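(* Let $0 < \kappa < 1$ and let $P_\kappa = \wp(\,\cdot\,; G_2, G_3)$ with $G_2 = 48(1 + 8\kappa^2)$ and $G_3 = 64(1 - 20\kappa^2 - 8\kappa^4)$. The period lattice of $P_\kappa$ is rectangular, generated by $2\Omega_\kappa$ and $2\Omega_\kappa'$ with $\Omega_\kappa > 0$ real and $\Omega_\kappa'$ purely imaginary with positive imaginary part. Then $$\Omega_\kappa = \tfrac{1}{2\sqrt6}\, \pi \,_2F_1 (\tfrac{1}{3}, \tfrac{2}{3}; 1; \kappa^2).$$
   Context: $\wp(\,\cdot\,; g_2, g_3)$ denotes the Weierstrass elliptic function with invariants $g_2, g_3$; $\,_2F_1$ is the Gauss hypergeometric function. *)

(* Defs.v *)
From Stdlib Require Import Reals ZArith.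
From Coquelicot Require Import Coquelicot.
Open Scope R_scope.

Fixpoint csum (f : nat -> C) (n : nat) : C :=
  match n with
  | O => f O
  | S k => Cplus (csum f k) (f (S k))
  end.

Fixpoint cpow (z : C) (k : nat) : C :=
  match k with
  | O => RtoC 1
  | S j => Cmult z (cpow z j)
  end.

Definition lat_pt (w1 w3 : C) (m n : Z) : C :=
  Cplus (Cmult (RtoC (2 * IZR m)) w1) (Cmult (RtoC (2 * IZR n)) w3).

Definition eisen_partial (k : nat) (w1 w3 : C) (N : nat) : C :=
  csum (fun i => csum (fun j =>
      let m := (Z.of_nat i - Z.of_nat N)%Z in
      let n := (Z.of_nat j - Z.of_nat N)%Z in
      if (Z.eqb m 0 && Z.eqb n 0)%bool then RtoC 0
      else Cinv (cpow (lat_pt w1 w3 m n) k)) (2 * N)) (2 * N).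

(* The (absolutely convergent for k >= 3) lattice sum
   sum_{omega in Lambda \ 0} omega^(-k) equals z. *)
Definition eisen_sum_is (k : nat) (w1 w3 : C) (z : C) : Prop :=
  is_lim_seq (fun N => Re (eisen_partial k w1 w3 N)) (Re z) /\
  is_lim_seq (fun N => Im (eisen_partial k w1 w3 N)) (Im z).

(* The lattice Lambda = 2 w1 Z + 2 w3 Z has Weierstrass invariants g2, g3:
   g2 = 60 sum' omega^-4, g3 = 140 sum' omega^-6.  Equivalently,
   wp(.; g2, g3) is the Weierstrass function of Lambda, i.e. Lambda is the
   period lattice of wp(.; g2, g3). *)
Definition has_invariants (w1 w3 : C) (g2 g3 : R) : Prop :=
  exists s4 s6 : C,
    eisen_sum_is 4 w1 w3 s4 /\ eisen_sum_is 6 w1 w3 s6 /\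
    Cmult (RtoC 60) s4 = RtoC g2 /\ Cmult (RtoC 140) s6 = RtoC g3.

Fixpoint pochhammer (a : R) (n : nat) : R :=
  match n with
  | O => 1
  | S k => pochhammer a k * (a + INR k)
  end.

Definition hyp2F1 (a b c x : R) : R :=
  Series (fun n => pochhammer a n * pochhammer b n
                   / (pochhammer c n * INR (fact n)) * x ^ n).

(* Main.v *)
Require Import Defs.
From Stdlib Require Import Reals ZArith Lra Lia Psatz.
From Coquelicot Require Import Coquelicot.
Open Scope R_scope.

(** Write the lattice as [s (L Z + i PI Z)].  Summing [(x + w)^-2] first along the imaginary direction turns
    the Weierstrass function on the real axis into the real series [sum_m csch^2 (x + m L)], up to an additive
    constant; the partial fractions of [coth] identify the Laurent coefficients at [0] with the Eisenstein sums.
    The product formula for [csch^2 a * csch^2 b] telescopes and yields [wp'' = 6 wp^2 - g2 / 2], hence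
    [wp'^2 = 4 wp^3 - g2 wp - g3].

    For the given invariants the cubic equals [4 W^3 + 8 (3 W + 8 (1 - kappa^2))^2] with [W = wp - 6].  The
    3-isogeny with kernel [W = 0] followed by [3 u - 4 u^3 = kappa sin t] turns the differential [dx] into
    [2F1(1/3, 2/3; 1/2; kappa^2 sin^2 t) dt / (3 sqrt 6)], because this hypergeometric function is
    [1 / (1 - 4 u^2)].  As [x] goes from [0] to [Om], [t] goes from [0] to [3 PI / 2], and integrating the
    power series term by term gives the formula.

    A lattice exists by the intermediate value theorem in [L]: the ratio [g3^2 / g2^3] is [0] for the square
    lattice and tends to [1 / 27] as [L] tends to infinity, and exchanging the two periods changes the sign
    of [g3]. *)

(** * Series of real functions *)

(** Everything stays on the real axis: the half period is reached as the first zero of the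
    derivative, at [L / 2] before scaling, so no function theory in the complex plane enters. The
    vertical period i PI is the one for which the row sums are derivatives of [coth]. The price is
    that Eisenstein sums, defined by square partial sums, must be linked to real series by hand:
    dominated convergence rearranges them into rows, and comparing Laurent coefficients identifies
    the constants of the differential equation.

    The shift by 6 moves a real 3-torsion point to W = 0: there the line y = 2 sqrt 2 (3 W + 8 (1 -
    kappa^2)) meets the cubic with multiplicity three. As this point is real, it is met inside the
    half period, at t = PI, and the half period becomes three quarter turns of t. Near the pole W
    behaves like x^-2 and t like 3 sqrt 6 x, whence the factor 3 sqrt 6; the quotient of 3 PI / 2 by
    it is PI / (2 sqrt 6). *)

Fixpoint psum (b : nat -> R) (k : nat) : R :=
  match k with
  | O => 0
  | S j => psum b j + b j
  end.

Lemma psum_S (b : nat -> R) (k : nat) : psum b (S k) = psum b k + b k.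
Proof. reflexivity. Qed.

Lemma psum_ext (a b : nat -> R) (k : nat) :
  (forall i, (i < k)%nat -> a i = b i) -> psum a k = psum b k.
Proof.
  induction k as [|k IH]; intros H; simpl; [reflexivity|].
  rewrite IH by (intros; apply H; lia). now rewrite H by lia.
Qed.

Lemma psum_plus (a b : nat -> R) (k : nat) :
  psum (fun i => a i + b i) k = psum a k + psum b k.
Proof. induction k; simpl; [ring|rewrite IHk; ring]. Qed.

Lemma psum_scal (c : R) (b : nat -> R) (k : nat) :
  psum (fun i => c * b i) k = c * psum b k.
Proof. induction k; simpl; [ring|rewrite IHk; ring]. Qed.

Lemma psum_zero (k : nat) : psum (fun _ => 0) k = 0.
Proof. induction k; simpl; lra. Qed.

Lemma psum_le (a b : nat -> R) (k : nat) :
  (forall i, (i < k)%nat -> a i <= b i) -> psum a k <= psum b k.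
Proof.
  induction k as [|k IH]; intros H; simpl; [lra|].
  apply Rplus_le_compat; [apply IH; intros; apply H|apply H]; lia.
Qed.

Lemma psum_abs (b : nat -> R) (k : nat) :
  Rabs (psum b k) <= psum (fun i => Rabs (b i)) k.
Proof.
  induction k as [|k IH]; simpl; [rewrite Rabs_R0; lra|].
  eapply Rle_trans; [apply Rabs_triang|lra].
Qed.

Lemma psum_shift (b : nat -> R) (k d : nat) :
  psum (fun i => b (i + d)%nat) k = psum b (k + d) - psum b d.
Proof. induction k; simpl; [ring|rewrite IHk; ring]. Qed.

Lemma psum_exchange (a : nat -> nat -> R) (k l : nat) :
  psum (fun i => psum (fun j => a i j) l) k = psum (fun j => psum (fun i => a i j) k) l.
Proof.
  induction k; simpl; [now rewrite psum_zero|].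
  now rewrite IHk, psum_plus.
Qed.

Lemma psum_sum_n (b : nat -> R) (k : nat) : sum_n b k = psum b (S k).
Proof.
  induction k; [rewrite sum_O; simpl; ring|].
  rewrite sum_Sn, IHk. reflexivity.
Qed.

Lemma psum_lim (b : nat -> R) (l : R) :
  is_series b l <-> is_lim_seq (psum b) l.
Proof.
  split; intros H.
  - apply is_lim_seq_incr_1.
    apply is_lim_seq_ext with (sum_n b); [apply psum_sum_n|exact H].
  - apply is_lim_seq_incr_1 in H.
    apply (is_lim_seq_ext _ (sum_n b)) in H; [exact H|].
    intros n; symmetry; apply psum_sum_n.
Qed.

Lemma psum_le_Series (b : nat -> R) (k : nat) :
  (forall n, 0 <= b n) -> ex_series b -> psum b k <= Series b.
Proof.
  intros Hb Hex. apply Series_correct, psum_lim in Hex.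
  apply (is_lim_seq_incr_compare (psum b) _ Hex).
  intros n; simpl. specialize (Hb n); lra.
Qed.

Lemma ex_series_scal_R (c : R) (b : nat -> R) :
  ex_series b -> ex_series (fun n => c * b n).
Proof. exact (@ex_series_scal R_AbsRing R_NormedModule c b). Qed.

Lemma ex_series_abs_le (a b : nat -> R) :
  (forall n, Rabs (a n) <= b n) -> ex_series b -> ex_series a.
Proof. intros H. apply (ex_series_le a b). exact H. Qed.

Lemma Series_abs_le (a b : nat -> R) :
  (forall n, Rabs (a n) <= b n) -> ex_series b -> Rabs (Series a) <= Series b.
Proof.
  intros H Hb. eapply Rle_trans; [apply Series_Rabs|apply Series_le; auto].
  - apply ex_series_abs_le with b; auto.
    intros n; now rewrite Rabs_Rabsolu.
  - intros n; split; [apply Rabs_pos|apply H].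
Qed.

Lemma Series_nonneg (b : nat -> R) :
  (forall n, 0 <= b n) -> ex_series b -> 0 <= Series b.
Proof.
  intros H Hb. apply (psum_le_Series b 0) in Hb; auto.
Qed.

Lemma Series_pos (b : nat -> R) :
  (forall n, 0 < b n) -> ex_series b -> 0 < Series b.
Proof.
  intros H Hb. apply (psum_le_Series b 1) in Hb; [|intros; now apply Rlt_le].
  simpl in Hb. specialize (H O); lra.
Qed.

(** Dominated by twice the telescoping series of 1 / (n + 1) - 1 / (n + 2). This is the majorant
    used for row sums, half sums and theta sums alike. *)
Lemma ex_series_inv_square : ex_series (fun n => / (INR n + 1) ^ 2).
Proof.
  set (b := fun n => / (INR n + 1) - / (INR n + 2)).
  assert (Hb : ex_series b).
  { exists 1. apply psum_lim.
    apply is_lim_seq_ext with (fun n => 1 - / (INR n + 1)).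
    - intros n; induction n.
      + simpl; field.
      + simpl psum. rewrite <- IHn. unfold b. rewrite S_INR.
        pose proof (pos_INR n). field; lra.
    - replace (Finite 1) with (Rbar_minus 1 0) by (simpl; f_equal; ring).
      apply is_lim_seq_minus'; [apply is_lim_seq_const|].
      apply is_lim_seq_ext with (fun n => / INR (S n)).
      { intros n; now rewrite S_INR. }
      apply (proj1 (is_lim_seq_incr_1 (fun n => / INR n) 0)).
      replace (Finite 0) with (Rbar_inv p_infty) by reflexivity.
      apply is_lim_seq_inv; [apply is_lim_seq_INR|discriminate]. }
  apply ex_series_abs_le with (fun n => 2 * b n); [|now apply ex_series_scal_R].
  intros n. unfold b. pose proof (pos_INR n) as Hn.
  assert (0 < / (INR n + 1) ^ 2) by (apply Rinv_0_lt_compat; nra).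
  rewrite Rabs_pos_eq by lra.
  replace (/ (INR n + 1) - / (INR n + 2)) with (/ ((INR n + 1) * (INR n + 2))) by (field; lra).
  apply Rmult_le_reg_r with ((INR n + 1) ^ 2 * (INR n + 2)); [nra|].
  replace (/ (INR n + 1) ^ 2 * ((INR n + 1) ^ 2 * (INR n + 2))) with (INR n + 2) by (field; lra).
  replace (2 * / ((INR n + 1) * (INR n + 2)) * ((INR n + 1) ^ 2 * (INR n + 2)))
    with (2 * (INR n + 1)) by (field; lra).
  lra.
Qed.

Lemma ex_series_inv_square_scal (c : R) : ex_series (fun n => c * / (INR n + 1) ^ 2).
Proof. apply ex_series_scal_R, ex_series_inv_square. Qed.

(** Dominated convergence for sums in which both the terms and their number depend on [N]: the first
    [n] terms converge one by one, the others are bounded by the tail of [M]. The condition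
    [N <= K N] makes every index enter eventually. It serves both for the square of the periodic sum
    and for the square partial Eisenstein sums. *)
Lemma tannery (a : nat -> nat -> R) (l M : nat -> R) (K : nat -> nat) :
  (forall N, (N <= K N)%nat) ->
  (forall N n, (n < K N)%nat -> Rabs (a N n) <= M n) ->
  (forall n, is_lim_seq (fun N => a N n) (l n)) ->
  ex_series M ->
  is_lim_seq (fun N => psum (a N) (K N)) (Series l).
Proof.
  intros HK HM Hl Hex.
  assert (HlM : forall n, Rabs (l n) <= M n).
  { intros n. change (Rbar_le (Rabs (l n)) (M n)).
    apply is_lim_seq_le_loc with (u := fun N => Rabs (a N n)) (v := fun _ => M n).
    - exists (S n). intros N HN. apply HM. specialize (HK N); lia.
    - apply (is_lim_seq_abs _ (Finite (l n))), Hl.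
    - apply is_lim_seq_const. }
  assert (Hexl : ex_series l) by (apply ex_series_abs_le with M; auto).
  assert (HM0 : forall n, 0 <= M n)
    by (intros n; eapply Rle_trans; [apply Rabs_pos|apply HlM]).
  pose proof (proj1 (psum_lim _ _) (Series_correct _ Hexl)) as Sl.
  pose proof (proj1 (psum_lim _ _) (Series_correct _ Hex)) as SM.
  assert (Hpl : forall n, is_lim_seq (fun N => psum (a N) n) (psum l n)).
  { induction n; simpl; [apply is_lim_seq_const|].
    apply (is_lim_seq_plus' _ _ _ _ IHn (Hl n)). }
  assert (tail : forall N n k, (n + k <= K N)%nat ->
    Rabs (psum (a N) (n + k) - psum (a N) n) <= psum M (n + k) - psum M n).
  { induction k; intros Hk.
    - rewrite Nat.add_0_r, !Rminus_diag, Rabs_R0; lra.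
    - rewrite Nat.add_succ_r; simpl.
      replace (psum (a N) (n + k) + a N (n + k)%nat - psum (a N) n)
        with ((psum (a N) (n + k) - psum (a N) n) + a N (n + k)%nat) by ring.
      eapply Rle_trans; [apply Rabs_triang|].
      assert (Rabs (a N (n + k)%nat) <= M (n + k)%nat) by (apply HM; lia).
      assert (Rabs (psum (a N) (n + k) - psum (a N) n) <= psum M (n + k) - psum M n)
        by (apply IHk; lia).
      lra. }
  apply is_lim_seq_spec. intros eps.
  assert (He : 0 < eps / 3) by (destruct eps; simpl; lra).
  apply is_lim_seq_spec in Sl. destruct (Sl (mkposreal _ He)) as [n1 Hn1].
  apply is_lim_seq_spec in SM. destruct (SM (mkposreal _ He)) as [n2 Hn2].
  set (n := max n1 n2).
  pose proof (Hpl n) as Hp. apply is_lim_seq_spec in Hp.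
  destruct (Hp (mkposreal _ He)) as [N0 HN0].
  exists (max N0 n). intros N HN.
  assert (HNn : (n <= K N)%nat) by (specialize (HK N); lia).
  specialize (tail N n (K N - n)%nat ltac:(lia)).
  replace (n + (K N - n))%nat with (K N) in tail by lia.
  specialize (Hn1 n ltac:(unfold n; lia)). specialize (Hn2 n ltac:(unfold n; lia)).
  specialize (HN0 N ltac:(lia)). simpl in Hn1, Hn2, HN0.
  pose proof (psum_le_Series M (K N) HM0 Hex) as HSM.
  apply Rabs_def2 in Hn1; apply Rabs_def2 in Hn2; apply Rabs_def2 in HN0.
  apply Rabs_le_between in tail.
  apply Rabs_def1; lra.
Qed.

Lemma is_derive_of_quadratic_error (g : R -> R) (x l K d : R) :
  0 < d ->
  (forall y, Rabs (y - x) < d -> Rabs (g y - g x - (y - x) * l) <= K * (y - x) ^ 2) ->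
  is_derive g x l.
Proof.
  intros Hd H. apply is_derive_Reals. intros eps Heps.
  set (K' := Rabs K + 1).
  assert (HK' : 0 < K') by (unfold K'; pose proof (Rabs_pos K); lra).
  assert (Hmin : 0 < Rmin d (eps / K')).
  { apply Rmin_pos; auto. apply Rdiv_lt_0_compat; auto. }
  exists (mkposreal _ Hmin). intros t Ht0 Ht; simpl in Ht.
  assert (Ht1 : Rabs t < d) by (eapply Rlt_le_trans; [exact Ht|apply Rmin_l]).
  assert (Ht2 : Rabs t < eps / K') by (eapply Rlt_le_trans; [exact Ht|apply Rmin_r]).
  specialize (H (x + t)). replace (x + t - x) with t in H by ring. specialize (H Ht1).
  replace ((g (x + t) - g x) / t - l) with ((g (x + t) - g x - t * l) / t) by (field; auto).
  unfold Rdiv. rewrite Rabs_mult, Rabs_inv.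
  assert (Hat : 0 < Rabs t) by now apply Rabs_pos_lt.
  apply Rmult_lt_reg_r with (Rabs t); auto.
  rewrite Rmult_assoc, Rinv_l, Rmult_1_r by lra.
  eapply Rle_lt_trans; [exact H|].
  rewrite <- (pow2_abs t).
  apply Rle_lt_trans with (K' * Rabs t ^ 2).
  { apply Rmult_le_compat_r; [apply pow2_ge_0|unfold K'; pose proof (Rle_abs K); lra]. }
  assert (Rabs t * K' < eps).
  { apply Rmult_lt_reg_r with (/ K'); [now apply Rinv_0_lt_compat|].
    rewrite Rmult_assoc, Rinv_r, Rmult_1_r by lra. exact Ht2. }
  nra.
Qed.

Lemma mvt_bound (g dg : R -> R) (x y M : R) :
  (forall z, Rmin x y <= z <= Rmax x y -> is_derive g z (dg z)) ->
  (forall z, Rmin x y <= z <= Rmax x y -> Rabs (dg z) <= M) ->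
  Rabs (g y - g x) <= M * Rabs (y - x).
Proof.
  intros Hd HM.
  destruct (MVT_gen g x y dg) as [c [Hc ->]].
  - intros z Hz; apply Hd; lra.
  - intros z Hz. apply derivable_continuous_pt. exists (dg z). now apply is_derive_Reals, Hd.
  - rewrite Rabs_mult. apply Rmult_le_compat_r; [apply Rabs_pos|auto].
Qed.

(** A summable bound on the second derivatives makes the Taylor error of the sum quadratic, so no
    uniform convergence of the derived series has to be discussed. *)
Lemma is_derive_Series (u u1 u2 : nat -> R -> R) (M : nat -> R) (x d : R) :
  0 < d ->
  (forall n y, Rabs (y - x) < d -> is_derive (u n) y (u1 n y)) ->
  (forall n y, Rabs (y - x) < d -> is_derive (u1 n) y (u2 n y)) ->
  (forall n y, Rabs (y - x) < d -> Rabs (u2 n y) <= M n) ->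
  (forall y, Rabs (y - x) < d -> ex_series (fun n => u n y)) ->
  ex_series (fun n => u1 n x) ->
  ex_series M ->
  is_derive (fun y => Series (fun n => u n y)) x (Series (fun n => u1 n x)).
Proof.
  intros Hd H1 H2 HM Hu Hu1 HexM.
  apply is_derive_of_quadratic_error with (K := Series M) (d := d); auto.
  intros y Hy.
  assert (Hx : Rabs (x - x) < d) by (rewrite Rminus_diag, Rabs_R0; auto).
  rewrite <- Series_scal_l, <- Series_minus by auto.
  rewrite <- Series_minus; [|now apply (ex_series_minus (fun n => u n y) (fun n => u n x)); auto
                            |now apply ex_series_scal_R].
  rewrite Rmult_comm, <- Series_scal_l.
  apply Series_abs_le; [|now apply ex_series_scal_R].
  intros n.
  assert (Hb : forall z, Rmin x y <= z <= Rmax x y ->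
             Rabs (z - x) <= Rabs (y - x)).
  { intros z. unfold Rmin, Rmax; destruct (Rle_dec x y); intros Hz.
    - rewrite !Rabs_pos_eq; lra.
    - rewrite !Rabs_left1; lra. }
  replace (u n y - u n x - (y - x) * u1 n x)
    with ((u n y - y * u1 n x) - (u n x - x * u1 n x)) by ring.
  eapply Rle_trans.
  (* Mean value theorem twice: once the tangent is subtracted, the derivative [u1 n z - u1 n x] is
     itself at most [M n] times the distance. *)
  - apply mvt_bound with (g := fun z => u n z - z * u1 n x)
      (dg := fun z => u1 n z - u1 n x) (M := M n * Rabs (y - x)).
    + intros z Hz. specialize (Hb z Hz).
      apply (is_derive_minus (u n)).
      * apply H1; lra.
      * auto_derive; [auto|ring].
    + intros z Hz. pose proof (Hb z Hz) as Hbz.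
      eapply Rle_trans.
      * apply mvt_bound with (g := u1 n) (dg := u2 n) (M := M n).
        -- intros t Ht. apply H2.
           apply Rle_lt_trans with (Rabs (y - x)); auto. apply Hb.
           revert Hz Ht. unfold Rmin, Rmax.
           destruct (Rle_dec x y); destruct (Rle_dec x z); lra.
        -- intros t Ht. apply HM.
           apply Rle_lt_trans with (Rabs (y - x)); auto. apply Hb.
           revert Hz Ht. unfold Rmin, Rmax.
           destruct (Rle_dec x y); destruct (Rle_dec x z); lra.
      * apply Rmult_le_compat_l; auto.
        eapply Rle_trans; [apply Rabs_pos|apply (HM n x Hx)].
  - rewrite Rmult_assoc, Rmult_comm. apply Rmult_le_compat_r.
    + eapply Rle_trans; [apply Rabs_pos|apply (HM n x Hx)].
    + rewrite <- (pow2_abs (y - x)). lra.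
Qed.

(** * Hyperbolic functions *)

Definition coth (y : R) : R := cosh y / sinh y.

Definition csch2 (y : R) : R := / (sinh y) ^ 2.

Lemma nonneg_of_derive (g dg : R -> R) :
  g 0 = 0 -> (forall x, is_derive g x (dg x)) -> (forall x, 0 <= x -> 0 <= dg x) ->
  forall x, 0 <= x -> 0 <= g x.
Proof.
  intros H0 Hd Hp x Hx.
  destruct (MVT_gen g 0 x dg) as [c [Hc Heq]].
  - intros; auto.
  - intros z _. apply derivable_continuous_pt. exists (dg z). now apply is_derive_Reals.
  - rewrite Rmin_left, Rmax_right in Hc by lra.
    specialize (Hp c (proj1 Hc)). nra.
Qed.

Lemma cosh_pos (x : R) : 0 < cosh x.
Proof. unfold cosh. pose proof (exp_pos x); pose proof (exp_pos (- x)); lra. Qed.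

Lemma sinh_nonneg (x : R) : 0 <= x -> 0 <= sinh x.
Proof.
  intros [Hx| <-]; [|rewrite sinh_0; lra].
  pose proof (sinh_lt 0 x Hx) as H. rewrite sinh_0 in H. lra.
Qed.

Lemma sinh_pos (x : R) : 0 < x -> 0 < sinh x.
Proof. intros Hx. pose proof (sinh_lt 0 x Hx) as H. now rewrite sinh_0 in H. Qed.

Lemma cosh_sq (x : R) : cosh x ^ 2 = 1 + sinh x ^ 2.
Proof.
  unfold cosh, sinh. assert (exp x * exp (- x) = 1) by (rewrite <- exp_plus, Rplus_opp_r; apply exp_0).
  field_simplify. nra.
Qed.

Lemma sinh_le_mul_cosh (z : R) : 0 <= z -> sinh z <= z * cosh z.
Proof.
  intros Hz.
  enough (0 <= z * cosh z - sinh z) by lra. revert z Hz.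
  apply nonneg_of_derive with (fun z => z * sinh z).
  - rewrite sinh_0; ring.
  - intros x. auto_derive; [auto|ring].
  - intros x Hx. apply Rmult_le_pos; auto. now apply sinh_nonneg.
Qed.

Lemma sinh_ge_id (z : R) : 0 <= z -> z <= sinh z.
Proof.
  intros Hz.
  enough (0 <= sinh z - z) by lra. revert z Hz.
  apply nonneg_of_derive with (fun z => cosh z - 1).
  - rewrite sinh_0; ring.
  - intros x. auto_derive; [auto|ring].
  - intros x Hx. pose proof (cosh_sq x). pose proof (cosh_pos x).
    pose proof (pow2_ge_0 (sinh x)). nra.
Qed.

Lemma sinh_ge_half_sq (z : R) : 0 <= z -> z ^ 2 / 2 <= sinh z.
Proof.
  intros Hz.
  enough (0 <= sinh z - z ^ 2 / 2) by lra. revert z Hz.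
  apply nonneg_of_derive with (fun z => cosh z - z).
  - rewrite sinh_0; field.
  - intros x. auto_derive; [auto|field].
  - intros x Hx. pose proof (cosh_sq x). pose proof (cosh_pos x).
    pose proof (sinh_ge_id x Hx). nra.
Qed.

Lemma mul_cos_le_sin (t : R) : 0 <= t <= PI / 2 -> t * cos t <= sin t.
Proof.
  intros Ht.
  destruct (MVT_gen (fun t => sin t - t * cos t) 0 t (fun t => t * sin t)) as [c [Hc Heq]].
  - intros z _. auto_derive; [auto|ring].
  - intros z _. apply derivable_continuous_pt. exists (z * sin z).
    apply is_derive_Reals. auto_derive; [auto|ring].
  - rewrite Rmin_left, Rmax_right in Hc by lra.
    rewrite sin_0 in Heq. pose proof PI_RGT_0.
    assert (0 <= sin c) by (apply sin_ge_0; lra).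
    assert (0 <= c * sin c) by nra. nra.
Qed.

(** * The partial fraction expansion of the hyperbolic cotangent *)

(* [cosh_int] is a constant times a partial product quotient of
   [sinh (PI x / 2) = (PI x / 2) prod (1 + x^2 / (2 k)^2)], and [sinh_int] is its derivative in [x]:
   the quotient of the two telescopes to the partial fractions of [coth]. *)
Definition cosh_int (x : R) (n : nat) : R := RInt (fun t => cosh (x * t) * cos t ^ n) 0 (PI / 2).

Definition sinh_int (x : R) (n : nat) : R :=
  RInt (fun t => t * sinh (x * t) * cos t ^ n) 0 (PI / 2).

Lemma ex_cosh_int (x : R) (n : nat) (a b : R) :
  ex_RInt (fun t => cosh (x * t) * cos t ^ n) a b.
Proof.
  apply (ex_RInt_continuous (V := R_CompleteNormedModule)). intros z _.
  apply (ex_derive_continuous (K := R_AbsRing) (V := R_NormedModule)). auto_derive. auto.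
Qed.

Lemma ex_sinh_int (x : R) (n : nat) (a b : R) :
  ex_RInt (fun t => t * sinh (x * t) * cos t ^ n) a b.
Proof.
  apply (ex_RInt_continuous (V := R_CompleteNormedModule)). intros z _.
  apply (ex_derive_continuous (K := R_AbsRing) (V := R_NormedModule)). auto_derive. auto.
Qed.

Lemma RInt_of_derive (g dg : R -> R) (a b : R) :
  (forall x, is_derive g x (dg x)) -> (forall x, ex_derive dg x) ->
  is_RInt dg a b (g b - g a).
Proof.
  intros H1 H2. apply (is_RInt_derive (V := R_CompleteNormedModule) g dg).
  - intros; auto.
  - intros; apply (ex_derive_continuous (K := R_AbsRing) (V := R_NormedModule)); auto.
Qed.

(** Two integrations by parts, packaged as one antiderivative [G] of the difference [D]; its
    boundary values vanish because cos is 0 at PI / 2 and sin and sinh are 0 at 0. *)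
Lemma cosh_int_rec (x : R) (n : nat) :
  ((INR n + 2) ^ 2 + x ^ 2) * cosh_int x (S (S n)) = (INR n + 2) * (INR n + 1) * cosh_int x n.
Proof.
  unfold cosh_int.
  set (D := fun t => ((INR n + 2) ^ 2 + x ^ 2) * (cosh (x * t) * cos t ^ S (S n))
     - (INR n + 2) * (INR n + 1) * (cosh (x * t) * cos t ^ n)).
  assert (H0 : is_RInt D 0 (PI / 2) 0).
  { set (G := fun t => (INR n + 2) * cosh (x * t) * cos t ^ S n * sin t
                        + x * sinh (x * t) * cos t ^ S (S n)).
    replace 0 with (G (PI / 2) - G 0) at 2.
    - apply RInt_of_derive.
      + intros t. unfold G, D. auto_derive; [auto|].
        replace (INR (S (S n))) with (INR n + 2) by (rewrite !S_INR; ring).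
        replace (match n with O => 1 | S _ => INR n + 1 end) with (INR n + 1)
          by (destruct n; simpl; lra).
        simpl pow. assert (E : sin t * sin t = 1 - cos t * cos t).
        { pose proof (sin2_cos2 t); unfold Rsqr in *; lra. }
        ring [E].
      + intros t. unfold D. auto_derive. auto.
    - unfold G. rewrite cos_PI2, sin_0, (Rmult_0_r x), sinh_0. simpl. ring. }
  assert (H1 : is_RInt D 0 (PI / 2)
    (((INR n + 2) ^ 2 + x ^ 2) * RInt (fun t => cosh (x * t) * cos t ^ S (S n)) 0 (PI / 2)
     - (INR n + 2) * (INR n + 1) * RInt (fun t => cosh (x * t) * cos t ^ n) 0 (PI / 2))).
  { apply (is_RInt_minus (V := R_NormedModule)); apply (is_RInt_scal (V := R_NormedModule));
      apply (RInt_correct (V := R_CompleteNormedModule)); apply ex_cosh_int. }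
  pose proof (is_RInt_unique _ _ _ _ H0). pose proof (is_RInt_unique _ _ _ _ H1). lra.
Qed.

(** The derivative in [x] of the recurrence for [cosh_int]; [G] is likewise the derivative in [x] of
    the antiderivative used there. *)
Lemma sinh_int_rec (x : R) (n : nat) :
  ((INR n + 2) ^ 2 + x ^ 2) * sinh_int x (S (S n)) + 2 * x * cosh_int x (S (S n))
    = (INR n + 2) * (INR n + 1) * sinh_int x n.
Proof.
  unfold cosh_int, sinh_int.
  set (D := fun t => (((INR n + 2) ^ 2 + x ^ 2) * (t * sinh (x * t) * cos t ^ S (S n))
     + 2 * x * (cosh (x * t) * cos t ^ S (S n)))
     - (INR n + 2) * (INR n + 1) * (t * sinh (x * t) * cos t ^ n)).
  assert (H0 : is_RInt D 0 (PI / 2) 0).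
  { set (G := fun t => (INR n + 2) * (t * sinh (x * t)) * cos t ^ S n * sin t
                        + (sinh (x * t) + x * (t * cosh (x * t))) * cos t ^ S (S n)).
    replace 0 with (G (PI / 2) - G 0) at 2.
    - apply RInt_of_derive.
      + intros t. unfold G, D. auto_derive; [auto|].
        replace (INR (S (S n))) with (INR n + 2) by (rewrite !S_INR; ring).
        replace (match n with O => 1 | S _ => INR n + 1 end) with (INR n + 1)
          by (destruct n; simpl; lra).
        simpl pow. assert (E : sin t * sin t = 1 - cos t * cos t).
        { pose proof (sin2_cos2 t); unfold Rsqr in *; lra. }
        ring [E].
      + intros t. unfold D. auto_derive. auto.
    - unfold G. rewrite cos_PI2, sin_0, (Rmult_0_r x), sinh_0. simpl. ring. }
  assert (H1 : is_RInt D 0 (PI / 2)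
    ((((INR n + 2) ^ 2 + x ^ 2) * RInt (fun t => t * sinh (x * t) * cos t ^ S (S n)) 0 (PI / 2)
      + 2 * x * RInt (fun t => cosh (x * t) * cos t ^ S (S n)) 0 (PI / 2))
     - (INR n + 2) * (INR n + 1) * RInt (fun t => t * sinh (x * t) * cos t ^ n) 0 (PI / 2))).
  { apply (is_RInt_minus (V := R_NormedModule)); [apply (is_RInt_plus (V := R_NormedModule))|];
    apply (is_RInt_scal (V := R_NormedModule));
      apply (RInt_correct (V := R_CompleteNormedModule)); auto using ex_cosh_int, ex_sinh_int. }
  pose proof (is_RInt_unique _ _ _ _ H0). pose proof (is_RInt_unique _ _ _ _ H1). lra.
Qed.

Lemma cosh_int_pos (x : R) (n : nat) : 0 < cosh_int x n.
Proof.
  apply RInt_gt_0.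
  - pose proof PI_RGT_0; lra.
  - intros t Ht. apply Rmult_lt_0_compat; [apply cosh_pos|].
    apply pow_lt, cos_gt_0; lra.
  - intros t _. apply (ex_derive_continuous (K := R_AbsRing) (V := R_NormedModule)). auto_derive. auto.
Qed.

Lemma sinh_int_nonneg (x : R) (n : nat) : 0 < x -> 0 <= sinh_int x n.
Proof.
  intros Hx. apply RInt_ge_0; [pose proof PI_RGT_0; lra|apply ex_sinh_int|].
  intros t Ht. apply Rmult_le_pos; [apply Rmult_le_pos; [lra|apply sinh_nonneg; nra]|].
  apply pow_le, cos_ge_0; lra.
Qed.

(** Holds under the integral sign, by sinh z <= z cosh z and t cos t <= sin t. By [cosh_int_rec] the
    right-hand side is of order 1 / n relative to [cosh_int x (S (S n))], so the ratio of the two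
    integrals tends to 0. *)
Lemma sinh_int_le (x : R) (n : nat) : 0 < x ->
  sinh_int x (S (S n)) <= x * (cosh_int x n - cosh_int x (S (S n))).
Proof.
  intros Hx. unfold sinh_int, cosh_int.
  assert (H1 : is_RInt (fun t => x * (cosh (x * t) * cos t ^ n - cosh (x * t) * cos t ^ S (S n)))
    0 (PI / 2) (x * (cosh_int x n - cosh_int x (S (S n))))).
  { apply (is_RInt_scal (V := R_NormedModule)), (is_RInt_minus (V := R_NormedModule));
      apply (RInt_correct (V := R_CompleteNormedModule)), ex_cosh_int. }
  unfold cosh_int in H1. rewrite <- (is_RInt_unique _ _ _ _ H1).
  apply RInt_le.
  - pose proof PI_RGT_0; lra.
  - apply ex_sinh_int.
  - eexists; exact H1.
  - intros t Ht.
    assert (Hc : 0 <= cos t) by (apply cos_ge_0; lra).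
    pose proof (pow_le _ n Hc) as Hp.
    pose proof (sinh_le_mul_cosh (x * t) ltac:(nra)) as Hs.
    pose proof (mul_cos_le_sin t ltac:(lra)) as Ht1.
    pose proof (cosh_pos (x * t)) as Hch.
    assert (Ht2 : (t * cos t) ^ 2 <= 1 - cos t ^ 2).
    { pose proof (sin2_cos2 t) as E. unfold Rsqr in E.
      assert (0 <= t * cos t) by nra.
      replace (1 - cos t ^ 2) with (sin t ^ 2) by (simpl; lra).
      apply pow_incr; lra. }
    simpl pow.
    replace (t * sinh (x * t) * (cos t * (cos t * cos t ^ n)))
      with (cos t ^ n * (t * (cos t * cos t) * sinh (x * t))) by ring.
    replace (x * (cosh (x * t) * cos t ^ n - cosh (x * t) * (cos t * (cos t * cos t ^ n))))
      with (cos t ^ n * (x * cosh (x * t) * (1 - cos t ^ 2))) by (simpl; ring).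
    apply Rmult_le_compat_l; auto.
    apply Rle_trans with (t * (cos t * cos t) * (x * t * cosh (x * t))).
    + apply Rmult_le_compat_l; [apply Rmult_le_pos; nra|auto].
    + replace (t * (cos t * cos t) * (x * t * cosh (x * t)))
        with (x * cosh (x * t) * (t * cos t) ^ 2) by ring.
      apply Rmult_le_compat_l; [nra|auto].
Qed.

(** [cosh_int x 0] equals sinh (PI x / 2) / x, and the ratio is its logarithmic derivative. *)
Lemma sinh_int_0 (x : R) : 0 < x ->
  sinh_int x 0 / cosh_int x 0 = PI / 2 * coth (PI / 2 * x) - / x.
Proof.
  intros Hx.
  assert (Hc : cosh_int x 0 = sinh (PI / 2 * x) / x).
  { unfold cosh_int. apply is_RInt_unique.
    replace (sinh (PI / 2 * x) / x) with (sinh (x * (PI / 2)) / x - sinh (x * 0) / x).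
    - apply (RInt_of_derive (fun t => sinh (x * t) / x)).
      + intros t. auto_derive; [lra|simpl; field; lra].
      + intros t. auto_derive. auto.
    - rewrite Rmult_0_r, sinh_0, (Rmult_comm x). field. lra. }
  assert (Hs : sinh_int x 0 = PI / 2 * cosh (PI / 2 * x) / x - sinh (PI / 2 * x) / x ^ 2).
  { unfold sinh_int. apply is_RInt_unique.
    set (G := fun t => t * cosh (x * t) / x - sinh (x * t) / x ^ 2).
    replace (PI / 2 * cosh (PI / 2 * x) / x - sinh (PI / 2 * x) / x ^ 2) with (G (PI / 2) - G 0).
    - apply (RInt_of_derive G).
      + intros t. unfold G. auto_derive; [nra|simpl; field; lra].
      + intros t. auto_derive. auto.
    - unfold G. rewrite Rmult_0_r, sinh_0, (Rmult_comm x). field. lra. }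
  rewrite Hc, Hs. unfold coth.
  assert (0 < sinh (PI / 2 * x)) by (apply sinh_pos; pose proof PI_RGT_0; nra).
  field. split; lra.
Qed.

Lemma sinh_int_ratio_lim (x : R) : 0 < x ->
  is_lim_seq (fun k => sinh_int x (2 * k) / cosh_int x (2 * k)) 0.
Proof.
  intros Hx. apply is_lim_seq_incr_1.
  apply is_lim_seq_le_le with (u := fun _ => 0)
    (w := fun n => x * (2 + x ^ 2) * / INR (S n)).
  - intros k. replace (2 * S k)%nat with (S (S (2 * k))) by lia.
    set (n := (2 * k)%nat).
    pose proof (cosh_int_pos x (S (S n))) as HI. pose proof (cosh_int_pos x n) as HI0.
    pose proof (sinh_int_nonneg x (S (S n)) Hx) as HJ.
    pose proof (sinh_int_le x n Hx) as HJ2.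
    pose proof (cosh_int_rec x n) as Hrec.
    assert (Hn : INR k <= INR n) by (apply le_INR; unfold n; lia).
    pose proof (pos_INR k) as Hk.
    split; [apply Rdiv_le_0_compat; auto|].
    apply Rmult_le_reg_r with (cosh_int x (S (S n))); auto.
    unfold Rdiv at 1. rewrite Rmult_assoc, Rinv_l, Rmult_1_r by lra.
    eapply Rle_trans; [exact HJ2|].
    set (I2 := cosh_int x (S (S n))) in *. set (I0 := cosh_int x n) in *.
    replace (I0 - I2) with ((INR n + 2 + x ^ 2) / ((INR n + 2) * (INR n + 1)) * I2).
    2: { apply Rmult_eq_reg_l with ((INR n + 2) * (INR n + 1)); [|nra].
         rewrite Rmult_minus_distr_l, <- Hrec. field. lra. }
    rewrite !Rmult_assoc. apply Rmult_le_compat_l; [lra|].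
    rewrite <- !Rmult_assoc. apply Rmult_le_compat_r; [lra|].
    rewrite S_INR.
    apply Rmult_le_reg_r with ((INR n + 2) * (INR n + 1) * (INR k + 1)); [nra|].
    replace ((INR n + 2 + x ^ 2) / ((INR n + 2) * (INR n + 1)) * ((INR n + 2) * (INR n + 1) * (INR k + 1)))
      with ((INR n + 2 + x ^ 2) * (INR k + 1)) by (field; nra).
    replace ((2 + x ^ 2) * / (INR k + 1) * ((INR n + 2) * (INR n + 1) * (INR k + 1)))
      with ((2 + x ^ 2) * ((INR n + 2) * (INR n + 1))) by (field; nra).
    pose proof (pow2_ge_0 x) as Hx2.
    apply Rle_trans with ((INR n + 2 + x ^ 2) * (INR n + 1)); [nra|].
    rewrite <- Rmult_assoc. apply Rmult_le_compat_r; nra.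
  - apply is_lim_seq_const.
  - replace (Finite 0) with (Rbar_mult (x * (2 + x ^ 2)) 0) by (simpl; f_equal; ring).
    apply is_lim_seq_scal_l.
    apply (proj1 (is_lim_seq_incr_1 (fun n => / INR n) 0)).
    replace (Finite 0) with (Rbar_inv p_infty) by reflexivity.
    apply is_lim_seq_inv; [apply is_lim_seq_INR|discriminate].
Qed.

(** Dividing [sinh_int_rec] by [cosh_int_rec] raises the index by two at the cost of one partial
    fraction; after [k] terms the remainder is 2 / PI times the ratio of the integrals of index 2
    k. *)
Lemma coth_partial_fractions (y : R) : 0 < y ->
  is_series (fun n => 2 * (y / (y ^ 2 + (PI * (INR n + 1)) ^ 2))) (coth y - / y).
Proof.
  intros Hy. pose proof PI_RGT_0 as HPI.
  set (x := 2 * y / PI).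
  assert (Hx : 0 < x) by (apply Rdiv_lt_0_compat; lra).
  assert (Hxy : PI / 2 * x = y) by (unfold x; field; lra).
  apply psum_lim.
  apply is_lim_seq_ext with
    (fun k => coth y - / y - 2 / PI * (sinh_int x (2 * k) / cosh_int x (2 * k))).
  - intros k. induction k.
    + simpl Nat.mul. rewrite sinh_int_0, Hxy by auto. simpl.
      unfold x. field. lra.
    + rewrite psum_S, <- IHk.
      replace (2 * S k)%nat with (S (S (2 * k))) by lia.
      set (n := (2 * k)%nat).
      pose proof (cosh_int_pos x (S (S n))) as HI. pose proof (cosh_int_pos x n) as HI0.
      pose proof (cosh_int_rec x n) as H1. pose proof (sinh_int_rec x n) as H2.
      assert (Hn : INR n = 2 * INR k) by (unfold n; rewrite mult_INR; simpl; ring).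
      pose proof (pos_INR k) as Hk.
      assert (Hr : sinh_int x n / cosh_int x n
        = sinh_int x (S (S n)) / cosh_int x (S (S n)) + 2 * x / ((INR n + 2) ^ 2 + x ^ 2)).
      { set (a := (INR n + 2) ^ 2 + x ^ 2) in *. set (b := (INR n + 2) * (INR n + 1)) in *.
        assert (0 < a) by (unfold a; nra). assert (0 < b) by (unfold b; nra).
        replace (sinh_int x n) with ((a * sinh_int x (S (S n)) + 2 * x * cosh_int x (S (S n))) / b)
          by (rewrite H2; field; lra).
        replace (cosh_int x n) with (a * cosh_int x (S (S n)) / b) by (rewrite H1; field; lra).
        field. repeat split; lra. }
      rewrite Hr, Hn.
      replace (2 * (y / (y ^ 2 + (PI * (INR k + 1)) ^ 2)))
        with (2 / PI * (2 * x / ((2 * INR k + 2) ^ 2 + x ^ 2))); [ring|].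
      unfold x. field. repeat split; nra.
  - replace (Finite (coth y - / y)) with (Rbar_minus (coth y - / y) (Rbar_mult (2 / PI) 0))
      by (simpl; f_equal; ring).
    apply is_lim_seq_minus'; [apply is_lim_seq_const|].
    replace (2 / PI * 0) with 0 by ring.
    replace (Finite 0) with (Rbar_mult (2 / PI) 0) by (simpl; f_equal; ring).
    apply is_lim_seq_scal_l, sinh_int_ratio_lim, Hx.
Qed.

(** * Row sums of the lattice *)

Definition inv_pow (k : nat) (x y : R) : C := cpow (Cinv (x, y)) k.

(** The derivative of z^-k along the real direction is -k z^(-k-1). Both parts go through the
    induction together, because multiplication by 1 / z mixes them. *)
Lemma is_derive_inv_pow (k : nat) (x y : R) : y <> 0 ->
  is_derive (fun x => Re (inv_pow k x y)) x (- INR k * Re (inv_pow (S k) x y)) /\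
  is_derive (fun x => Im (inv_pow k x y)) x (- INR k * Im (inv_pow (S k) x y)).
Proof.
  intros Hy. assert (Hxy : forall z : R, z ^ 2 + y ^ 2 <> 0).
  { intros z. assert (0 < y ^ 2) by (apply pow2_gt_0; auto). pose proof (pow2_ge_0 z). lra. }
  induction k as [|k [IHr IHi]].
  - split; simpl; [apply is_derive_ext with (fun _ => 1)|apply is_derive_ext with (fun _ => 0)];
      try reflexivity; replace (- 0 * _) with 0 by ring; apply @is_derive_const.
  - set (cr := fun x => x / (x ^ 2 + y ^ 2)). set (ci := fun x => - y / (x ^ 2 + y ^ 2)).
    assert (Dr : is_derive cr x (- (cr x * cr x - ci x * ci x))).
    { unfold cr, ci. pose proof (Hxy x) as Hx. auto_derive; [exact Hx|field; exact Hx]. }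
    assert (Di : is_derive ci x (- (2 * cr x * ci x))).
    { unfold cr, ci. pose proof (Hxy x) as Hx. auto_derive; [exact Hx|field; exact Hx]. }
    assert (ER : forall j z, Re (inv_pow (S j) z y)
      = cr z * Re (inv_pow j z y) - ci z * Im (inv_pow j z y)) by reflexivity.
    assert (EI : forall j z, Im (inv_pow (S j) z y)
      = cr z * Im (inv_pow j z y) + ci z * Re (inv_pow j z y)) by reflexivity.
    split.
    + apply is_derive_ext with (1 := fun z => eq_sym (ER k z)).
      replace (- INR (S k) * Re (inv_pow (S (S k)) x y)) with
        ((- (cr x * cr x - ci x * ci x) * Re (inv_pow k x y) + cr x * (- INR k * Re (inv_pow (S k) x y)))
         - (- (2 * cr x * ci x) * Im (inv_pow k x y) + ci x * (- INR k * Im (inv_pow (S k) x y)))).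
      2: { rewrite S_INR, (ER (S k)), (ER k), (EI k). ring. }
      apply (is_derive_minus (V := R_NormedModule));
        apply (is_derive_mult (K := R_AbsRing)); auto; exact Rmult_comm.
    + apply is_derive_ext with (1 := fun z => eq_sym (EI k z)).
      replace (- INR (S k) * Im (inv_pow (S (S k)) x y)) with
        ((- (cr x * cr x - ci x * ci x) * Im (inv_pow k x y) + cr x * (- INR k * Im (inv_pow (S k) x y)))
         + (- (2 * cr x * ci x) * Re (inv_pow k x y) + ci x * (- INR k * Re (inv_pow (S k) x y)))).
      2: { rewrite S_INR, (EI (S k)), (ER k), (EI k). ring. }
      apply (is_derive_plus (V := R_NormedModule));
        apply (is_derive_mult (K := R_AbsRing)); auto; exact Rmult_comm.
Qed.

Lemma Cmod_cpow (z : C) (k : nat) : Cmod (cpow z k) = Cmod z ^ k.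
Proof.
  induction k; simpl; [apply Cmod_1|now rewrite Cmod_mult, IHk].
Qed.

Lemma abs_Re_inv_pow (k : nat) (x y : R) : y <> 0 ->
  Rabs (Re (inv_pow k x y)) <= (/ sqrt (x ^ 2 + y ^ 2)) ^ k.
Proof.
  intros Hy. eapply Rle_trans; [apply re_le_Cmod|].
  unfold inv_pow. rewrite Cmod_cpow, Cmod_inv; [apply Rle_refl|].
  intros E. injection E. auto.
Qed.

Lemma abs_Re_inv_pow_le (k : nat) (x y : R) : 1 <= y -> (2 <= k)%nat ->
  Rabs (Re (inv_pow k x y)) <= / y ^ 2.
Proof.
  intros Hy Hk. eapply Rle_trans; [apply abs_Re_inv_pow; lra|].
  assert (Hs : y <= sqrt (x ^ 2 + y ^ 2)).
  { rewrite <- (sqrt_pow2 y) at 1 by lra. apply sqrt_le_1; pose proof (pow2_ge_0 x); nra. }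
  assert (Hi : 0 < / sqrt (x ^ 2 + y ^ 2) <= / y).
  { split; [apply Rinv_0_lt_compat; lra|apply Rinv_le_contravar; lra]. }
  assert (Hi1 : / y <= 1) by (rewrite <- Rinv_1; apply Rinv_le_contravar; lra).
  replace k with (2 + (k - 2))%nat by lia. rewrite pow_add, <- pow_inv.
  rewrite <- (Rmult_1_r ((/ y) ^ 2)).
  apply Rmult_le_compat.
  - apply pow_le; lra.
  - apply pow_le; lra.
  - apply pow_incr; lra.
  - rewrite <- (pow1 (k - 2)). apply pow_incr; lra.
Qed.

(** The sum of (x + i PI n)^-k over all nonzero integers n. Pairing n with -n leaves twice the real
    part and makes the case k = 1 converge. *)
Definition row (k : nat) (x : R) : R :=
  Series (fun n => 2 * Re (inv_pow k x (PI * (INR n + 1)))).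

Lemma PI_mul_ge (n : nat) : INR n + 1 <= PI * (INR n + 1).
Proof. pose proof (pos_INR n). pose proof PI2_1. nra. Qed.

Lemma inv_PI_mul_sq_le (n : nat) : / (PI * (INR n + 1)) ^ 2 <= / (INR n + 1) ^ 2.
Proof.
  pose proof (pos_INR n). pose proof (PI_mul_ge n).
  apply Rinv_le_contravar; [apply pow_lt; lra|apply pow_incr; lra].
Qed.

Lemma row_term_le (k n : nat) (x : R) : (2 <= k)%nat ->
  Rabs (2 * Re (inv_pow k x (PI * (INR n + 1)))) <= 2 * / (INR n + 1) ^ 2.
Proof.
  intros Hk. rewrite Rabs_mult, (Rabs_pos_eq 2) by lra.
  apply Rmult_le_compat_l; [lra|].
  eapply Rle_trans; [|apply inv_PI_mul_sq_le].
  apply abs_Re_inv_pow_le; auto. pose proof (pos_INR n); pose proof (PI_mul_ge n); lra.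
Qed.

Lemma ex_row (k : nat) (x : R) : (1 <= k)%nat ->
  ex_series (fun n => 2 * Re (inv_pow k x (PI * (INR n + 1)))).
Proof.
  intros Hk. destruct (Nat.eq_dec k 1) as [->|Hk1].
  - apply ex_series_abs_le with (fun n => (2 * Rabs x) * / (INR n + 1) ^ 2);
      [|apply ex_series_inv_square_scal].
    intros n. pose proof (pos_INR n) as Hn. pose proof (PI_mul_ge n) as HP.
    set (y := PI * (INR n + 1)) in *.
    replace (Re (inv_pow 1 x y)) with (x / (x ^ 2 + y ^ 2)) by (simpl; field; nra).
    unfold Rdiv. rewrite !Rabs_mult, (Rabs_pos_eq 2), Rmult_assoc by lra.
    do 2 (apply Rmult_le_compat_l; [first [lra | apply Rabs_pos]|]).
    pose proof (pow2_ge_0 x). rewrite Rabs_inv, Rabs_pos_eq by nra.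
    apply Rinv_le_contravar; nra.
  - apply ex_series_abs_le with (fun n => 2 * / (INR n + 1) ^ 2);
      [|apply ex_series_inv_square_scal].
    intros n. apply row_term_le. lia.
Qed.

Lemma is_derive_row (k : nat) (x : R) : (1 <= k)%nat ->
  is_derive (row k) x (- INR k * row (S k) x).
Proof.
  intros Hk. unfold row. rewrite <- Series_scal_l.
  assert (Hy : forall n, PI * (INR n + 1) <> 0).
  { intros n. pose proof (pos_INR n); pose proof (PI_mul_ge n); lra. }
  apply is_derive_Series with (d := 1)
    (u1 := fun n x => - INR k * (2 * Re (inv_pow (S k) x (PI * (INR n + 1)))))
    (u2 := fun n x => - INR k * (2 * (- INR (S k) * Re (inv_pow (S (S k)) x (PI * (INR n + 1))))))
    (M := fun n => INR k * INR (S k) * 2 * / (INR n + 1) ^ 2).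
  - lra.
  - intros n y _. replace (- INR k * _)
      with (2 * (- INR k * Re (inv_pow (S k) y (PI * (INR n + 1))))) by ring.
    apply (is_derive_scal (fun x => Re (inv_pow k x (PI * (INR n + 1))))).
    now apply is_derive_inv_pow.
  - intros n y _.
    apply (is_derive_scal (fun x => 2 * Re (inv_pow (S k) x (PI * (INR n + 1))))).
    apply (is_derive_scal (fun x => Re (inv_pow (S k) x (PI * (INR n + 1))))).
    now apply is_derive_inv_pow.
  - intros n y _.
    pose proof (row_term_le (S (S k)) n y ltac:(lia)) as H.
    replace (- INR k * _) with (INR k * INR (S k) * (2 * Re (inv_pow (S (S k)) y (PI * (INR n + 1)))))
      by ring.
    pose proof (pos_INR k). pose proof (pos_INR (S k)).
    rewrite Rabs_mult, (Rabs_pos_eq (INR k * INR (S k))) by nra.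
    rewrite (Rmult_assoc _ 2). apply Rmult_le_compat_l; nra.
  - intros y _. now apply ex_row.
  - apply ex_series_scal_R, ex_row. lia.
  - apply ex_series_inv_square_scal.
Qed.

(** * Derivatives of the hyperbolic cotangent and closed forms of the row sums *)

Definition psi (a : nat) (y : R) : R := coth y ^ a * csch2 y.

(** By csch^2 = coth^2 - 1 the functions [psi a] span a space closed under differentiation, and this
    is the derivative of [psi a]. At a = 0 the factor [INR a] removes the term with [pred a]. *)
Definition dpsi (a : nat) (y : R) : R := INR a * psi (pred a) y - (INR a + 2) * psi (S a) y.

Lemma is_derive_coth (y : R) : 0 < y -> is_derive coth y (- csch2 y).
Proof.
  intros Hy. pose proof (sinh_pos y Hy) as Hs. unfold coth, csch2.
  replace (/ sinh y ^ 2) with ((cosh y ^ 2 - sinh y ^ 2) / sinh y ^ 2)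
    by (rewrite cosh_sq; field; lra).
  auto_derive; [lra|field; lra].
Qed.

Lemma coth_sq (y : R) : 0 < y -> coth y ^ 2 = 1 + csch2 y.
Proof.
  intros Hy. pose proof (sinh_pos y Hy) as Hs. unfold coth, csch2.
  replace ((cosh y / sinh y) ^ 2) with (cosh y ^ 2 / sinh y ^ 2) by (field; lra).
  rewrite cosh_sq. field. lra.
Qed.

Lemma csch2_pos (y : R) : 0 < y -> 0 < csch2 y.
Proof. intros Hy. apply Rinv_0_lt_compat, pow_lt, sinh_pos, Hy. Qed.

Lemma coth_pos (y : R) : 0 < y -> 0 < coth y.
Proof. intros Hy. apply Rdiv_lt_0_compat; [apply cosh_pos|now apply sinh_pos]. Qed.

Lemma coth_ge_1 (y : R) : 0 < y -> 1 <= coth y.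
Proof.
  intros Hy. pose proof (coth_sq y Hy). pose proof (csch2_pos y Hy). pose proof (coth_pos y Hy). nra.
Qed.

Lemma csch2_le_inv_sq (y : R) : 0 < y -> csch2 y <= / y ^ 2.
Proof.
  intros Hy. apply Rinv_le_contravar; [apply pow_lt, Hy|].
  apply pow_incr. pose proof (sinh_ge_id y); lra.
Qed.

(** Decay of fourth order absorbs the weights of order n in [coefB] and in the theta sums, for which
    the quadratic bound would be too weak. *)
Lemma csch2_le_inv_pow4 (y : R) : 0 < y -> csch2 y <= 4 * / y ^ 4.
Proof.
  intros Hy. assert (H : 0 < (y ^ 2 / 2) ^ 2) by (apply pow_lt; nra).
  replace (4 * / y ^ 4) with (/ (y ^ 2 / 2) ^ 2) by (field; lra).
  apply Rinv_le_contravar; auto. apply pow_incr.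
  pose proof (sinh_ge_half_sq y ltac:(lra)). nra.
Qed.

Lemma is_derive_csch2 (y : R) : 0 < y -> is_derive csch2 y (- 2 * (coth y * csch2 y)).
Proof.
  intros Hy. pose proof (sinh_pos y Hy) as Hs. unfold coth, csch2.
  auto_derive; [nra|]. field. lra.
Qed.

Lemma is_derive_psi (a : nat) (y : R) : 0 < y -> is_derive (psi a) y (dpsi a y).
Proof.
  intros Hy. unfold dpsi, psi.
  replace (INR a * (coth y ^ pred a * csch2 y) - (INR a + 2) * (coth y ^ S a * csch2 y))
    with ((INR a * (- csch2 y) * coth y ^ pred a) * csch2 y + coth y ^ a * (- 2 * (coth y * csch2 y))).
  - apply (is_derive_mult (K := R_AbsRing) (fun y => coth y ^ a)).
    + apply is_derive_pow, is_derive_coth, Hy.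
    + apply is_derive_csch2, Hy.
    + exact Rmult_comm.
  - destruct a as [|a]; [simpl; ring|].
    replace (pred (S a)) with a by reflexivity. rewrite S_INR. simpl pow.
    pose proof (coth_sq y Hy) as E.
    assert (E' : csch2 y = coth y * coth y - 1) by (simpl in E; lra).
    rewrite E'. ring.
Qed.

Lemma psi_pos (a : nat) (y : R) : 0 < y -> 0 < psi a y.
Proof.
  intros Hy. apply Rmult_lt_0_compat; [apply pow_lt, coth_pos, Hy|apply csch2_pos, Hy].
Qed.

Lemma coth_le (d y : R) : 0 < d -> d <= y -> coth y <= 1 + / d ^ 2.
Proof.
  intros Hd Hy. pose proof (coth_sq y ltac:(lra)). pose proof (coth_ge_1 y ltac:(lra)).
  pose proof (csch2_le_inv_sq y ltac:(lra)).
  assert (/ y ^ 2 <= / d ^ 2).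
  { apply Rinv_le_contravar; [apply pow_lt, Hd|apply pow_incr; lra]. }
  nra.
Qed.

Lemma pow_coth_le (d y : R) (a b : nat) : 0 < d -> d <= y -> (a <= b)%nat ->
  0 < coth y ^ a <= (1 + / d ^ 2) ^ b.
Proof.
  intros Hd Hy Hab. split; [apply pow_lt, coth_pos; lra|].
  pose proof (coth_ge_1 y ltac:(lra)). pose proof (coth_le d y Hd Hy).
  apply Rle_trans with (coth y ^ b); [apply Rle_pow; auto|apply pow_incr; lra].
Qed.

Lemma psi_le (d y : R) (a b : nat) : 0 < d -> d <= y -> (a <= b)%nat ->
  psi a y <= (1 + / d ^ 2) ^ b * / y ^ 2.
Proof.
  intros Hd Hy Hab. pose proof (pow_coth_le d y a b Hd Hy Hab).
  apply Rmult_le_compat; [lra| |lra|apply csch2_le_inv_sq; lra].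
  apply Rlt_le, csch2_pos; lra.
Qed.

Lemma psi_le4 (d y : R) (a b : nat) : 0 < d -> d <= y -> (a <= b)%nat ->
  psi a y <= (1 + / d ^ 2) ^ b * (4 * / y ^ 4).
Proof.
  intros Hd Hy Hab. pose proof (pow_coth_le d y a b Hd Hy Hab).
  apply Rmult_le_compat; [lra| |lra|apply csch2_le_inv_pow4; lra].
  apply Rlt_le, csch2_pos; lra.
Qed.

Lemma abs_dpsi_le (y K : R) (a : nat) : 0 < y ->
  psi (pred a) y <= K -> psi (S a) y <= K -> Rabs (dpsi a y) <= (2 * INR a + 2) * K.
Proof.
  intros Hy H1 H2. unfold dpsi. pose proof (pos_INR a).
  pose proof (psi_pos (pred a) y Hy). pose proof (psi_pos (S a) y Hy).
  apply Rabs_le. split; nra.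
Qed.

Lemma coth_row (x : R) : 0 < x -> coth x = / x + row 1 x.
Proof.
  intros Hx. pose proof (is_series_unique _ _ (coth_partial_fractions x Hx)) as H.
  unfold row. rewrite (Series_ext _ (fun n => 2 * (x / (x ^ 2 + (PI * (INR n + 1)) ^ 2)))).
  - rewrite H. ring.
  - intros n. pose proof (pos_INR n). pose proof (PI_mul_ge n). simpl. field. nra.
Qed.

Lemma is_derive_unique_loc (f g : R -> R) (x df dg : R) : 0 < x ->
  (forall y, 0 < y -> f y = g y) -> is_derive f x df -> is_derive g x dg -> df = dg.
Proof.
  intros Hx H Hf Hg.
  apply (is_derive_ext_loc f g) in Hf.
  - rewrite <- (is_derive_unique _ _ _ Hf). now apply is_derive_unique.
  - exists (mkposreal x Hx). intros y Hy. apply H.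
    apply Rabs_def2 in Hy. simpl in Hy. unfold minus, plus, opp in Hy; simpl in Hy. lra.
Qed.

Lemma is_derive_inv_pow_row (k : nat) (x : R) : 0 < x -> (1 <= k)%nat ->
  is_derive (fun x => / x ^ k + row k x) x (- INR k * (/ x ^ S k + row (S k) x)).
Proof.
  intros Hx Hk. rewrite Rmult_plus_distr_l.
  apply (is_derive_plus (V := R_NormedModule) (fun x => / x ^ k)); [|now apply is_derive_row].
  destruct k as [|k]; [lia|].
  auto_derive; [apply (pow_nonzero x (S k)); lra|].
  replace (match k with O => 1 | S _ => INR k + 1 end) with (INR (S k)) by reflexivity.
  simpl pow. field. split; [apply pow_nonzero|]; lra.
Qed.

(** Differentiating a closed form for x^-k plus [row k] gives the one for k + 1, so all of them
    descend from the partial fractions of [coth]. *)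
Lemma row_step (k : nat) (g dg : R -> R) : (1 <= k)%nat ->
  (forall x, 0 < x -> g x = / x ^ k + row k x) ->
  (forall x, 0 < x -> is_derive g x (- INR k * dg x)) ->
  forall x, 0 < x -> dg x = / x ^ S k + row (S k) x.
Proof.
  intros Hk Hg Hd x Hx.
  assert (HK : INR k <> 0) by (apply not_0_INR; lia).
  apply Rmult_eq_reg_l with (- INR k); [|lra].
  apply (is_derive_unique_loc g (fun x => / x ^ k + row k x) x); auto.
  now apply is_derive_inv_pow_row.
Qed.

Lemma is_derive_psi_comb (p q r : R) (a b c : nat) (y : R) : 0 < y ->
  is_derive (fun y => p * psi a y + q * psi b y + r * psi c y) y
    (p * dpsi a y + q * dpsi b y + r * dpsi c y).
Proof.
  intros Hy. repeat apply (is_derive_plus (V := R_NormedModule));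
  apply is_derive_scal, is_derive_psi, Hy.
Qed.

Lemma csch2_row (x : R) : 0 < x -> psi 0 x = / x ^ 2 + row 2 x.
Proof.
  revert x. apply (row_step 1 coth (psi 0)); [lia| |].
  - intros x Hx. rewrite pow_1. now apply coth_row.
  - intros x Hx. replace (- INR 1 * psi 0 x) with (- csch2 x) by (unfold psi; simpl; ring).
    now apply is_derive_coth.
Qed.

Lemma psi_row4 (x : R) : 0 < x -> psi 2 x - psi 0 x / 3 = / x ^ 4 + row 4 x.
Proof.
  intros Hx.
  assert (H3 : forall x, 0 < x -> psi 1 x = / x ^ 3 + row 3 x).
  { apply (row_step 2 (psi 0) (psi 1)); [lia|apply csch2_row|].
    intros z Hz. replace (- INR 2 * psi 1 z) with (dpsi 0 z) by (unfold dpsi; simpl; ring).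
    now apply is_derive_psi. }
  revert x Hx. apply (row_step 3 (psi 1) (fun x => psi 2 x - psi 0 x / 3)); [lia|exact H3|].
  intros z Hz. replace (- INR 3 * (psi 2 z - psi 0 z / 3)) with (dpsi 1 z)
    by (unfold dpsi; simpl; field).
  now apply is_derive_psi.
Qed.

Lemma psi_row6 (x : R) : 0 < x ->
  psi 4 x - psi 2 x + 2 / 15 * psi 0 x = / x ^ 6 + row 6 x.
Proof.
  intros Hx.
  assert (H5 : forall x, 0 < x -> psi 3 x - 2 / 3 * psi 1 x = / x ^ 5 + row 5 x).
  { apply (row_step 4 (fun x => psi 2 x - psi 0 x / 3)); [lia|apply psi_row4|].
    intros z Hz.
    replace (- INR 4 * (psi 3 z - 2 / 3 * psi 1 z))
      with (1 * dpsi 2 z + (- / 3) * dpsi 0 z + 0 * dpsi 0 z) by (unfold dpsi; simpl; field).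
    apply is_derive_ext with (fun y => 1 * psi 2 y + (- / 3) * psi 0 y + 0 * psi 0 y).
    - intros t. match goal with |- ?a = ?b => change (@eq R a b) end. field.
    - now apply is_derive_psi_comb. }
  revert x Hx.
  apply (row_step 5 (fun x => psi 3 x - 2 / 3 * psi 1 x)); [lia|exact H5|].
  intros z Hz.
  replace (- INR 5 * (psi 4 z - psi 2 z + 2 / 15 * psi 0 z))
    with (1 * dpsi 3 z + (- (2 / 3)) * dpsi 1 z + 0 * dpsi 0 z) by (unfold dpsi; simpl; field).
  apply is_derive_ext with (fun y => 1 * psi 3 y + (- (2 / 3)) * psi 1 y + 0 * psi 0 y).
  - intros t. match goal with |- ?a = ?b => change (@eq R a b) end. field.
  - now apply is_derive_psi_comb.
Qed.

(** * One-sided sums of powers of the hyperbolic cotangent *)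

(** One-sided, so that all arguments stay positive; the translates on the other side are reflected
    and enter as [half_sum L a (L - x)]. *)
Definition half_sum (L : R) (a : nat) (x : R) : R := Series (fun m => psi a (x + INR m * L)).

Lemma inv_sq_affine_le (L d : R) (n : nat) : 0 < L -> 0 < d ->
  / (d + INR n * L) ^ 2 <= (/ Rmin d L ^ 2) * / (INR n + 1) ^ 2.
Proof.
  intros HL Hd. pose proof (pos_INR n) as Hn.
  pose proof (Rmin_l d L). pose proof (Rmin_r d L).
  assert (Hm : 0 < Rmin d L) by now apply Rmin_pos.
  rewrite <- Rinv_mult, <- Rpow_mult_distr.
  apply Rinv_le_contravar; [apply pow_lt; nra|apply pow_incr; nra].
Qed.

Lemma psi_term_le (L d x : R) (a b n : nat) : 0 < L -> 0 < d -> d <= x -> (a <= b)%nat ->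
  0 < psi a (x + INR n * L) <= (1 + / d ^ 2) ^ b * / Rmin d L ^ 2 * / (INR n + 1) ^ 2.
Proof.
  intros HL Hd Hx Hab. pose proof (pos_INR n) as Hn.
  assert (Hxn : d + INR n * L <= x + INR n * L) by lra.
  assert (Hd2 : 0 < / d ^ 2) by (apply Rinv_0_lt_compat, pow_lt, Hd).
  split; [apply psi_pos; nra|].
  eapply Rle_trans; [apply (psi_le d _ a b); auto; nra|].
  rewrite Rmult_assoc. apply Rmult_le_compat_l; [apply pow_le; lra|].
  eapply Rle_trans; [|apply inv_sq_affine_le; auto].
  apply Rinv_le_contravar; [apply pow_lt; nra|apply pow_incr; nra].
Qed.

Lemma ex_half_sum (L x : R) (a : nat) : 0 < L -> 0 < x ->
  ex_series (fun m => psi a (x + INR m * L)).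
Proof.
  intros HL Hx.
  apply ex_series_abs_le with (fun n => (1 + / x ^ 2) ^ a * / Rmin x L ^ 2 * / (INR n + 1) ^ 2);
    [|apply ex_series_inv_square_scal].
  intros n. pose proof (psi_term_le L x x a a n HL Hx ltac:(lra) ltac:(lia)).
  rewrite Rabs_pos_eq; lra.
Qed.

Lemma half_sum_pos (L x : R) (a : nat) : 0 < L -> 0 < x -> 0 < half_sum L a x.
Proof.
  intros HL Hx. apply Series_pos; [|now apply ex_half_sum].
  intros n. apply psi_pos. pose proof (pos_INR n). nra.
Qed.

Lemma is_derive_half_sum (L x : R) (a : nat) : 0 < L -> 0 < x ->
  is_derive (half_sum L a) x
    (INR a * half_sum L (pred a) x - (INR a + 2) * half_sum L (S a) x).
Proof.
  intros HL Hx. unfold half_sum.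
  rewrite <- !Series_scal_l, <- Series_minus by (apply ex_series_scal_R, ex_half_sum; auto).
  (* Within distance x / 2 of [x] all arguments stay above x / 2, and the exponent [S (S a)] covers
     every index produced by two differentiations. *)
  set (K := (1 + / (x / 2) ^ 2) ^ (S (S a)) * / Rmin (x / 2) L ^ 2).
  apply is_derive_Series with (d := x / 2)
    (u1 := fun n y => dpsi a (y + INR n * L))
    (u2 := fun n y => INR a * dpsi (pred a) (y + INR n * L) - (INR a + 2) * dpsi (S a) (y + INR n * L))
    (M := fun n => (INR a * (2 * INR (pred a) + 2) + (INR a + 2) * (2 * INR (S a) + 2)) * K
                   * / (INR n + 1) ^ 2).
  - lra.
  - intros n y Hy. apply Rabs_def2 in Hy. pose proof (pos_INR n).
    assert (Hyn : 0 < y + INR n * L) by nra.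
    rewrite <- (Rmult_1_l (dpsi a _)).
    apply (is_derive_comp (psi a) (fun y => y + INR n * L)).
    + now apply is_derive_psi.
    + auto_derive; [auto|ring].
  - intros n y Hy. apply Rabs_def2 in Hy. pose proof (pos_INR n).
    assert (Hyn : 0 < y + INR n * L) by nra.
    rewrite <- (Rmult_1_l (_ - _)).
    apply (is_derive_comp (dpsi a) (fun y => y + INR n * L)).
    + unfold dpsi at 1. apply (is_derive_minus (V := R_NormedModule));
        now apply is_derive_scal, is_derive_psi.
    + auto_derive; [auto|ring].
  - intros n y Hy. apply Rabs_def2 in Hy. pose proof (pos_INR n).
    assert (Hyn : 0 < y + INR n * L) by nra.
    set (Q := K * / (INR n + 1) ^ 2).
    assert (HQ : forall b, (b <= S (S a))%nat -> psi b (y + INR n * L) <= Q).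
    { intros b Hb. apply (psi_term_le L (x / 2) y b (S (S a)) n); auto; lra. }
    pose proof (abs_dpsi_le _ Q (pred a) Hyn ltac:(apply HQ; lia) ltac:(apply HQ; lia)) as H1.
    pose proof (abs_dpsi_le _ Q (S a) Hyn ltac:(apply HQ; lia) ltac:(apply HQ; lia)) as H2.
    pose proof (pos_INR a). unfold Rminus.
    eapply Rle_trans; [apply Rabs_triang|]. rewrite Rabs_Ropp, !Rabs_mult.
    rewrite (Rabs_pos_eq (INR a)), (Rabs_pos_eq (INR a + 2)) by lra.
    apply Rle_trans with (INR a * ((2 * INR (pred a) + 2) * Q)
      + (INR a + 2) * ((2 * INR (S a) + 2) * Q)).
    + apply Rplus_le_compat; apply Rmult_le_compat_l; lra.
    + right. unfold Q. ring.
  - intros y Hy. apply Rabs_def2 in Hy. apply ex_half_sum; lra.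
  - apply (ex_series_minus (V := R_NormedModule)
      (fun n => INR a * psi (pred a) (x + INR n * L))
      (fun n => (INR a + 2) * psi (S a) (x + INR n * L)));
      apply ex_series_scal_R, ex_half_sum; auto.
  - apply ex_series_inv_square_scal.
Qed.

(** * The square of the periodic sum *)

(** For 0 < x < L, the sum of csch^2 (x + m L) over all integers m, the negative translates being
    reflected by evenness. *)
Definition full_sum (L x : R) : R := half_sum L 0 x + half_sum L 0 (L - x).

Definition coefA (L : R) : R := 2 * half_sum L 0 L.

(** The weight counts the unpaired values of [coth] that remain at each end when the square of a
    long finite sum is telescoped. *)
Definition coefB (L : R) : R := 8 * Series (fun n => (INR n + 1) * psi 1 ((INR n + 1) * L)).

Lemma psum_first (b : nat -> R) (k : nat) :
  psum b (S k) = b O + psum (fun i => b (S i)) k.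
Proof.
  pose proof (psum_shift b k 1) as H. rewrite Nat.add_1_r in H. simpl in H.
  rewrite (psum_ext (fun i => b (S i)) (fun i => b (i + 1)%nat)).
  - simpl. lra.
  - intros i _. now rewrite Nat.add_1_r.
Qed.

Lemma psum_rev (b : nat -> R) (k : nat) : psum (fun n => b (k - S n)%nat) k = psum b k.
Proof.
  induction k; [reflexivity|].
  rewrite psum_first. simpl psum at 2. rewrite <- IHk.
  replace (S k - 1)%nat with k by lia.
  rewrite (psum_ext (fun i => b (S k - S (S i))%nat) (fun n => b (k - S n)%nat)).
  - ring.
  - intros i _. reflexivity.
Qed.

(** The off-diagonal products are grouped by the difference of their indices, on which alone the
    coefficients of [csch2_mul] depend along equally spaced points. *)
Lemma psum_square (a : nat -> R) (K : nat) :
  psum a K ^ 2 = psum (fun i => a i ^ 2) K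
    + 2 * psum (fun n => psum (fun i => a i * a (i + S n)%nat) (K - S n)) K.
Proof.
  induction K as [|K IH]; [simpl; ring|].
  rewrite !psum_S. replace (S K - S K)%nat with O by lia. simpl (psum _ 0).
  rewrite (psum_ext (fun n => psum (fun i => a i * a (i + S n)%nat) (S K - S n))
    (fun n => psum (fun i => a i * a (i + S n)%nat) (K - S n) + a K * a (K - S n)%nat)).
  - rewrite psum_plus, psum_scal, psum_rev.
    replace ((psum a K + a K) ^ 2) with (psum a K ^ 2 + 2 * psum a K * a K + a K ^ 2) by ring.
    rewrite IH. ring.
  - intros n Hn. replace (S K - S n)%nat with (S (K - S n)) by lia.
    rewrite psum_S. f_equal. replace (K - S n + S n)%nat with K by lia. ring.
Qed.

Lemma sinh_neg (y : R) : sinh (- y) = - sinh y.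
Proof. unfold sinh. rewrite Ropp_involutive. field. Qed.

Lemma cosh_neg (y : R) : cosh (- y) = cosh y.
Proof. unfold cosh. rewrite Ropp_involutive. field. Qed.

Lemma csch2_neg (y : R) : csch2 (- y) = csch2 y.
Proof. unfold csch2. rewrite sinh_neg. f_equal. ring. Qed.

Lemma sinh_neq_0 (y : R) : y <> 0 -> sinh y <> 0.
Proof.
  intros Hy H. destruct (Rtotal_order y 0) as [Hn|[He|Hp]]; [|auto|].
  - pose proof (sinh_pos (- y) ltac:(lra)). rewrite sinh_neg in *. lra.
  - pose proof (sinh_pos y Hp). lra.
Qed.

Lemma coth_neg (y : R) : y <> 0 -> coth (- y) = - coth y.
Proof.
  intros Hy. unfold coth. rewrite sinh_neg, cosh_neg. field. now apply sinh_neq_0.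
Qed.

Lemma sinh_minus (a b : R) : sinh (b - a) = sinh b * cosh a - cosh b * sinh a.
Proof.
  unfold sinh, cosh. replace (- (b - a)) with (- b + a) by ring.
  unfold Rminus at 2. rewrite !exp_plus. field.
Qed.

Lemma cosh_minus (a b : R) : cosh (b - a) = cosh b * cosh a - sinh b * sinh a.
Proof.
  unfold sinh, cosh. replace (- (b - a)) with (- b + a) by ring.
  unfold Rminus at 1. rewrite !exp_plus. field.
Qed.

(** The poles at a and b are separated with coefficients depending only on b - a. Along equally
    spaced points the differences of [coth] telescope, and the [csch2] terms add up to twice the
    whole sum, edges apart. *)
Lemma csch2_mul (a b : R) : a <> 0 -> b <> 0 -> b - a <> 0 ->
  csch2 a * csch2 b =
  csch2 (b - a) * (csch2 a + csch2 b) + 2 * (coth (b - a) * csch2 (b - a)) * (coth b - coth a).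
Proof.
  intros Ha Hb Hd. apply sinh_neq_0 in Ha, Hb, Hd.
  pose proof (cosh_sq a) as Ea. pose proof (cosh_sq b) as Eb.
  unfold csch2, coth. revert Hd. rewrite sinh_minus, cosh_minus.
  set (p := sinh a) in *. set (q := cosh a) in *. set (r := sinh b) in *. set (s := cosh b) in *.
  intros Hd. set (D := r * q - s * p) in *.
  assert (ED : D ^ 2 = p ^ 2 + r ^ 2 - 2 * (s * q - r * p) * (p * r)).
  { replace (D ^ 2) with (r ^ 2 * q ^ 2 - 2 * r * q * s * p + s ^ 2 * p ^ 2) by (unfold D; ring).
    rewrite Ea, Eb. ring. }
  replace (s / r - q / p) with (- D / (p * r)) by (unfold D; field; auto).
  replace (/ p ^ 2 * / r ^ 2) with (D ^ 2 / (D ^ 2 * p ^ 2 * r ^ 2)) by (field; auto).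
  rewrite ED at 1. field. auto.
Qed.

(** For i < 2 N + 2 these are the translates x + j L with -N - 1 <= j <= N, a range chosen so that
    replacing x by L - x negates the set. *)
Definition window (L x : R) (N i : nat) : R := x + (INR i - INR N - 1) * L.

Lemma psum_window (F : R -> R) (L x : R) (N : nat) :
  psum (fun i => F (window L x N i)) (2 * N + 2) =
  psum (fun m => F (x + INR m * L)) (S N) + psum (fun m => F (- (L - x + INR m * L))) (S N).
Proof.
  induction N as [|N IH].
  - simpl. unfold window. simpl.
    replace (x + (0 - 0 - 1) * L) with (- (L - x + 0 * L)) by ring.
    replace (x + (1 - 0 - 1) * L) with (x + 0 * L) by ring. ring.
  - replace (2 * S N + 2)%nat with (S (S (2 * N + 2))) by lia.
    rewrite psum_first, psum_S, (psum_S _ (S N)), (psum_S _ (S N)).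
    rewrite (psum_ext (fun i => F (window L x (S N) (S i))) (fun i => F (window L x N i))).
    + rewrite IH. unfold window. rewrite !S_INR, plus_INR, mult_INR. simpl (INR 0). simpl (INR 2).
      replace (x + (0 - (INR N + 1) - 1) * L) with (- (L - x + (INR N + 1) * L)) by ring.
      replace (x + ((1 + 1) * INR N + (1 + 1) + 1 - (INR N + 1) - 1) * L)
        with (x + (INR N + 1) * L) by ring.
      ring.
    + intros i _. f_equal. unfold window. rewrite !S_INR. ring.
Qed.

Lemma window_shift (L x : R) (N i d : nat) :
  window L x N (i + d) - window L x N i = INR d * L.
Proof. unfold window. rewrite plus_INR. ring. Qed.

Lemma window_away (L x : R) (N i : nat) : 0 < x < L ->
  x <= window L x N i \/ L - x <= - window L x N i.
Proof.
  intros Hx. unfold window. destruct (le_lt_dec i N) as [Hi|Hi].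
  - right. apply le_INR in Hi. nra.
  - left. apply le_INR in Hi. rewrite S_INR in Hi. nra.
Qed.

Lemma window_neq_0 (L x : R) (N i : nat) : 0 < x < L -> window L x N i <> 0.
Proof. intros Hx. destruct (window_away L x N i Hx); lra. Qed.

Lemma csch2_window_pos (L x : R) (N i : nat) : 0 < x < L -> 0 < csch2 (window L x N i).
Proof.
  intros Hx. apply Rinv_0_lt_compat, pow2_gt_0, sinh_neq_0. now apply window_neq_0.
Qed.

Lemma abs_coth_window_le (L x : R) (N i : nat) : 0 < x < L ->
  Rabs (coth (window L x N i)) <= 1 + / Rmin x (L - x) ^ 2.
Proof.
  intros Hx. assert (Hm : 0 < Rmin x (L - x)) by (apply Rmin_pos; lra).
  pose proof (Rmin_l x (L - x)). pose proof (Rmin_r x (L - x)).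
  destruct (window_away L x N i Hx) as [H1|H1].
  - rewrite Rabs_pos_eq by (apply Rlt_le, coth_pos; lra). apply coth_le; lra.
  - rewrite <- Rabs_Ropp, <- coth_neg by lra.
    rewrite Rabs_pos_eq by (apply Rlt_le, coth_pos; lra). apply coth_le; lra.
Qed.

Lemma is_lim_seq_affine (L b : R) : 0 < L -> is_lim_seq (fun N => b + INR N * L) p_infty.
Proof.
  intros HL. apply is_lim_seq_plus with (l1 := b) (l2 := p_infty).
  - apply is_lim_seq_const.
  - apply is_lim_seq_ext with (fun n => L * INR n); [intros; ring|].
    replace p_infty with (Rbar_mult L p_infty).
    + apply is_lim_seq_scal_l, is_lim_seq_INR.
    + simpl. destruct (Rle_dec 0 L); [|lra]. destruct (Rle_lt_or_eq_dec 0 L r); [reflexivity|lra].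
  - reflexivity.
Qed.

Lemma is_lim_seq_csch2 (L b : R) : 0 < L -> is_lim_seq (fun N => csch2 (b + INR N * L)) 0.
Proof.
  intros HL. pose proof (is_lim_seq_affine L b HL) as Hinf.
  apply is_lim_seq_le_le_loc with (u := fun _ => 0) (w := fun N => / (b + INR N * L)).
  - apply is_lim_seq_spec in Hinf. destruct (Hinf 1) as [N0 H]. exists N0. intros N HN.
    specialize (H N HN). simpl in H. set (y := b + INR N * L) in *.
    split; [apply Rlt_le, csch2_pos; lra|].
    eapply Rle_trans; [apply csch2_le_inv_sq; lra|]. apply Rinv_le_contravar; nra.
  - apply is_lim_seq_const.
  - replace (Finite 0) with (Rbar_inv p_infty) by reflexivity.
    apply is_lim_seq_inv; [exact Hinf|discriminate].
Qed.

Lemma is_lim_seq_coth (L b : R) : 0 < L -> is_lim_seq (fun N => coth (b + INR N * L)) 1.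
Proof.
  intros HL. pose proof (is_lim_seq_affine L b HL) as Hinf.
  apply is_lim_seq_le_le_loc with (u := fun _ => 1) (w := fun N => 1 + csch2 (b + INR N * L)).
  - apply is_lim_seq_spec in Hinf. destruct (Hinf 1) as [N0 H]. exists N0. intros N HN.
    specialize (H N HN). simpl in H. set (y := b + INR N * L) in *.
    pose proof (coth_ge_1 y ltac:(lra)). pose proof (coth_sq y ltac:(lra)). split; nra.
  - apply is_lim_seq_const.
  - replace (Finite 1) with (Finite (1 + 0)) by (f_equal; ring).
    apply is_lim_seq_plus'; [apply is_lim_seq_const|now apply is_lim_seq_csch2].
Qed.

Lemma is_lim_seq_psum (F : nat -> nat -> R) (l : R) (d : nat) :
  (forall i, is_lim_seq (fun N => F N i) l) ->
  is_lim_seq (fun N => psum (F N) d) (INR d * l).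
Proof.
  intros H. induction d.
  - simpl. rewrite Rmult_0_l. apply is_lim_seq_const.
  - rewrite S_INR, Rmult_plus_distr_r, Rmult_1_l. simpl psum. now apply is_lim_seq_plus'.
Qed.

Lemma is_lim_seq_left_edge (L x : R) (i : nat) : 0 < x < L ->
  is_lim_seq (fun N => csch2 (window L x N i)) 0 /\
  is_lim_seq (fun N => coth (window L x N i)) (- 1).
Proof.
  intros Hx.
  assert (E : forall N, window L x N i = - ((L - INR i * L - x) + INR N * L))
    by (intros N; unfold window; ring).
  split.
  - apply is_lim_seq_ext with (fun N => csch2 ((L - INR i * L - x) + INR N * L)).
    + intros N. rewrite E. now rewrite csch2_neg.
    + apply is_lim_seq_csch2; lra.
  - apply is_lim_seq_ext with (fun N => - coth ((L - INR i * L - x) + INR N * L)).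
    + intros N. pose proof (window_neq_0 L x N i Hx) as H0. rewrite E in H0.
      rewrite E. rewrite coth_neg; [reflexivity|lra].
    + apply (is_lim_seq_opp _ 1), is_lim_seq_coth; lra.
Qed.

Lemma is_lim_seq_right_edge (L x : R) (i d : nat) : 0 < L -> (1 <= d)%nat ->
  is_lim_seq (fun N => csch2 (window L x N (i + (2 * N + 2 - d)))) 0 /\
  is_lim_seq (fun N => coth (window L x N (i + (2 * N + 2 - d)))) 1.
Proof.
  intros HL Hd.
  assert (E : forall N, (d <= N)%nat ->
    window L x N (i + (2 * N + 2 - d)) = (x + (INR i + 1 - INR d) * L) + INR N * L).
  { intros N HN. unfold window. rewrite plus_INR, minus_INR, plus_INR, mult_INR by lia.
    simpl (INR 2). ring. }
  split.
  - apply is_lim_seq_ext_loc with (fun N => csch2 ((x + (INR i + 1 - INR d) * L) + INR N * L));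
      [exists d; intros N HN; now rewrite E|now apply is_lim_seq_csch2].
  - apply is_lim_seq_ext_loc with (fun N => coth ((x + (INR i + 1 - INR d) * L) + INR N * L));
      [exists d; intros N HN; now rewrite E|now apply is_lim_seq_coth].
Qed.

(** Each entry occurs once as [a i] and once as [a (i + d)], except that the last d miss the former
    and the first d miss the latter. *)
Lemma psum_pair_sum (a : nat -> R) (K d : nat) : (d <= K)%nat ->
  psum (fun i => a i + a (i + d)%nat) (K - d)
  = 2 * psum a K - psum a d - psum (fun i => a (i + (K - d))%nat) d.
Proof.
  intros Hd. rewrite psum_plus, !psum_shift.
  replace (K - d + d)%nat with K by lia. replace (d + (K - d))%nat with K by lia. ring.
Qed.

Lemma psum_pair_diff (a : nat -> R) (K d : nat) : (d <= K)%nat ->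
  psum (fun i => a (i + d)%nat + - 1 * a i) (K - d)
  = psum (fun i => a (i + (K - d))%nat) d - psum a d.
Proof.
  intros Hd. rewrite psum_plus, psum_scal, !psum_shift.
  replace (K - d + d)%nat with K by lia. replace (d + (K - d))%nat with K by lia. ring.
Qed.

Lemma abs_psum_le (b : nat -> R) (Q : R) (k : nat) :
  (forall i, Rabs (b i) <= Q) -> Rabs (psum b k) <= INR k * Q.
Proof.
  intros H. induction k.
  - simpl. rewrite Rabs_R0. lra.
  - rewrite S_INR. simpl. eapply Rle_trans; [apply Rabs_triang|].
    specialize (H k). lra.
Qed.

Lemma csch2_window_mul (L x : R) (N i d : nat) : 0 < x < L -> (1 <= d)%nat ->
  csch2 (window L x N i) * csch2 (window L x N (i + d)) =
  psi 0 (INR d * L) * (csch2 (window L x N i) + csch2 (window L x N (i + d)))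
  + 2 * psi 1 (INR d * L) * (coth (window L x N (i + d)) + - 1 * coth (window L x N i)).
Proof.
  intros Hx Hd.
  assert (0 < INR d) by (apply lt_0_INR; lia).
  rewrite (csch2_mul (window L x N i) (window L x N (i + d))).
  - rewrite window_shift. unfold psi. ring.
  - now apply window_neq_0.
  - now apply window_neq_0.
  - rewrite window_shift. nra.
Qed.

Lemma is_lim_seq_window_sum (L x : R) (F G : R -> R) :
  0 < x < L -> (forall y, F (- y) = F y) -> (forall y, 0 < y -> F y = G y) ->
  (forall y, 0 < y -> ex_series (fun m => G (y + INR m * L))) ->
  is_lim_seq (fun N => psum (fun i => F (window L x N i)) (2 * N + 2))
    (Series (fun m => G (x + INR m * L)) + Series (fun m => G (L - x + INR m * L))).
Proof.
  intros Hx Hev HFG Hex.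
  apply is_lim_seq_ext with (fun N => psum (fun m => G (x + INR m * L)) (S N)
    + psum (fun m => G (L - x + INR m * L)) (S N)).
  - intros N. rewrite psum_window. f_equal; apply psum_ext; intros m _; pose proof (pos_INR m).
    + symmetry. apply HFG. nra.
    + rewrite Hev. symmetry. apply HFG. nra.
  - apply is_lim_seq_plus'; apply is_lim_seq_incr_1 with (u := psum _);
      apply psum_lim, Series_correct, Hex; lra.
Qed.

Lemma weight_psi1_le (L : R) (n : nat) : 0 < L ->
  0 < (INR n + 1) * psi 1 ((INR n + 1) * L)
    <= (1 + / L ^ 2) ^ 1 * (4 * / L ^ 4) * / (INR n + 1) ^ 2.
Proof.
  intros HL. pose proof (pos_INR n) as Hn.
  assert (Hl : L <= (INR n + 1) * L) by nra.
  split; [apply Rmult_lt_0_compat; [lra|apply psi_pos; nra]|].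
  pose proof (psi_le4 L _ 1 1 HL Hl ltac:(lia)) as H.
  assert (H2 : 0 < / L ^ 2) by (apply Rinv_0_lt_compat, pow_lt, HL).
  assert (H4 : 0 < / L ^ 4) by (apply Rinv_0_lt_compat, pow_lt, HL).
  apply Rle_trans with ((INR n + 1) * ((1 + / L ^ 2) ^ 1 * (4 * / ((INR n + 1) * L) ^ 4))).
  - apply Rmult_le_compat_l; lra.
  - replace ((INR n + 1) * ((1 + / L ^ 2) ^ 1 * (4 * / ((INR n + 1) * L) ^ 4)))
      with ((1 + / L ^ 2) ^ 1 * (4 * / L ^ 4) * / (INR n + 1) ^ 3) by (field; nra).
    apply Rmult_le_compat_l.
    + apply Rmult_le_pos; [apply pow_le; lra|lra].
    + apply Rinv_le_contravar; [apply pow_lt; lra|apply Rle_pow; [lra|lia]].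
Qed.

Lemma ex_weight_psi1 (L : R) : 0 < L ->
  ex_series (fun n => (INR n + 1) * psi 1 ((INR n + 1) * L)).
Proof.
  intros HL.
  apply ex_series_abs_le with (fun n => (1 + / L ^ 2) ^ 1 * (4 * / L ^ 4) * / (INR n + 1) ^ 2);
    [|apply ex_series_inv_square_scal].
  intros n. pose proof (weight_psi1_le L n HL). rewrite Rabs_pos_eq; lra.
Qed.

Lemma ex_half_sum_L (L : R) (a : nat) : 0 < L -> ex_series (fun n => psi a ((INR n + 1) * L)).
Proof.
  intros HL. apply ex_series_ext with (fun m => psi a (L + INR m * L)); [|now apply ex_half_sum].
  intros n. f_equal. ring.
Qed.

Lemma half_sum_L (L : R) (a : nat) :
  half_sum L a L = Series (fun n => psi a ((INR n + 1) * L)).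
Proof. apply Series_ext. intros n. f_equal. ring. Qed.

(** The square of the window sum is expanded by [psum_square] and each product replaced by
    [csch2_mul]. As the window grows, the pairs at distance n L contribute 2 f through [csch2] and n
    - (- n) through the surviving values of [coth], which tend to 1 and -1 at the two ends.
    Summation over n, with the outer factor 2, gives the terms with [coefA] and [coefB]; the
    diagonal csch^4 is [psi 2] minus [psi 0]. *)
Lemma full_sum_square (L x : R) : 0 < x < L ->
  full_sum L x ^ 2 =
  (half_sum L 2 x - half_sum L 0 x) + (half_sum L 2 (L - x) - half_sum L 0 (L - x))
  + 2 * coefA L * full_sum L x + coefB L.
Proof.
  intros Hx. assert (HL : 0 < L) by lra.
  set (f := full_sum L x).
  set (a := fun N i => csch2 (window L x N i)). set (c := fun N i => coth (window L x N i)).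
  assert (Hf0 : 0 < f) by (apply Rplus_lt_0_compat; apply half_sum_pos; lra).
  assert (Ha : forall N i, 0 < a N i) by (intros; now apply csch2_window_pos).
  assert (Hf : is_lim_seq (fun N => psum (a N) (2 * N + 2)) f).
  { apply (is_lim_seq_window_sum L x csch2 (psi 0)); auto using csch2_neg.
    - intros y _. unfold psi. simpl. ring.
    - intros y Hy. now apply ex_half_sum. }
  assert (Hfle : forall N, psum (a N) (2 * N + 2) <= f).
  { intros N. unfold a. rewrite psum_window. apply Rplus_le_compat.
    - rewrite (psum_ext _ (fun m => psi 0 (x + INR m * L))).
      + apply psum_le_Series; [|apply ex_half_sum; lra].
        intros n. apply Rlt_le, psi_pos. pose proof (pos_INR n). nra.
      + intros m _. unfold psi. simpl. ring.
    - rewrite (psum_ext _ (fun m => psi 0 (L - x + INR m * L))).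
      + apply psum_le_Series; [|apply ex_half_sum; lra].
        intros n. apply Rlt_le, psi_pos. pose proof (pos_INR n). nra.
      + intros m _. rewrite csch2_neg. unfold psi. simpl. ring. }
  assert (Hf2 : is_lim_seq (fun N => psum (fun i => a N i ^ 2) (2 * N + 2))
    ((half_sum L 2 x - half_sum L 0 x) + (half_sum L 2 (L - x) - half_sum L 0 (L - x)))).
  { unfold half_sum. rewrite <- !Series_minus by (apply ex_half_sum; lra).
    apply (is_lim_seq_window_sum L x (fun y => csch2 y ^ 2) (fun y => psi 2 y - psi 0 y));
      auto.
    - intros y. now rewrite csch2_neg.
    - intros y Hy. unfold psi. rewrite (coth_sq y Hy). simpl. ring.
    - intros y Hy. apply (ex_series_minus (V := R_NormedModule)
        (fun m => psi 2 (y + INR m * L)) (fun m => psi 0 (y + INR m * L))); now apply ex_half_sum. }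
  set (Q := 1 + / Rmin x (L - x) ^ 2).
  assert (Hc : forall N i, Rabs (c N i) <= Q) by (intros; now apply abs_coth_window_le).
  (* The [csch2] and the [coth] sums over pairs at distance d, with their edge terms displayed:
     those of [T1] vanish in the limit, those of [T2] survive. *)
  set (T1 := fun N d => 2 * psum (a N) (2 * N + 2) - psum (a N) d
               - psum (fun i => a N (i + (2 * N + 2 - d))%nat) d).
  set (T2 := fun N d => psum (fun i => c N (i + (2 * N + 2 - d))%nat) d - psum (c N) d).
  set (t := fun N n => psi 0 (INR (S n) * L) * T1 N (S n) + 2 * psi 1 (INR (S n) * L) * T2 N (S n)).
  assert (Hsq : forall N, psum (a N) (2 * N + 2) ^ 2
    = psum (fun i => a N i ^ 2) (2 * N + 2) + 2 * psum (t N) (2 * N + 2)).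
  { intros N. rewrite psum_square. do 2 f_equal. apply psum_ext. intros n Hn.
    unfold t, T1, T2. rewrite <- psum_pair_sum, <- psum_pair_diff by lia.
    rewrite <- !psum_scal, <- psum_plus. apply psum_ext. intros i _.
    apply csch2_window_mul; auto; lia. }
  assert (Ht : is_lim_seq (fun N => psum (t N) (2 * N + 2))
    (Series (fun n => 2 * f * psi 0 ((INR n + 1) * L)
                      + 4 * ((INR n + 1) * psi 1 ((INR n + 1) * L))))).
  (* [T1] stays below 2 f, whereas the 2 d edge values in [T2] are only bounded by a multiple of d;
     this is why the weighted series of [psi 1] enters the majorant. *)
  { apply tannery with (M := fun n => 2 * f * psi 0 ((INR n + 1) * L)
                      + 4 * Q * ((INR n + 1) * psi 1 ((INR n + 1) * L))).
    - intros N. lia.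
    - intros N n Hn. unfold t. rewrite S_INR.
      pose proof (pos_INR n) as Hn0.
      assert (Hp0 : 0 < psi 0 ((INR n + 1) * L)) by (apply psi_pos; nra).
      assert (Hp1 : 0 < psi 1 ((INR n + 1) * L)) by (apply psi_pos; nra).
      assert (H1 : 0 <= T1 N (S n) <= 2 * f).
      { split.
        - unfold T1. rewrite <- psum_pair_sum by lia.
          rewrite <- (psum_zero (2 * N + 2 - S n)). apply psum_le. intros i _.
          pose proof (Ha N i). pose proof (Ha N (i + S n)%nat). lra.
        - unfold T1. specialize (Hfle N).
          assert (0 <= psum (a N) (S n)).
          { rewrite <- (psum_zero (S n)). apply psum_le. intros; apply Rlt_le, Ha. }
          assert (0 <= psum (fun i => a N (i + (2 * N + 2 - S n))%nat) (S n)).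
          { rewrite <- (psum_zero (S n)). apply psum_le. intros; apply Rlt_le, Ha. }
          lra. }
      assert (H2 : Rabs (T2 N (S n)) <= 2 * ((INR n + 1) * Q)).
      { unfold T2, Rminus. eapply Rle_trans; [apply Rabs_triang|]. rewrite Rabs_Ropp.
        assert (Rabs (psum (fun i => c N (i + (2 * N + 2 - S n))%nat) (S n)) <= INR (S n) * Q)
          by (apply abs_psum_le; intros; apply Hc).
        assert (Rabs (psum (c N) (S n)) <= INR (S n) * Q)
          by (apply abs_psum_le; intros; apply Hc).
        rewrite S_INR in *. lra. }
      eapply Rle_trans; [apply Rabs_triang|]. apply Rplus_le_compat.
      + rewrite Rabs_mult, !Rabs_pos_eq by lra.
        rewrite Rmult_comm. apply Rmult_le_compat_r; lra.
      + rewrite !Rabs_mult, (Rabs_pos_eq 2), (Rabs_pos_eq (psi 1 _)) by lra.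
        replace (4 * Q * ((INR n + 1) * psi 1 ((INR n + 1) * L)))
          with (2 * psi 1 ((INR n + 1) * L) * (2 * ((INR n + 1) * Q))) by ring.
        apply Rmult_le_compat_l; lra.
    - intros n. unfold t. rewrite S_INR.
      replace (2 * f * psi 0 ((INR n + 1) * L) + 4 * ((INR n + 1) * psi 1 ((INR n + 1) * L)))
        with (psi 0 ((INR n + 1) * L) * (2 * f - INR (S n) * 0 - INR (S n) * 0)
              + 2 * psi 1 ((INR n + 1) * L) * (INR (S n) * 1 - INR (S n) * (- 1)))
        by (rewrite S_INR; ring).
      apply is_lim_seq_plus'.
      + apply (is_lim_seq_scal_l _ _ (Finite _)). unfold T1.
        apply is_lim_seq_minus'; [apply is_lim_seq_minus'|].
        * apply (is_lim_seq_scal_l _ 2 (Finite f)), Hf.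
        * apply is_lim_seq_psum. intros i. now apply is_lim_seq_left_edge.
        * apply (is_lim_seq_psum (fun N i => a N (i + (2 * N + 2 - S n))%nat)). intros i.
          apply is_lim_seq_right_edge; [lra|lia].
      + apply (is_lim_seq_scal_l _ _ (Finite _)). unfold T2.
        apply is_lim_seq_minus'.
        * apply (is_lim_seq_psum (fun N i => c N (i + (2 * N + 2 - S n))%nat)). intros i.
          apply is_lim_seq_right_edge; [lra|lia].
        * apply is_lim_seq_psum. intros i. now apply is_lim_seq_left_edge.
    - apply (ex_series_plus (V := R_NormedModule)
        (fun n => 2 * f * psi 0 ((INR n + 1) * L))
        (fun n => 4 * Q * ((INR n + 1) * psi 1 ((INR n + 1) * L))));
        apply ex_series_scal_R; [now apply ex_half_sum_L|now apply ex_weight_psi1]. }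
  rewrite Series_plus, !Series_scal_l, <- half_sum_L in Ht
    by (apply ex_series_scal_R; first [now apply ex_half_sum_L | now apply ex_weight_psi1]).
  assert (Hl1 : is_lim_seq (fun N => psum (a N) (2 * N + 2) ^ 2) (f ^ 2)).
  { simpl. apply is_lim_seq_mult'; [exact Hf|].
    apply is_lim_seq_mult'; [exact Hf|apply is_lim_seq_const]. }
  pose proof (is_lim_seq_plus' _ _ _ _ Hf2 (is_lim_seq_scal_l _ 2 (Finite _) Ht)) as Hl2.
  apply (is_lim_seq_ext _ _ _ Hsq) in Hl1.
  pose proof (is_lim_seq_unique _ _ Hl1) as E1. pose proof (is_lim_seq_unique _ _ Hl2) as E2.
  pose proof (eq_trans (eq_sym E1) E2) as E3. injection E3 as E3. simpl pow. rewrite E3. unfold coefA, coefB. ring.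
Qed.

(** * The Weierstrass function of the lattice [L Z + i PI Z] on the real axis *)

(** With this constant the terms of 6 wp^2 - g2 / 2 linear in [full_sum] match the second
    derivative. Equivalently, [wp] has no constant Laurent coefficient at 0, where csch^2
    contributes -1 / 3 and the other translates [coefA]. *)
Definition coefC (L : R) : R := 1 / 3 - coefA L.

Definition wp (L x : R) : R := full_sum L x + coefC L.

Definition wp' (L x : R) : R := - 2 * half_sum L 1 x + 2 * half_sum L 1 (L - x).

Definition g2 (L : R) : R := 12 * (coefC L ^ 2 + coefB L).

(** Read off the cubic at L / 2, where [wp'] vanishes by symmetry; its meaning as an Eisenstein sum
    is obtained from the Laurent expansion. *)
Definition g3 (L : R) : R := 4 * wp L (L / 2) ^ 3 - g2 L * wp L (L / 2).

Definition dhalf (L : R) (a : nat) (x : R) : R :=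
  INR a * half_sum L (pred a) x - (INR a + 2) * half_sum L (S a) x.

Lemma is_derive_half_sum_right (L c x : R) (a : nat) : 0 < L -> 0 < c + x ->
  is_derive (fun x => half_sum L a (c + x)) x (dhalf L a (c + x)).
Proof.
  intros HL Hx. rewrite <- (Rmult_1_l (dhalf L a (c + x))).
  apply (is_derive_comp (half_sum L a) (fun x => c + x)).
  - now apply is_derive_half_sum.
  - auto_derive; [auto|ring].
Qed.

Lemma is_derive_half_sum_left (L c x : R) (a : nat) : 0 < L -> 0 < c - x ->
  is_derive (fun x => half_sum L a (c - x)) x (- dhalf L a (c - x)).
Proof.
  intros HL Hx. replace (- dhalf L a (c - x)) with (-1 * dhalf L a (c - x)) by ring.
  apply (is_derive_comp (half_sum L a) (fun x => c - x)).
  - now apply is_derive_half_sum.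
  - auto_derive; [auto|ring].
Qed.

Lemma is_derive_wp (L x : R) : 0 < x < L -> is_derive (wp L) x (wp' L x).
Proof.
  intros Hx. unfold wp, full_sum, wp'. evar_last.
  - apply (is_derive_plus (V := R_NormedModule)); [|apply @is_derive_const].
    apply (is_derive_plus (V := R_NormedModule)).
    + apply is_derive_half_sum; lra.
    + apply is_derive_half_sum_left; lra.
  - unfold plus, zero, dhalf; simpl. ring.
Qed.

Lemma is_derive_wp' (L x : R) : 0 < x < L ->
  is_derive (wp' L) x (6 * wp L x ^ 2 - g2 L / 2).
Proof.
  intros Hx. unfold wp' at 1. evar_last.
  - apply (is_derive_plus (V := R_NormedModule)); apply is_derive_scal.
    + apply is_derive_half_sum; lra.
    + apply is_derive_half_sum_left; lra.
  - unfold wp, g2. set (f := full_sum L x).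
    replace (6 * (f + coefC L) ^ 2 - 12 * (coefC L ^ 2 + coefB L) / 2)
      with (6 * f ^ 2 + 12 * coefC L * f - 6 * coefB L) by field.
    unfold f at 1. rewrite full_sum_square by auto. unfold f, full_sum, coefC, dhalf, plus; simpl.
    field.
Qed.

Lemma constant_of_derive (g : R -> R) (a b x y : R) :
  (forall z, a < z < b -> is_derive g z 0) -> a < x < b -> a < y < b -> g x = g y.
Proof.
  intros H Hx Hy.
  assert (Rabs (g y - g x) <= 0 * Rabs (y - x)).
  { apply mvt_bound with (dg := fun _ => 0).
    - intros z Hz. apply H. revert Hz. unfold Rmin, Rmax. destruct (Rle_dec x y); lra.
    - intros z _. rewrite Rabs_R0. lra. }
  rewrite Rmult_0_l in *. pose proof (Rabs_pos (g y - g x)).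
  assert (E : Rabs (g y - g x) = 0) by lra. apply Rabs_eq_0 in E. lra.
Qed.

(** By [is_derive_wp'] the two sides differ by a constant, which is 0 at L / 2 by the choice of
    [g3]. *)
Lemma wp_equation (L x : R) : 0 < x < L ->
  wp' L x ^ 2 = 4 * wp L x ^ 3 - g2 L * wp L x - g3 L.
Proof.
  intros Hx.
  set (D := fun x => wp' L x ^ 2 - 4 * wp L x ^ 3 + g2 L * wp L x).
  assert (E : D x = D (L / 2)).
  { apply (constant_of_derive D 0 L); [|lra|lra]. intros z Hz. unfold D. evar_last.
    - apply (is_derive_plus (V := R_NormedModule)).
      + apply (is_derive_minus (V := R_NormedModule)).
        * apply is_derive_pow, is_derive_wp', Hz.
        * apply is_derive_scal, is_derive_pow, is_derive_wp, Hz.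
      + apply is_derive_scal, is_derive_wp, Hz.
    - unfold plus, minus, plus, opp; simpl. field. }
  assert (H0 : wp' L (L / 2) = 0).
  { unfold wp'. replace (L - L / 2) with (L / 2) by field. ring. }
  unfold D in E. rewrite H0 in E. unfold g3. lra.
Qed.

Lemma half_sum_shift (L x : R) (a : nat) : 0 < L -> 0 < x ->
  half_sum L a x = psi a x + half_sum L a (L + x).
Proof.
  intros HL Hx. unfold half_sum. rewrite Series_incr_1 by now apply ex_half_sum.
  f_equal.
  - simpl. f_equal. ring.
  - apply Series_ext. intros n. rewrite S_INR. f_equal. ring.
Qed.

(** [wp] without its double pole, in a form smooth on |x| < L. The definitions that follow are its
    successive derivatives, needed up to the fifth to bound the remainder after the x^4 term. *)
Definition wp_reg (L x : R) : R :=
  coefC L + row 2 x + (half_sum L 0 (L + x) + half_sum L 0 (L - x)).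

Definition wp_reg1 (L x : R) : R :=
  - 2 * row 3 x + (- 2 * half_sum L 1 (L + x) + 2 * half_sum L 1 (L - x)).

Definition wp_reg2 (L x : R) : R :=
  6 * row 4 x + ((- 2 * half_sum L 0 (L + x) + 6 * half_sum L 2 (L + x))
                 + (- 2 * half_sum L 0 (L - x) + 6 * half_sum L 2 (L - x))).

Definition wp_reg3 (L x : R) : R :=
  - 24 * row 5 x + ((16 * half_sum L 1 (L + x) - 24 * half_sum L 3 (L + x))
                 - (16 * half_sum L 1 (L - x) - 24 * half_sum L 3 (L - x))).

Definition wp_reg4 (L x : R) : R :=
  120 * row 6 x
  + ((16 * half_sum L 0 (L + x) - 120 * half_sum L 2 (L + x) + 120 * half_sum L 4 (L + x))
     + (16 * half_sum L 0 (L - x) - 120 * half_sum L 2 (L - x) + 120 * half_sum L 4 (L - x))).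

Definition wp_reg5 (L x : R) : R :=
  - 720 * row 7 x
  + ((- 272 * half_sum L 1 (L + x) + 960 * half_sum L 3 (L + x) - 720 * half_sum L 5 (L + x))
     - (- 272 * half_sum L 1 (L - x) + 960 * half_sum L 3 (L - x) - 720 * half_sum L 5 (L - x))).

Ltac derive_sums :=
  lazymatch goal with
  | |- is_derive (fun x => @?f x + @?g x) _ _ =>
      apply (is_derive_plus (V := R_NormedModule) f g); derive_sums
  | |- is_derive (fun x => @?f x - @?g x) _ _ =>
      apply (is_derive_minus (V := R_NormedModule) f g); derive_sums
  | |- is_derive (fun x => ?c * @?f x) _ _ => apply (is_derive_scal f); derive_sums
  | |- is_derive (fun x => half_sum _ _ (_ + x)) _ _ => apply is_derive_half_sum_right; lra
  | |- is_derive (fun x => half_sum _ _ (_ - x)) _ _ => apply is_derive_half_sum_left; lra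
  | |- is_derive (fun x => row ?k x) _ _ => apply (is_derive_row k); lia
  | |- is_derive (fun x => coefC _) _ _ => apply @is_derive_const
  end.

Lemma is_derive_wp_reg (L x : R) : Rabs x < L ->
  is_derive (wp_reg L) x (wp_reg1 L x) /\ is_derive (wp_reg1 L) x (wp_reg2 L x) /\
  is_derive (wp_reg2 L) x (wp_reg3 L x) /\ is_derive (wp_reg3 L) x (wp_reg4 L x) /\
  is_derive (wp_reg4 L) x (wp_reg5 L x) /\ ex_derive (wp_reg5 L) x.
Proof.
  intros Hx. apply Rabs_def2 in Hx.
  refine (conj _ (conj _ (conj _ (conj _ (conj _ _))))).
  6: eexists; unfold wp_reg5; derive_sums.
  all: evar_last; [unfold wp_reg, wp_reg1, wp_reg2, wp_reg3, wp_reg4; derive_sums|];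
    unfold wp_reg1, wp_reg2, wp_reg3, wp_reg4, wp_reg5, dhalf, plus, minus, plus, opp, zero; simpl; ring.
Qed.

Lemma wp_laurent (L x : R) : 0 < x < L ->
  wp L x = / x ^ 2 + wp_reg L x /\ wp' L x = - 2 * / x ^ 3 + wp_reg1 L x /\
  6 * wp L x ^ 2 - g2 L / 2 = 6 * / x ^ 4 + wp_reg2 L x.
Proof.
  assert (H0 : forall x, 0 < x < L -> wp L x = / x ^ 2 + wp_reg L x).
  { intros z Hz. unfold wp, full_sum, wp_reg.
    rewrite half_sum_shift, csch2_row by lra. ring. }
  assert (Hstep : forall (f g df dg : R -> R),
    (forall x, 0 < x < L -> f x = g x) ->
    (forall x, 0 < x < L -> is_derive f x (df x)) ->
    (forall x, 0 < x < L -> is_derive g x (dg x)) -> forall x, 0 < x < L -> df x = dg x).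
  { intros f g df dg Hfg Hf Hg z Hz.
    rewrite <- (is_derive_unique _ _ _ (Hg z Hz)). symmetry. apply is_derive_unique.
    apply is_derive_ext_loc with f; [|now apply Hf].
    assert (Hm : 0 < Rmin z (L - z)) by (apply Rmin_pos; lra).
    exists (mkposreal _ Hm). intros y Hy. apply Hfg.
    apply Rabs_def2 in Hy. simpl in Hy. unfold minus, plus, opp in Hy; simpl in Hy.
    pose proof (Rmin_l z (L - z)). pose proof (Rmin_r z (L - z)). lra. }
  assert (H1 : forall x, 0 < x < L -> wp' L x = - 2 * / x ^ 3 + wp_reg1 L x).
  { apply (Hstep (wp L) (fun x => / x ^ 2 + wp_reg L x)); [exact H0|apply is_derive_wp|].
    intros z Hz. apply (is_derive_plus (V := R_NormedModule) (fun x => / x ^ 2)).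
    - auto_derive; [nra|field; lra].
    - apply is_derive_wp_reg. rewrite Rabs_pos_eq; lra. }
  assert (H2 : forall x, 0 < x < L -> 6 * wp L x ^ 2 - g2 L / 2 = 6 * / x ^ 4 + wp_reg2 L x).
  { apply (Hstep (wp' L) (fun x => - 2 * / x ^ 3 + wp_reg1 L x)); [exact H1|apply is_derive_wp'|].
    intros z Hz. apply (is_derive_plus (V := R_NormedModule) (fun x => - 2 * / x ^ 3)).
    - auto_derive; [|field; lra]. assert (0 < z ^ 3) by (apply pow_lt; lra). simpl in *. lra.
    - apply is_derive_wp_reg. rewrite Rabs_pos_eq; lra. }
  auto.
Qed.

(** * Identification of the invariants *)

(** Stands for O(1) as x tends to 0 from the right; remainders of expansions are carried as explicit
    bounded functions. *)
Definition bounded_on (d : R) (f : R -> R) : Prop :=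
  exists C, forall x, 0 < x <= d -> Rabs (f x) <= C.

Lemma bounded_on_const (d c : R) : bounded_on d (fun _ => c).
Proof. exists (Rabs c). intros; lra. Qed.

Lemma bounded_on_id (d : R) : bounded_on d (fun x => x).
Proof. exists d. intros x Hx. rewrite Rabs_pos_eq; lra. Qed.

Lemma bounded_on_plus (d : R) (f g : R -> R) :
  bounded_on d f -> bounded_on d g -> bounded_on d (fun x => f x + g x).
Proof.
  intros [C HC] [D HD]. exists (C + D). intros x Hx.
  eapply Rle_trans; [apply Rabs_triang|]. specialize (HC x Hx). specialize (HD x Hx). lra.
Qed.

Lemma bounded_on_mult (d : R) (f g : R -> R) :
  bounded_on d f -> bounded_on d g -> bounded_on d (fun x => f x * g x).
Proof.
  intros [C HC] [D HD]. exists (C * D). intros x Hx. rewrite Rabs_mult.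
  apply Rmult_le_compat; auto using Rabs_pos.
Qed.

Lemma bounded_on_minus (d : R) (f g : R -> R) :
  bounded_on d f -> bounded_on d g -> bounded_on d (fun x => f x - g x).
Proof.
  intros Hf Hg. unfold Rminus. apply bounded_on_plus; auto.
  destruct Hg as [C HC]. exists C. intros x Hx. rewrite Rabs_Ropp. auto.
Qed.

Lemma bounded_on_pow (d : R) (f : R -> R) (n : nat) :
  bounded_on d f -> bounded_on d (fun x => f x ^ n).
Proof.
  intros Hf. induction n; simpl; [apply bounded_on_const|now apply bounded_on_mult].
Qed.

Ltac bounded :=
  repeat first [ assumption | apply bounded_on_const | apply bounded_on_id
    | apply bounded_on_minus | apply bounded_on_plus | apply bounded_on_mult | apply bounded_on_pow ].

Lemma eq_0_of_bounded (d v : R) (f : R -> R) : 0 < d -> bounded_on d f ->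
  (forall x, 0 < x <= d -> v = x * f x) -> v = 0.
Proof.
  intros Hd [C HC] H. destruct (Req_dec v 0) as [|Hv]; auto. exfalso.
  assert (HC0 : 0 <= C) by (eapply Rle_trans; [apply Rabs_pos|apply (HC d); lra]).
  assert (Hav : 0 < Rabs v) by now apply Rabs_pos_lt.
  set (x := Rmin d (Rabs v / (2 * (C + 1)))).
  assert (Hq : 0 < Rabs v / (2 * (C + 1))) by (apply Rdiv_lt_0_compat; lra).
  assert (Hx : 0 < x <= d) by (split; [apply Rmin_pos; auto|apply Rmin_l]).
  assert (Hx2 : x <= Rabs v / (2 * (C + 1))) by apply Rmin_r.
  pose proof (f_equal Rabs (H x Hx)) as E. rewrite Rabs_mult, (Rabs_pos_eq x) in E by lra.
  specialize (HC x Hx).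
  assert (x * (2 * (C + 1)) <= Rabs v).
  { apply Rmult_le_reg_r with (/ (2 * (C + 1))); [apply Rinv_0_lt_compat; lra|].
    rewrite Rmult_assoc, Rinv_r by lra. unfold Rdiv in Hx2. lra. }
  pose proof (Rabs_pos (f x)). nra.
Qed.

Lemma taylor_step (d K : R) (n : nat) (g dg : R -> R) : 0 <= K ->
  g 0 = 0 -> (forall x, 0 <= x <= d -> is_derive g x (dg x)) ->
  (forall x, 0 <= x <= d -> Rabs (dg x) <= K * x ^ n) ->
  forall x, 0 <= x <= d -> Rabs (g x) <= K * x ^ S n.
Proof.
  intros HK H0 Hd Hb x Hx. replace (g x) with (g x - g 0) by (rewrite H0; ring).
  replace (K * x ^ S n) with (K * x ^ n * Rabs (x - 0))
    by (rewrite Rminus_0_r, Rabs_pos_eq by lra; simpl; ring).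
  apply mvt_bound with dg; rewrite Rmin_left, Rmax_right by lra.
  - intros z Hz. apply Hd. lra.
  - intros z Hz. eapply Rle_trans; [apply Hb; lra|].
    apply Rmult_le_compat_l; auto. apply pow_incr. lra.
Qed.

Lemma bounded_remainder (d K : R) (n : nat) (g : R -> R) :
  (forall x, 0 <= x <= d -> Rabs (g x) <= K * x ^ n) -> bounded_on d (fun x => g x / x ^ n).
Proof.
  intros H. exists K. intros x Hx.
  assert (Hn : 0 < x ^ n) by (apply pow_lt; lra).
  unfold Rdiv. rewrite Rabs_mult, Rabs_inv, (Rabs_pos_eq (x ^ n)) by lra.
  apply Rmult_le_reg_r with (x ^ n); auto. rewrite Rmult_assoc, Rinv_l, Rmult_1_r by lra.
  apply H. lra.
Qed.

(** An odd power of 1 / (i y) is purely imaginary. *)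
Lemma row_odd_0 (k : nat) : (k = 3 \/ k = 5)%nat -> row k 0 = 0.
Proof.
  intros Hk. unfold row. rewrite (Series_ext _ (fun _ => 0)).
  - apply is_series_unique. apply psum_lim.
    apply is_lim_seq_ext with (fun _ => 0); [intros n; now rewrite psum_zero|apply is_lim_seq_const].
  - intros n. set (y := PI * (INR n + 1)). destruct Hk; subst k; simpl; unfold Rdiv; ring.
Qed.

(** Comparison of coefficients for the expansion x^-2 + r + a x^2 / 2 + b x^4 / 24: the second-order
    equation forces r = 0 and then a = g2 / 10, and the first-order equation gives b = 6 g3 / 7. *)
Lemma invariants_regular (L : R) : 0 < L ->
  g2 L = 10 * wp_reg2 L 0 /\ g3 L = 7 / 6 * wp_reg4 L 0.
Proof.
  intros HL. set (d := L / 2). assert (Hd : 0 < d) by (unfold d; lra).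
  assert (D : forall x, 0 <= x <= d -> is_derive (wp_reg L) x (wp_reg1 L x) /\
    is_derive (wp_reg1 L) x (wp_reg2 L x) /\ is_derive (wp_reg2 L) x (wp_reg3 L x) /\
    is_derive (wp_reg3 L) x (wp_reg4 L x) /\ is_derive (wp_reg4 L) x (wp_reg5 L x) /\
    ex_derive (wp_reg5 L) x).
  { intros x Hx. apply is_derive_wp_reg. rewrite Rabs_pos_eq; unfold d in *; lra. }
  assert (HK : exists K, 0 <= K /\ forall x, 0 <= x <= d -> Rabs (wp_reg5 L x) <= K).
  { destruct (continuity_ab_maj (fun x => Rabs (wp_reg5 L x)) 0 d) as [M [HM _]]; [lra| |].
    - intros c Hc. apply (continuity_pt_comp (wp_reg5 L) Rabs); [|apply Rcontinuity_abs].
      destruct (D c Hc) as (_ & _ & _ & _ & _ & [l Hl]).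
      apply derivable_continuous_pt. exists l. now apply is_derive_Reals.
    - exists (Rabs (wp_reg5 L M)). split; [apply Rabs_pos|exact HM]. }
  destruct HK as [K [HK0 HK]].
  set (r := wp_reg L 0). set (a := wp_reg2 L 0). set (b := wp_reg4 L 0).
  assert (Z1 : wp_reg1 L 0 = 0).
  { unfold wp_reg1. rewrite row_odd_0, Rplus_0_r, Rminus_0_r by auto. ring. }
  assert (Z3 : wp_reg3 L 0 = 0).
  { unfold wp_reg3. rewrite row_odd_0, Rplus_0_r, Rminus_0_r by auto. ring. }
  assert (B4 : forall x, 0 <= x <= d -> Rabs (wp_reg4 L x - b) <= K * x ^ 1).
  { apply taylor_step with (dg := wp_reg5 L); auto.
    - unfold b. ring.
    - intros x Hx. destruct (D x Hx) as (_ & _ & _ & _ & H & _). evar_last.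
      + apply (is_derive_minus (V := R_NormedModule)); [exact H|apply @is_derive_const].
      + unfold minus, plus, opp, zero; simpl. ring.
    - intros x Hx. rewrite pow_O, Rmult_1_r. auto. }
  assert (B3 : forall x, 0 <= x <= d -> Rabs (wp_reg3 L x - b * x) <= K * x ^ 2).
  { apply taylor_step with (dg := fun x => wp_reg4 L x - b); auto.
    - rewrite Z3. ring.
    - intros x Hx. destruct (D x Hx) as (_ & _ & _ & H & _).
      apply (is_derive_minus (V := R_NormedModule)); [exact H|]. auto_derive; [auto|ring]. }
  assert (B2 : forall x, 0 <= x <= d -> Rabs (wp_reg2 L x - (a + b * x ^ 2 / 2)) <= K * x ^ 3).
  { apply taylor_step with (dg := fun x => wp_reg3 L x - b * x); auto.
    - unfold a. field.
    - intros x Hx. destruct (D x Hx) as (_ & _ & H & _).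
      apply (is_derive_minus (V := R_NormedModule)); [exact H|]. auto_derive; [auto|field]. }
  assert (B1 : forall x, 0 <= x <= d ->
    Rabs (wp_reg1 L x - (a * x + b * x ^ 3 / 6)) <= K * x ^ 4).
  { apply taylor_step with (dg := fun x => wp_reg2 L x - (a + b * x ^ 2 / 2)); auto.
    - rewrite Z1. field.
    - intros x Hx. destruct (D x Hx) as (_ & H & _).
      apply (is_derive_minus (V := R_NormedModule)); [exact H|]. auto_derive; [auto|field]. }
  assert (B0 : forall x, 0 <= x <= d ->
    Rabs (wp_reg L x - (r + a * x ^ 2 / 2 + b * x ^ 4 / 24)) <= K * x ^ 5).
  { apply taylor_step with (dg := fun x => wp_reg1 L x - (a * x + b * x ^ 3 / 6)); auto.
    - unfold r. field.
    - intros x Hx. destruct (D x Hx) as (H & _).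
      apply (is_derive_minus (V := R_NormedModule)); [exact H|]. auto_derive; [auto|field]. }
  apply bounded_remainder in B0, B1, B2.
  set (e0 := fun x => (wp_reg L x - (r + a * x ^ 2 / 2 + b * x ^ 4 / 24)) / x ^ 5) in B0.
  set (e1 := fun x => (wp_reg1 L x - (a * x + b * x ^ 3 / 6)) / x ^ 4) in B1.
  set (e2 := fun x => (wp_reg2 L x - (a + b * x ^ 2 / 2)) / x ^ 3) in B2.
  assert (R0 : forall x, 0 < x <= d -> wp_reg L x = r + a * x ^ 2 / 2 + b * x ^ 4 / 24 + x ^ 5 * e0 x)
    by (intros x Hx; unfold e0; field; lra).
  assert (R1 : forall x, 0 < x <= d -> wp_reg1 L x = a * x + b * x ^ 3 / 6 + x ^ 4 * e1 x)
    by (intros x Hx; unfold e1; field; lra).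
  assert (R2 : forall x, 0 < x <= d -> wp_reg2 L x = a + b * x ^ 2 / 2 + x ^ 3 * e2 x)
    by (intros x Hx; unfold e2; field; lra).
  clearbody e0 e1 e2.
  (* The second-order equation times x^2: the poles of fourth order cancel, and the only term
     without a factor x is the one with 12 [wp_reg]. *)
  assert (Eq1 : forall x, 0 < x <= d ->
    x ^ 2 * wp_reg2 L x = 12 * wp_reg L x + 6 * x ^ 2 * wp_reg L x ^ 2 - g2 L / 2 * x ^ 2).
  { intros x Hx. destruct (wp_laurent L x) as (E0 & _ & E2); [unfold d in *; lra|].
    rewrite E0 in E2. replace (wp_reg2 L x) with
      (6 * (/ x ^ 2 + wp_reg L x) ^ 2 - g2 L / 2 - 6 * / x ^ 4) by lra. field. lra. }
  assert (Hr : r = 0).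
  { apply eq_0_of_bounded with d (fun x => x * (wp_reg2 L x - 6 * wp_reg L x ^ 2 + g2 L / 2 - 6 * a) / 12
      - (b * x ^ 3 * / 24 + x ^ 4 * e0 x)); auto.
    - assert (bounded_on d (wp_reg L)).
      { destruct (bounded_on_plus d (fun x => r + a * x ^ 2 * / 2 + b * x ^ 4 * / 24) (fun x => x ^ 5 * e0 x)
          ltac:(bounded) ltac:(bounded)) as [C HC].
        exists C. intros x Hx. rewrite R0 by auto. apply HC, Hx. }
      assert (bounded_on d (wp_reg2 L)).
      { destruct (bounded_on_plus d (fun x => a + b * x ^ 2 * / 2) (fun x => x ^ 3 * e2 x)
          ltac:(bounded) ltac:(bounded)) as [C HC].
        exists C. intros x Hx. rewrite R2 by auto. apply HC, Hx. }
      unfold Rdiv. bounded.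
    - intros x Hx. specialize (Eq1 x Hx). pose proof (R0 x Hx) as E.
      set (w := wp_reg L x) in *. set (w2 := wp_reg2 L x) in *.
      replace (x * (x * (w2 - 6 * w ^ 2 + g2 L / 2 - 6 * a) / 12 - (b * x ^ 3 * / 24 + x ^ 4 * e0 x)))
        with ((x ^ 2 * w2 - 6 * x ^ 2 * w ^ 2 + g2 L / 2 * x ^ 2) / 12
              - (a * x ^ 2 / 2 + b * x ^ 4 / 24 + x ^ 5 * e0 x)) by field.
      rewrite Eq1. lra. }
  rewrite Hr in R0.
  (* Once r = 0, the factors x^2 of [wp_reg] and x of [wp_reg1] can be split off, which lets the
     poles of the cubic equation cancel explicitly. *)
  set (S0 := fun x => a * / 2 + b * x ^ 2 * / 24 + x ^ 3 * e0 x).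
  set (S1 := fun x => a + b * x ^ 2 * / 6 + x ^ 3 * e1 x).
  assert (BS0 : bounded_on d S0) by (unfold S0; bounded).
  assert (BS1 : bounded_on d S1) by (unfold S1; bounded).
  assert (R0' : forall x, 0 < x <= d -> wp_reg L x = x ^ 2 * S0 x)
    by (intros x Hx; rewrite R0 by auto; unfold S0; field).
  assert (R1' : forall x, 0 < x <= d -> wp_reg1 L x = x * S1 x)
    by (intros x Hx; rewrite R1 by auto; unfold S1; field).
  assert (H2 : 5 * a - g2 L / 2 = 0).
  { apply eq_0_of_bounded with d (fun x => x ^ 2 * e2 x - 12 * (x ^ 2 * e0 x) - 6 * (x ^ 3 * S0 x ^ 2)); auto.
    - bounded.
    - intros x Hx. specialize (Eq1 x Hx). rewrite R0' in Eq1 by auto.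
      assert (E : wp_reg2 L x = 12 * S0 x + 6 * x ^ 4 * S0 x ^ 2 - g2 L / 2).
      { apply Rmult_eq_reg_l with (x ^ 2); [rewrite Eq1; ring|apply pow_nonzero; lra]. }
      rewrite R2 in E by auto.
      replace (x * (x ^ 2 * e2 x - 12 * (x ^ 2 * e0 x) - 6 * (x ^ 3 * S0 x ^ 2)))
        with (x ^ 3 * e2 x - 12 * x ^ 3 * e0 x - 6 * x ^ 4 * S0 x ^ 2) by ring.
      unfold S0 in E at 1. lra. }
  assert (H3 : g3 L - 7 / 6 * b = 0).
  { apply eq_0_of_bounded with d (fun x => 4 * e1 x + 12 * e0 x - x * S1 x ^ 2 + 12 * (x * S0 x ^ 2)
      + 4 * (x ^ 5 * S0 x ^ 3) - g2 L * (x * S0 x)); auto.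
    - bounded.
    - intros x Hx. destruct (wp_laurent L x) as (E0 & E1 & _); [unfold d in *; lra|].
      pose proof (wp_equation L x ltac:(unfold d in *; lra)) as E.
      rewrite E0, E1, R0', R1' in E by auto.
      assert (E' : g3 L = (4 * S1 x + 12 * S0 x - g2 L) / x ^ 2 - x ^ 2 * S1 x ^ 2
        + 12 * x ^ 2 * S0 x ^ 2 + 4 * x ^ 6 * S0 x ^ 3 - g2 L * x ^ 2 * S0 x).
      { replace (g3 L) with (4 * (/ x ^ 2 + x ^ 2 * S0 x) ^ 3 - g2 L * (/ x ^ 2 + x ^ 2 * S0 x)
          - (-2 * / x ^ 3 + x * S1 x) ^ 2) by lra. field. lra. }
      assert (E2 : (4 * S1 x + 12 * S0 x - g2 L) / x ^ 2 = 7 / 6 * b + x * (4 * e1 x + 12 * e0 x)).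
      { replace (g2 L) with (10 * a) by lra. unfold S0, S1. field. lra. }
      rewrite E', E2. ring. }
  split; lra.
Qed.

(** The sum of w^-4 over the nonzero points of L Z + i PI Z, by rows: the imaginary axis first, then
    the rows m and -m together in the closed form of [psi_row4]. *)
Definition eis4 (L : R) : R := row 4 0 + 2 * (half_sum L 2 L - half_sum L 0 L / 3).

Definition eis6 (L : R) : R :=
  row 6 0 + 2 * (half_sum L 4 L - half_sum L 2 L + 2 / 15 * half_sum L 0 L).

Lemma g2_eis4 (L : R) : 0 < L -> g2 L = 60 * eis4 L.
Proof.
  intros HL. rewrite (proj1 (invariants_regular L HL)). unfold wp_reg2, eis4.
  rewrite Rplus_0_r, Rminus_0_r. field.
Qed.

Lemma g3_eis6 (L : R) : 0 < L -> g3 L = 140 * eis6 L.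
Proof.
  intros HL. rewrite (proj2 (invariants_regular L HL)). unfold wp_reg4, eis6.
  rewrite Rplus_0_r, Rminus_0_r. field.
Qed.

(** * Eisenstein sums of rectangular lattices *)

Lemma inv_pow_zero (k : nat) : (1 <= k)%nat -> inv_pow k 0 0 = RtoC 0.
Proof.
  destruct k as [|k]; [lia|]. intros _. unfold inv_pow. simpl cpow.
  replace (Cinv (0, 0)) with (RtoC 0); [apply Cmult_0_l|].
  unfold Cinv, RtoC; simpl. f_equal; unfold Rdiv; ring.
Qed.

Lemma inv_pow_scale (k : nat) (s x y : R) : s <> 0 ->
  inv_pow k (s * x) (s * y) = Cmult (RtoC ((/ s) ^ k)) (inv_pow k x y).
Proof.
  intros Hs. unfold inv_pow.
  assert (E : Cinv (s * x, s * y) = Cmult (RtoC (/ s)) (Cinv (x, y))).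
  { unfold Cinv, Cmult, RtoC; simpl.
    destruct (Req_dec (x ^ 2 + y ^ 2) 0) as [H|H].
    - assert (x = 0 /\ y = 0) as [-> ->].
      { pose proof (pow2_ge_0 x). pose proof (pow2_ge_0 y). split; nra. }
      f_equal; unfold Rdiv; ring.
    - assert (s * x * (s * x * 1) + s * y * (s * y * 1) <> 0).
      { replace (s * x * (s * x * 1) + s * y * (s * y * 1)) with (s ^ 2 * (x ^ 2 + y ^ 2)) by ring.
        apply Rmult_integral_contrapositive. split; auto using pow_nonzero. }
      rewrite !Rmult_1_r in *. f_equal; field; simpl in H; rewrite !Rmult_1_r in H; auto. }
  rewrite E. induction k as [|k IH]; [simpl; now rewrite Cmult_1_l|].
  simpl. rewrite IH, RtoC_mult. ring.
Qed.

Lemma Re_scal (a : R) (z : C) : Re (Cmult (RtoC a) z) = a * Re z.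
Proof. unfold Re, Cmult, RtoC; simpl; ring. Qed.

Lemma inv_pow_conj (k : nat) (x y : R) :
  Re (inv_pow k x (- y)) = Re (inv_pow k x y) /\ Im (inv_pow k x (- y)) = - Im (inv_pow k x y).
Proof.
  assert (E : Cinv (x, - y) = Cconj (Cinv (x, y))).
  { unfold Cinv, Cconj; simpl.
    replace (- y * (- y * 1)) with (y * (y * 1)) by ring. f_equal. unfold Rdiv. ring. }
  unfold inv_pow. rewrite E. set (z := Cinv (x, y)). induction k as [|k [IHr IHi]].
  - simpl. split; ring.
  - assert (ER : forall w, Re (cpow w (S k)) = Re w * Re (cpow w k) - Im w * Im (cpow w k))
      by reflexivity.
    assert (EI : forall w, Im (cpow w (S k)) = Re w * Im (cpow w k) + Im w * Re (cpow w k))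
      by reflexivity.
    rewrite !ER, !EI, IHr, IHi. unfold Cconj, Re, Im; simpl. split; ring.
Qed.

Lemma Im_inv_pow_real (k : nat) (x : R) : Im (inv_pow k x 0) = 0.
Proof. pose proof (proj2 (inv_pow_conj k x 0)) as H. rewrite Ropp_0 in H. lra. Qed.

Lemma Re_inv_pow_real (k : nat) (x : R) : x <> 0 -> Re (inv_pow k x 0) = / x ^ k.
Proof.
  intros Hx. replace (inv_pow k x 0) with (inv_pow k (x * 1) (x * 0)) by (f_equal; ring).
  rewrite inv_pow_scale, Re_scal, pow_inv by auto.
  replace (Re (inv_pow k 1 0)) with 1; [ring|].
  unfold inv_pow. replace (Cinv (1, 0)) with (RtoC 1).
  - replace (cpow (RtoC 1) k) with (RtoC 1); [reflexivity|].
    induction k; [reflexivity|].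
    change (cpow (RtoC 1) (S k)) with (Cmult (RtoC 1) (cpow (RtoC 1) k)).
    rewrite <- IHk. symmetry. apply Cmult_1_l.
  - unfold Cinv, RtoC; simpl. f_equal; field.
Qed.

Lemma inv_pow_even (k : nat) (x y : R) : Nat.Even k -> Re (inv_pow k (- x) y) = Re (inv_pow k x y).
Proof.
  intros [j Hj]. rewrite <- (proj1 (inv_pow_conj k (- x) y)).
  replace (- x) with (-1 * x) by ring. replace (- y) with (-1 * y) by ring.
  rewrite inv_pow_scale, Re_scal by lra.
  replace ((/ -1) ^ k) with 1; [ring|].
  rewrite Hj, pow_mult. replace ((/ -1) ^ 2) with 1 by field. now rewrite pow1.
Qed.

Lemma Re_csum (f : nat -> C) (n : nat) : Re (csum f n) = psum (fun i => Re (f i)) (S n).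
Proof.
  induction n; simpl; [ring|].
  simpl in IHn. rewrite <- IHn. reflexivity.
Qed.

Lemma Im_csum (f : nat -> C) (n : nat) : Im (csum f n) = psum (fun i => Im (f i)) (S n).
Proof.
  induction n; simpl; [ring|].
  simpl in IHn. rewrite <- IHn. reflexivity.
Qed.

Lemma Cinv_cpow (z : C) (k : nat) : z <> RtoC 0 -> Cinv (cpow z k) = cpow (Cinv z) k.
Proof.
  intros Hz. induction k as [|k IH]; simpl.
  - unfold Cinv, RtoC; simpl. f_equal; field.
  - rewrite <- IH.
    assert (Hk : cpow z k <> RtoC 0).
    { intros E. apply (f_equal Cmod) in E. rewrite Cmod_cpow, Cmod_0 in E.
      apply Cmod_gt_0 in Hz. revert E. apply pow_nonzero. lra. }
    field. auto.
Qed.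

Definition zoff (i N : nat) : R := IZR (Z.of_nat i - Z.of_nat N).

Lemma eisen_term (k : nat) (Om T : R) (m n : Z) : (1 <= k)%nat -> 0 < Om -> 0 < T ->
  (if (Z.eqb m 0 && Z.eqb n 0)%bool then RtoC 0
   else Cinv (cpow (lat_pt (RtoC Om) (0, T) m n) k))
  = inv_pow k (2 * Om * IZR m) (2 * T * IZR n).
Proof.
  intros Hk HOm HT.
  assert (E : lat_pt (RtoC Om) (0, T) m n = (2 * Om * IZR m, 2 * T * IZR n)).
  { unfold lat_pt, Cplus, Cmult, RtoC; simpl. f_equal; ring. }
  destruct (Z.eqb_spec m 0) as [Hm|Hm]; destruct (Z.eqb_spec n 0) as [Hn|Hn]; simpl.
  1: { subst. rewrite !Rmult_0_r, inv_pow_zero by auto. reflexivity. }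
  all: rewrite E; apply Cinv_cpow; intros E0; injection E0; intros E1 E2.
  - apply Hn, eq_IZR. nra.
  - apply Hm, eq_IZR. nra.
  - apply Hm, eq_IZR. nra.
Qed.

Lemma Re_eisen_partial (k : nat) (Om T : R) (N : nat) : (1 <= k)%nat -> 0 < Om -> 0 < T ->
  Re (eisen_partial k (RtoC Om) (0, T) N) =
  psum (fun i => psum (fun j => Re (inv_pow k (2 * Om * zoff i N) (2 * T * zoff j N))) (S (2 * N)))
    (S (2 * N)).
Proof.
  intros Hk HOm HT. unfold eisen_partial. rewrite Re_csum. apply psum_ext. intros i _.
  rewrite Re_csum. apply psum_ext. intros j _. cbv zeta. now rewrite eisen_term.
Qed.

Lemma Im_eisen_partial (k : nat) (Om T : R) (N : nat) : (1 <= k)%nat -> 0 < Om -> 0 < T ->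
  Im (eisen_partial k (RtoC Om) (0, T) N) =
  psum (fun i => psum (fun j => Im (inv_pow k (2 * Om * zoff i N) (2 * T * zoff j N))) (S (2 * N)))
    (S (2 * N)).
Proof.
  intros Hk HOm HT. unfold eisen_partial. rewrite Im_csum. apply psum_ext. intros i _.
  rewrite Im_csum. apply psum_ext. intros j _. cbv zeta. now rewrite eisen_term.
Qed.

Lemma psum_symmetric (g : R -> R) (N : nat) :
  psum (fun j => g (zoff j N)) (S (2 * N)) = g 0 + psum (fun n => g (INR n + 1) + g (- (INR n + 1))) N.
Proof.
  induction N as [|N IH].
  - simpl. unfold zoff. simpl. ring.
  - replace (S (2 * S N)) with (S (S (S (2 * N)))) by lia.
    rewrite psum_first, psum_S.
    rewrite (psum_ext (fun i => g (zoff (S i) (S N))) (fun j => g (zoff j N))).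
    + rewrite IH, psum_S.
      replace (zoff 0 (S N)) with (- (INR N + 1)).
      2: { unfold zoff. rewrite minus_IZR, <- !INR_IZR_INZ, S_INR. simpl. ring. }
      replace (zoff (S (S (2 * N))) (S N)) with (INR N + 1); [ring|].
      unfold zoff. rewrite minus_IZR, <- !INR_IZR_INZ, !S_INR, mult_INR. simpl. ring.
    + intros i _. f_equal. unfold zoff. f_equal. lia.
Qed.

(** The index square is symmetric under n to -n, which conjugates the terms. *)
Lemma Im_eisen_partial_0 (k : nat) (Om T : R) (N : nat) : (1 <= k)%nat -> 0 < Om -> 0 < T ->
  Im (eisen_partial k (RtoC Om) (0, T) N) = 0.
Proof.
  intros Hk HOm HT. rewrite Im_eisen_partial by auto.
  rewrite <- (psum_zero (S (2 * N))). apply psum_ext. intros i _.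
  rewrite (psum_symmetric (fun t => Im (inv_pow k (2 * Om * zoff i N) (2 * T * t)))).
  rewrite Rmult_0_r, Im_inv_pow_real, Rplus_0_l, <- (psum_zero N).
  apply psum_ext. intros n _. rewrite Ropp_mult_distr_r_reverse, (proj2 (inv_pow_conj _ _ _)). ring.
Qed.

Lemma Re_eisen_partial_rows (k : nat) (L s : R) (N : nat) : (1 <= k)%nat -> Nat.Even k ->
  0 < L -> 0 < s ->
  Re (eisen_partial k (RtoC (s * L / 2)) (0, s * PI / 2) N) =
  (/ s) ^ k * (psum (fun n => 2 * Re (inv_pow k 0 (PI * (INR n + 1)))) N
    + psum (fun m => 2 * (/ ((INR m + 1) * L) ^ k
        + psum (fun n => 2 * Re (inv_pow k ((INR m + 1) * L) (PI * (INR n + 1)))) N)) N).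
Proof.
  intros Hk Hev HL Hs. pose proof PI_RGT_0 as HPI.
  rewrite Re_eisen_partial by (auto; nra).
  set (G := fun x => Re (inv_pow k x 0) + psum (fun n => 2 * Re (inv_pow k x (PI * (INR n + 1)))) N).
  assert (HG : forall i, psum (fun j => Re (inv_pow k (2 * (s * L / 2) * zoff i N)
     (2 * (s * PI / 2) * zoff j N))) (S (2 * N)) = (/ s) ^ k * G (L * zoff i N)).
  { intros i.
    rewrite (psum_ext _ (fun j => (/ s) ^ k * Re (inv_pow k (L * zoff i N) (PI * zoff j N)))).
    - rewrite psum_scal, (psum_symmetric (fun t => Re (inv_pow k (L * zoff i N) (PI * t)))).
      unfold G. rewrite Rmult_0_r. do 2 f_equal. apply psum_ext. intros n _.
      rewrite Ropp_mult_distr_r_reverse, (proj1 (inv_pow_conj _ _ _)). ring.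
    - intros j _. rewrite <- Re_scal, <- inv_pow_scale by lra. f_equal. f_equal; field. }
  rewrite (psum_ext _ (fun i => (/ s) ^ k * G (L * zoff i N))) by (intros; apply HG).
  rewrite psum_scal, (psum_symmetric (fun t => G (L * t))). f_equal. f_equal.
  - unfold G. rewrite Rmult_0_r, inv_pow_zero by auto. simpl. ring.
  - apply psum_ext. intros m _. pose proof (pos_INR m).
    assert (HGe : forall x, G (- x) = G x).
    { intros x. unfold G. rewrite inv_pow_even by auto. f_equal. apply psum_ext.
      intros n _. now rewrite inv_pow_even. }
    rewrite Ropp_mult_distr_r_reverse, HGe. unfold G.
    rewrite (Rmult_comm L), Re_inv_pow_real by nra. ring.
Qed.

(** Uses |z|^4 >= x^2 y^2 and |z| >= 1. The bound splits into a factor in x and one in y, so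
    truncated rows have a summable majorant independent of the truncation. *)
Lemma abs_Re_inv_pow_le4 (k : nat) (x y : R) : (4 <= k)%nat -> 0 < x -> 1 <= y ->
  Rabs (Re (inv_pow k x y)) <= / x ^ 2 * / y ^ 2.
Proof.
  intros Hk Hx Hy. eapply Rle_trans; [apply abs_Re_inv_pow; lra|].
  set (r := sqrt (x ^ 2 + y ^ 2)).
  assert (Hr2 : r ^ 2 = x ^ 2 + y ^ 2) by (unfold r; rewrite pow2_sqrt; nra).
  assert (Hr0 : 0 <= r) by apply sqrt_pos.
  assert (Hr : 1 <= r) by nra.
  assert (Hi : 0 < / r <= 1).
  { split; [apply Rinv_0_lt_compat; lra|rewrite <- Rinv_1; apply Rinv_le_contravar; lra]. }
  replace k with (4 + (k - 4))%nat by lia. rewrite pow_add, <- Rinv_mult.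
  rewrite <- (Rmult_1_r (/ (x ^ 2 * y ^ 2))).
  apply Rmult_le_compat; try (apply pow_le; lra).
  - rewrite pow_inv. apply Rinv_le_contravar; [apply Rmult_lt_0_compat; apply pow_lt; lra|].
    replace (r ^ 4) with ((r ^ 2) ^ 2) by ring. rewrite Hr2.
    pose proof (pow2_ge_0 x). pose proof (pow2_ge_0 y). nra.
  - rewrite <- (pow1 (k - 4)). apply pow_incr. lra.
Qed.

(** Square partial sums become iterated sums by [tannery], with the row m truncated at N as the m-th
    term; for even k the rows m and -m merge. *)
Lemma is_lim_eisen_partial (k : nat) (L s : R) : (4 <= k)%nat -> Nat.Even k -> 0 < L -> 0 < s ->
  is_lim_seq (fun N => Re (eisen_partial k (RtoC (s * L / 2)) (0, s * PI / 2) N))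
    ((/ s) ^ k * (row k 0
      + Series (fun m => 2 * (/ ((INR m + 1) * L) ^ k + row k ((INR m + 1) * L))))).
Proof.
  intros Hk Hev HL Hs.
  eapply is_lim_seq_ext.
  { intros N. symmetry. apply Re_eisen_partial_rows; auto. lia. }
  apply (is_lim_seq_scal_l _ _ (Finite _)). apply is_lim_seq_plus'.
  - apply psum_lim, Series_correct, ex_row. lia.
  - set (Z := Series (fun n => / (INR n + 1) ^ 2)).
    apply tannery with (K := fun N => N)
      (M := fun m => 2 * ((/ L) ^ k + 2 * (/ L) ^ 2 * Z) * / (INR m + 1) ^ 2).
    + auto.
    + intros N m _. pose proof (pos_INR m) as Hm.
      set (x := (INR m + 1) * L). assert (Hx : 0 < x) by (unfold x; nra).
      rewrite Rabs_mult, (Rabs_pos_eq 2), !Rmult_assoc by lra.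
      apply Rmult_le_compat_l; [lra|].
      eapply Rle_trans; [apply Rabs_triang|]. rewrite Rmult_plus_distr_r. apply Rplus_le_compat.
      * assert (Hxk : 0 < / x ^ k) by (apply Rinv_0_lt_compat, pow_lt, Hx).
        rewrite Rabs_pos_eq by lra. unfold x. rewrite Rpow_mult_distr, Rinv_mult, Rmult_comm, pow_inv.
        apply Rmult_le_compat_l; [apply Rlt_le, Rinv_0_lt_compat, pow_lt, HL|].
        apply Rinv_le_contravar; [apply pow_lt; lra|apply Rle_pow; [lra|lia]].
      * eapply Rle_trans; [apply psum_abs|].
        apply Rle_trans with (psum (fun n => 2 * / x ^ 2 * / (INR n + 1) ^ 2) N).
        -- apply psum_le. intros n _. rewrite Rabs_mult, (Rabs_pos_eq 2), Rmult_assoc by lra.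
           apply Rmult_le_compat_l; [lra|]. pose proof (pos_INR n). pose proof (PI_mul_ge n).
           eapply Rle_trans; [apply abs_Re_inv_pow_le4; auto; lra|].
           apply Rmult_le_compat_l; [apply Rlt_le, Rinv_0_lt_compat, pow_lt, Hx|].
           apply inv_PI_mul_sq_le.
        -- rewrite psum_scal.
           replace (2 * ((/ L) ^ 2 * Z) * / (INR m + 1) ^ 2) with (2 * / x ^ 2 * Z)
             by (unfold x; field; lra).
           apply Rmult_le_compat_l.
           ++ assert (0 < / x ^ 2) by (apply Rinv_0_lt_compat, pow_lt, Hx). lra.
           ++ apply psum_le_Series; [|apply ex_series_inv_square].
              intros n. apply Rlt_le, Rinv_0_lt_compat, pow_lt. pose proof (pos_INR n). lra.
    + intros m. apply (is_lim_seq_scal_l _ 2 (Finite _)).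
      apply is_lim_seq_plus'; [apply is_lim_seq_const|].
      apply psum_lim, Series_correct, ex_row. lia.
    + apply ex_series_inv_square_scal.
Qed.

Lemma eisen_sum_4 (L s : R) : 0 < L -> 0 < s ->
  eisen_sum_is 4 (RtoC (s * L / 2)) (0, s * PI / 2) (RtoC ((/ s) ^ 4 * eis4 L)).
Proof.
  intros HL Hs. pose proof PI_RGT_0. split.
  - simpl Re. replace (eis4 L) with (row 4 0
      + Series (fun m => 2 * (/ ((INR m + 1) * L) ^ 4 + row 4 ((INR m + 1) * L)))).
    + apply is_lim_eisen_partial; auto. now exists 2%nat.
    + unfold eis4. rewrite Series_scal_l, !half_sum_L. do 2 f_equal.
      unfold Rdiv. rewrite <- Series_scal_r, <- Series_minus.
      * apply Series_ext. intros n. pose proof (pos_INR n). rewrite <- psi_row4; [reflexivity|nra].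
      * now apply ex_half_sum_L.
      * apply ex_series_ext with (fun n => / 3 * psi 0 ((INR n + 1) * L)); [intros; apply Rmult_comm|].
        now apply ex_series_scal_R, ex_half_sum_L.
  - apply is_lim_seq_ext with (fun _ => 0); [|apply is_lim_seq_const].
    intros N. symmetry. apply Im_eisen_partial_0; [lia|nra|nra].
Qed.

Lemma eisen_sum_6 (L s : R) : 0 < L -> 0 < s ->
  eisen_sum_is 6 (RtoC (s * L / 2)) (0, s * PI / 2) (RtoC ((/ s) ^ 6 * eis6 L)).
Proof.
  intros HL Hs. pose proof PI_RGT_0. split.
  - simpl Re. replace (eis6 L) with (row 6 0
      + Series (fun m => 2 * (/ ((INR m + 1) * L) ^ 6 + row 6 ((INR m + 1) * L)))).
    + apply is_lim_eisen_partial; auto. now exists 3%nat.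
    + unfold eis6. rewrite Series_scal_l, !half_sum_L. do 2 f_equal.
      rewrite <- Series_scal_l, <- Series_minus, <- Series_plus;
        try (now apply ex_half_sum_L); try (now apply ex_series_scal_R, ex_half_sum_L).
      * apply Series_ext. intros n. pose proof (pos_INR n). rewrite <- psi_row6; [reflexivity|nra].
      * apply (ex_series_minus (V := R_NormedModule) (fun n => psi 4 ((INR n + 1) * L)));
          now apply ex_half_sum_L.
  - apply is_lim_seq_ext with (fun _ => 0); [|apply is_lim_seq_const].
    intros N. symmetry. apply Im_eisen_partial_0; [lia|nra|nra].
Qed.

(** y + i x is i times the conjugate of x + i y, and i^-4 = 1 while i^-6 = -1. *)
Lemma inv_pow_swap (x y : R) :
  Re (inv_pow 4 y x) = Re (inv_pow 4 x y) /\ Re (inv_pow 6 y x) = - Re (inv_pow 6 x y).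
Proof.
  unfold inv_pow.
  assert (E1 : Cinv (x, y) = (x / (x ^ 2 + y ^ 2), - (y / (x ^ 2 + y ^ 2)))).
  { unfold Cinv; simpl. f_equal. unfold Rdiv. ring. }
  assert (E2 : Cinv (y, x) = (y / (x ^ 2 + y ^ 2), - (x / (x ^ 2 + y ^ 2)))).
  { unfold Cinv; simpl. rewrite (Rplus_comm (y * _)). f_equal. unfold Rdiv. ring. }
  rewrite E1, E2. set (a := x / (x ^ 2 + y ^ 2)). set (b := y / (x ^ 2 + y ^ 2)).
  split; simpl; ring.
Qed.

Lemma eisen_sum_4_swap (Om T s : R) : 0 < Om -> 0 < T ->
  eisen_sum_is 4 (RtoC Om) (0, T) (RtoC s) -> eisen_sum_is 4 (RtoC T) (0, Om) (RtoC s).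
Proof.
  intros HOm HT [H _]. split.
  - apply is_lim_seq_ext with (2 := H). intros N.
    rewrite !Re_eisen_partial, psum_exchange by (auto; lia).
    apply psum_ext; intros i _; apply psum_ext; intros j _. symmetry. apply inv_pow_swap.
  - apply is_lim_seq_ext with (fun _ => 0); [|apply is_lim_seq_const].
    intros N. symmetry. apply Im_eisen_partial_0; auto; lia.
Qed.

Lemma eisen_sum_6_swap (Om T s : R) : 0 < Om -> 0 < T ->
  eisen_sum_is 6 (RtoC Om) (0, T) (RtoC s) -> eisen_sum_is 6 (RtoC T) (0, Om) (RtoC (- s)).
Proof.
  intros HOm HT [H _]. split.
  - apply is_lim_seq_opp in H. apply is_lim_seq_ext with (2 := H). intros N.
    rewrite !Re_eisen_partial, psum_exchange by (auto; lia).
    replace (- psum _ _) with (-1 * psum (fun j => psum (fun i => Re (inv_pow 6 (2 * Om * zoff i N)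
      (2 * T * zoff j N))) (S (2 * N))) (S (2 * N))) by ring.
    rewrite <- psum_scal. apply psum_ext; intros i _. rewrite <- psum_scal.
    apply psum_ext; intros j _. rewrite (proj2 (inv_pow_swap _ _)). ring.
  - apply is_lim_seq_ext with (fun _ => 0); [|apply is_lim_seq_const].
    intros N. symmetry. apply Im_eisen_partial_0; auto; lia.
Qed.

Lemma eisen_sum_unique (k : nat) (w1 w3 s s' : C) :
  eisen_sum_is k w1 w3 s -> eisen_sum_is k w1 w3 s' -> s = s'.
Proof.
  intros [Hr Hi] [Hr' Hi'].
  apply is_lim_seq_unique in Hr, Hi, Hr', Hi'.
  rewrite Hr in Hr'. rewrite Hi in Hi'. injection Hr'. injection Hi'.
  destruct s, s'; simpl. now intros -> ->.
Qed.

(** Exchanging the periods preserves the square lattice, so its sum of sixth order equals its own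
    negative. *)
Lemma g3_square : g3 PI = 0.
Proof.
  pose proof PI_RGT_0 as HPI. rewrite g3_eis6 by auto.
  pose proof (eisen_sum_6 PI 1 HPI ltac:(lra)) as H.
  pose proof (eisen_sum_6_swap (1 * PI / 2) (1 * PI / 2) _ ltac:(lra) ltac:(lra) H) as H'.
  pose proof (eisen_sum_unique _ _ _ _ _ H H') as E.
  apply (f_equal Re) in E. change ((/ 1) ^ 6 * eis6 PI = - ((/ 1) ^ 6 * eis6 PI)) in E.
  rewrite Rinv_1, pow1 in E. lra.
Qed.

(** * The algebraic hypergeometric function 2F1(1/3, 2/3; 1/2; y^2) *)

Definition hcoef (n : nat) : R :=
  pochhammer (1/3) n * pochhammer (2/3) n / (pochhammer (1/2) n * INR (fact n)).

Lemma pochhammer_pos (a : R) (n : nat) : 0 < a -> 0 < pochhammer a n.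
Proof.
  intros Ha. induction n; simpl; [lra|]. pose proof (pos_INR n).
  apply Rmult_lt_0_compat; lra.
Qed.

Lemma hcoef_rec (n : nat) :
  (INR n + 1) * (4 * INR n + 2) * hcoef (S n) = (4 * INR n ^ 2 + 4 * INR n + 8 / 9) * hcoef n.
Proof.
  unfold hcoef. pose proof (pochhammer_pos (1/2) n ltac:(lra)) as Hp.
  pose proof (INR_fact_neq_0 n) as Hf. pose proof (pos_INR n) as Hn.
  rewrite fact_simpl, mult_INR, S_INR. simpl pochhammer. field. repeat split; lra.
Qed.

Lemma hcoef_bounds (n : nat) : 0 < hcoef n <= 1.
Proof.
  induction n as [|n [IH1 IH2]].
  - unfold hcoef. simpl. lra.
  - pose proof (hcoef_rec n) as H. pose proof (pos_INR n) as Hn. split.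
    + apply Rmult_lt_reg_l with ((INR n + 1) * (4 * INR n + 2)); [nra|].
      rewrite H, Rmult_0_r. apply Rmult_lt_0_compat; nra.
    + apply Rmult_le_reg_l with ((INR n + 1) * (4 * INR n + 2)); [nra|].
      rewrite H. apply Rle_trans with ((4 * INR n ^ 2 + 4 * INR n + 8 / 9) * 1); [|nra].
      apply Rmult_le_compat_l; nra.
Qed.

Lemma hcoef_radius (s : R) : Rabs s < 1 -> Rbar_lt (Rabs s) (CV_radius hcoef).
Proof.
  intros Hs. apply Rbar_lt_le_trans with 1; [exact Hs|].
  apply (proj1 (CV_radius_bounded hcoef)). exists 1. intros n.
  rewrite pow1, Rmult_1_r. pose proof (hcoef_bounds n). rewrite Rabs_pos_eq; lra.
Qed.

(** Four times the hypergeometric equation with parameters 1/3, 2/3, 1/2, checked on coefficients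
    through [hcoef_rec]. *)
Lemma hcoef_ode (s : R) : Rabs s < 1 ->
  4 * s * (1 - s) * PSeries (PS_derive (PS_derive hcoef)) s
  + (2 - 8 * s) * PSeries (PS_derive hcoef) s - 8 / 9 * PSeries hcoef s = 0.
Proof.
  intros Hs. set (D1 := PS_derive hcoef). set (D2 := PS_derive D1).
  assert (X0 : ex_pseries hcoef s) by now apply CV_radius_inside, hcoef_radius.
  assert (X1 : ex_pseries D1 s)
    by (apply CV_radius_inside; unfold D1; rewrite CV_radius_derive; now apply hcoef_radius).
  assert (X2 : ex_pseries D2 s)
    by (apply CV_radius_inside; unfold D2, D1; rewrite !CV_radius_derive; now apply hcoef_radius).
  pose proof (ex_pseries_incr_1 D1 s X1) as X1'.
  pose proof (ex_pseries_incr_1 D2 s X2) as X2'.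
  pose proof (ex_pseries_incr_1 _ s X2') as X2''.
  assert (E : PSeries (PS_plus (PS_plus (PS_scal 4 (PS_incr_1 D2))
       (PS_scal (-4) (PS_incr_1 (PS_incr_1 D2))))
     (PS_plus (PS_plus (PS_scal 2 D1) (PS_scal (-8) (PS_incr_1 D1))) (PS_scal (- (8 / 9)) hcoef))) s
     = 0).
  { rewrite <- (PSeries_const_0 s). apply PSeries_ext. intros n.
    unfold PS_plus, PS_scal, PS_incr_1, plus, scal; simpl. unfold mult; simpl.
    unfold D2, D1, PS_derive.
    match goal with |- ?a = ?b => change (@eq R a b) end.
    destruct n as [|[|n]].
    - pose proof (hcoef_rec 0) as H. simpl in *. unfold zero; simpl. lra.
    - pose proof (hcoef_rec 1) as H. simpl in *. unfold zero; simpl. lra.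
    - pose proof (hcoef_rec (S (S n))) as H. rewrite !S_INR in *.
      set (p := INR n) in *. set (h3 := hcoef (S (S (S n)))) in *. set (h2 := hcoef (S (S n))) in *.
      unfold zero; simpl. nra. }
  assert (XS : forall (c : R) (a : nat -> R), ex_pseries a s -> ex_pseries (PS_scal c a) s)
    by (intros c a Ha; exact (ex_pseries_scal c a s (Rmult_comm s c) Ha)).
  pose proof (XS 4 _ X2') as Y1. pose proof (XS (-4) _ X2'') as Y2. pose proof (XS 2 _ X1) as Y3.
  pose proof (XS (-8) _ X1') as Y4. pose proof (XS (- (8 / 9)) _ X0) as Y5.
  pose proof (ex_pseries_plus _ _ _ Y1 Y2) as Y12. pose proof (ex_pseries_plus _ _ _ Y3 Y4) as Y34.
  pose proof (ex_pseries_plus _ _ _ Y34 Y5) as Y345.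
  rewrite (PSeries_plus _ _ _ Y12 Y345), (PSeries_plus _ _ _ Y1 Y2), (PSeries_plus _ _ _ Y34 Y5),
    (PSeries_plus _ _ _ Y3 Y4), !PSeries_scal, !PSeries_incr_1 in E.
  rewrite <- E. ring.
Qed.

Lemma sin_sq_lt_1 (th : R) : - (PI / 2) < th < PI / 2 -> Rabs (sin th ^ 2) < 1.
Proof.
  intros Hth. pose proof (cos_gt_0 th ltac:(lra) ltac:(lra)) as Hc.
  pose proof (sin2_cos2 th) as E. unfold Rsqr in E.
  rewrite Rabs_pos_eq by apply pow2_ge_0. nra.
Qed.

Lemma is_derive_PSeries_sin_sq (a : nat -> R) (th : R) :
  Rbar_lt (Rabs (sin th ^ 2)) (CV_radius a) ->
  is_derive (fun th => PSeries a (sin th ^ 2)) th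
    (2 * sin th * cos th * PSeries (PS_derive a) (sin th ^ 2)).
Proof.
  intros H. apply (is_derive_comp (PSeries a) (fun th => sin th ^ 2)).
  - now apply is_derive_PSeries.
  - auto_derive; [auto|ring].
Qed.

Ltac derivable_hyps :=
  repeat match goal with
  | |- _ /\ _ => split
  | |- True => exact I
  | |- ex_derive _ _ => eexists; eassumption
  end.

Ltac rewrite_derive H :=
  match type of H with is_derive ?f ?x ?l =>
    replace (Derive (fun y : R => f y) x) with l by (symmetry; exact (is_derive_unique _ _ _ H))
  end.

(** The difference E of the two sides satisfies E'' = - E / 9 with zero data at 0. The quantity E'^2
    + E^2 / 9 is constant, hence zero. *)
Lemma hyp_sin_mul_cos (th : R) : - (PI / 2) < th < PI / 2 ->
  PSeries hcoef (sin th ^ 2) * cos th = cos (th / 3).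
Proof.
  intros Hth. pose proof PI_RGT_0 as HPI.
  set (A0 := fun t => PSeries hcoef (sin t ^ 2)).
  set (A1 := fun t => PSeries (PS_derive hcoef) (sin t ^ 2)).
  set (A2 := fun t => PSeries (PS_derive (PS_derive hcoef)) (sin t ^ 2)).
  set (E := fun t => A0 t * cos t - cos (t / 3)).
  set (E1 := fun t => 2 * (sin t * (cos t ^ 2 * A1 t)) - sin t * A0 t + sin (t / 3) / 3).
  assert (D0 : forall t, - (PI / 2) < t < PI / 2 -> is_derive A0 t (2 * sin t * cos t * A1 t)).
  { intros t Ht. now apply is_derive_PSeries_sin_sq, hcoef_radius, sin_sq_lt_1. }
  assert (D1 : forall t, - (PI / 2) < t < PI / 2 -> is_derive A1 t (2 * sin t * cos t * A2 t)).
  { intros t Ht. apply is_derive_PSeries_sin_sq. rewrite CV_radius_derive.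
    now apply hcoef_radius, sin_sq_lt_1. }
  assert (DE : forall t, - (PI / 2) < t < PI / 2 -> is_derive E t (E1 t)).
  { intros t Ht. pose proof (D0 t Ht) as H0. unfold E.
    auto_derive; [derivable_hyps|].
    rewrite_derive H0. unfold E1, Rdiv. field. }
  assert (DE1 : forall t, - (PI / 2) < t < PI / 2 -> is_derive E1 t (- E t / 9)).
  { intros t Ht. pose proof (D0 t Ht) as H0. pose proof (D1 t Ht) as H1. unfold E1.
    auto_derive.
    - derivable_hyps.
    - rewrite_derive H0. rewrite_derive H1.
      pose proof (hcoef_ode (sin t ^ 2) (sin_sq_lt_1 t Ht)) as O.
      fold (A0 t) (A1 t) (A2 t) in O. unfold E. change (t * / 3) with (t / 3).
      assert (S2 : sin t ^ 2 = 1 - cos t ^ 2).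
      { pose proof (sin2_cos2 t) as H. unfold Rsqr in H. simpl. lra. }
      transitivity (cos t * (4 * sin t ^ 2 * (1 - sin t ^ 2) * A2 t + (2 - 8 * sin t ^ 2) * A1 t
        - 8 / 9 * A0 t) - (A0 t * cos t - cos (t / 3)) / 9).
      + replace (sin t ^ 2) with (1 - cos t ^ 2) by lra.
        simpl. assert (S2' : sin t * sin t = 1 - cos t * cos t) by (simpl in S2; lra).
        field [S2'].
      + rewrite O. field. }
  assert (Z : forall t, - (PI / 2) < t < PI / 2 -> E1 t ^ 2 + E t ^ 2 / 9 = 0).
  { intros t Ht.
    transitivity ((fun t => E1 t ^ 2 + E t ^ 2 * / 9) 0).
    - apply (constant_of_derive (fun t => E1 t ^ 2 + E t ^ 2 * / 9) (- (PI / 2)) (PI / 2)); [|auto|lra].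
      intros z Hz. pose proof (DE z Hz) as H0. pose proof (DE1 z Hz) as H1.
      auto_derive.
      + derivable_hyps.
      + rewrite_derive H0. rewrite_derive H1.
        field.
    - unfold E1, E, A0. replace (0 / 3) with 0 by field. rewrite sin_0, cos_0.
      replace (0 ^ 2) with 0 by ring. rewrite PSeries_0.
      replace (hcoef 0) with 1 by (unfold hcoef; simpl; field). field. }
  pose proof (Z th Hth) as H. pose proof (pow2_ge_0 (E1 th)). pose proof (pow2_ge_0 (E th)).
  assert (HE : E th = 0) by nra. unfold E, A0 in HE. lra.
Qed.

(* [3 u - 4 u^3] is the sine of three times the arcsine of [u]. *)
Lemma hyp_algebraic (u : R) : 4 * u ^ 2 < 1 ->
  PSeries hcoef ((3 * u - 4 * u ^ 3) ^ 2) * (1 - 4 * u ^ 2) = 1.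
Proof.
  intros Hu. pose proof PI_RGT_0 as HPI.
  assert (Hu1 : -1 < u < 1) by (split; nra).
  set (al := asin u).
  assert (Hs : sin al = u) by (apply sin_asin; lra).
  pose proof (asin_bound_lt u Hu1) as Hb. fold al in Hb.
  (* The hypothesis 4 u^2 < 1 keeps the angle below PI / 6, so that its triple stays in the interval
     of [hyp_sin_mul_cos]. *)
  assert (Hb6 : - (PI / 6) < al < PI / 6).
  { split; apply Rnot_le_lt; intros H.
    - assert (sin al <= sin (- (PI / 6))) by (apply sin_incr_1; lra).
      rewrite sin_neg, sin_PI6 in *. nra.
    - assert (sin (PI / 6) <= sin al) by (apply sin_incr_1; lra).
      rewrite sin_PI6 in *. nra. }
  pose proof (hyp_sin_mul_cos (3 * al) ltac:(lra)) as H.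
  replace (3 * al / 3) with al in H by field.
  assert (Hc : 0 < cos al) by (apply cos_gt_0; lra).
  assert (E : cos al * cos al = 1 - u * u).
  { pose proof (sin2_cos2 al) as E. unfold Rsqr in E. rewrite Hs in E. lra. }
  assert (S3 : sin (3 * al) = 3 * u - 4 * u ^ 3).
  { replace (3 * al) with (2 * al + al) by ring. rewrite sin_plus, sin_2a, cos_2a, Hs.
    replace (2 * u * cos al * cos al) with (2 * u * (cos al * cos al)) by ring.
    rewrite E. ring. }
  assert (C3 : cos (3 * al) = (1 - 4 * u ^ 2) * cos al).
  { replace (3 * al) with (2 * al + al) by ring. rewrite cos_plus, sin_2a, cos_2a, Hs.
    rewrite E. ring. }
  rewrite S3, C3 in H. apply Rmult_eq_reg_r with (cos al); [|lra]. rewrite <- H at 2. ring.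
Qed.

(** * Integration of the hypergeometric series over three quarter turns *)

Lemma ex_derive_hyp_sin (k t : R) : 0 <= k < 1 ->
  ex_derive (fun t => PSeries hcoef (k * sin t ^ 2)) t.
Proof.
  intros Hk.
  apply (ex_derive_comp (PSeries hcoef) (fun t => k * sin t ^ 2)).
  - eexists. apply is_derive_PSeries, hcoef_radius.
    pose proof (SIN_bound t). rewrite Rabs_pos_eq; [|pose proof (pow2_ge_0 (sin t)); nra].
    assert (0 <= sin t ^ 2 <= 1) by (split; [apply pow2_ge_0|nra]). nra.
  - auto_derive. auto.
Qed.

Lemma ex_RInt_hyp (k a b : R) : 0 <= k < 1 ->
  ex_RInt (fun t => PSeries hcoef (k * sin t ^ 2)) a b.
Proof.
  intros Hk. apply (ex_RInt_continuous (V := R_CompleteNormedModule)). intros z _.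
  apply (ex_derive_continuous (K := R_AbsRing) (V := R_NormedModule)). now apply ex_derive_hyp_sin.
Qed.

(** The Wallis recurrence: the boundary term cos t sin^(2n+1) t vanishes at 0 and at 3 PI / 2. The
    factor (1/2)_n / n! is what turns the third parameter 1/2 into 1. *)
Lemma sin_pow_int (n : nat) :
  is_RInt (fun t => sin t ^ (2 * n)) 0 (3 * (PI / 2))
    (3 * (PI / 2) * (pochhammer (1/2) n / INR (fact n))).
Proof.
  induction n as [|n IH].
  - simpl. replace (3 * (PI / 2) * (1 / 1)) with (3 * (PI / 2) - 0) by field.
    apply (RInt_of_derive (fun t => t)); intros; auto_derive; auto.
  - pose proof (pos_INR n) as Hn. pose proof (INR_fact_neq_0 n) as Hf.
    set (c := - / (2 * INR n + 2)). set (e := (2 * INR n + 1) / (2 * INR n + 2)).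
    set (G := fun t => c * (cos t * sin t ^ S (2 * n))).
    set (I := 3 * (PI / 2) * (pochhammer (1/2) n / INR (fact n))) in *.
    assert (HG : is_RInt (fun t => sin t ^ (2 * S n) - e * sin t ^ (2 * n)) 0 (3 * (PI / 2)) 0).
    { replace 0 with (G (3 * (PI / 2)) - G 0) at 2.
      - apply RInt_of_derive.
        + intros t. unfold G. auto_derive; [auto|].
          replace (2 * S n)%nat with (S (S (2 * n))) by lia.
          replace (n + (n + 0))%nat with (2 * n)%nat by lia.
          assert (Hm : forall j : nat, match j with O => 1 | S _ => INR j + 1 end = INR j + 1)
            by (destruct j; simpl; lra).
          rewrite Hm, mult_INR. change (INR 2) with (1 + 1).
          simpl pow. set (p := sin t ^ (n + (n + 0))).
          assert (E : cos t * cos t = 1 - sin t * sin t).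
          { pose proof (sin2_cos2 t) as E. unfold Rsqr in E. lra. }
          transitivity (c * ((2 * INR n + 1) * (cos t * cos t) * p - sin t * sin t * p)); [ring|].
          rewrite E. unfold c, e. field. lra.
        + intros t. auto_derive. auto.
      - unfold G. rewrite sin_0.
        replace (cos (3 * (PI / 2))) with 0; [simpl; ring|].
        replace (3 * (PI / 2)) with (PI / 2 + PI) by field. rewrite neg_cos, cos_PI2. ring. }
    pose proof (is_RInt_plus (V := R_NormedModule) _ _ _ _ _ _ HG
      (is_RInt_scal (V := R_NormedModule) _ _ _ e _ IH)) as H.
    unfold plus, scal in H; simpl in H. unfold mult in H; simpl in H.
    replace (3 * (PI / 2) * (pochhammer (1 / 2) (S n) / INR (fact (S n)))) with (0 + e * I).
    + eapply is_RInt_ext; [|exact H]. intros t _. simpl. ring.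
    + unfold I, e. rewrite fact_simpl, mult_INR, S_INR. simpl pochhammer. field.
      repeat split; lra.
Qed.

Lemma Series_tail (b : nat -> R) (N : nat) : ex_series b ->
  Series b - psum b N = Series (fun n => b (N + n)%nat).
Proof.
  intros Hb. induction N as [|N IH].
  - simpl. rewrite Rminus_0_r. reflexivity.
  - rewrite psum_S.
    assert (Hx : ex_series (fun n => b (N + n)%nat)) by now apply (ex_series_incr_n b N).
    rewrite (Series_incr_1 _ Hx), Nat.add_0_r in IH.
    rewrite (Series_ext (fun n => b (S N + n)%nat) (fun n => b (N + S n)%nat)).
    + lra.
    + intros n. f_equal. lia.
Qed.

(** (1/2)_n cancels against the denominator of [hcoef n], and n! is (1)_n. Integration term by term
    is legitimate because [hcoef n] <= 1 bounds the tail of the integrand by k^N / (1 - k) uniformly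
    in t. *)
Lemma hyp_period (k : R) : 0 <= k < 1 ->
  RInt (fun t => PSeries hcoef (k * sin t ^ 2)) 0 (3 * (PI / 2))
  = 3 * (PI / 2) * hyp2F1 (1/3) (2/3) 1 k.
Proof.
  intros Hk. pose proof PI_RGT_0 as HPI. set (b := 3 * (PI / 2)).
  set (I := RInt (fun t => PSeries hcoef (k * sin t ^ 2)) 0 b).
  set (c := fun n => b * (pochhammer (1/3) n * pochhammer (2/3) n
                   / (pochhammer 1 n * INR (fact n)) * k ^ n)).
  assert (Hpart : forall N, is_RInt (fun t => psum (fun n => hcoef n * (k * sin t ^ 2) ^ n) N) 0 b (psum c N)).
  { induction N as [|N IH].
    - pose proof (is_RInt_const (V := R_NormedModule) 0 b 0) as H.
      replace (scal (b - 0) (0 : R_NormedModule)) with 0 in H; [exact H|].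
      unfold scal; simpl; unfold mult; simpl. symmetry. apply Rmult_0_r.
    - apply (is_RInt_plus (V := R_NormedModule)); [exact IH|].
      replace (c N) with (hcoef N * k ^ N * (b * (pochhammer (1/2) N / INR (fact N)))).
      + eapply is_RInt_ext; [|apply (is_RInt_scal (V := R_NormedModule) _ _ _ (hcoef N * k ^ N) _ (sin_pow_int N))].
        intros t _. change (hcoef N * k ^ N * sin t ^ (2 * N) = hcoef N * (k * sin t ^ 2) ^ N).
        rewrite Rpow_mult_distr, <- pow_mult. ring.
      + unfold c, hcoef. assert (E : pochhammer 1 N = INR (fact N)).
        { clear. induction N; [reflexivity|]. rewrite fact_simpl, mult_INR, S_INR. simpl.
          rewrite IHN. ring. }
        rewrite E. pose proof (INR_fact_neq_0 N).
        pose proof (pochhammer_pos (1/2) N ltac:(lra)). field. repeat split; lra. }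
  assert (Herr : forall N, Rabs (I - psum c N) <= b * (k ^ N * / (1 - k))).
  { intros N.
    assert (HD : is_RInt (fun t => PSeries hcoef (k * sin t ^ 2)
        - psum (fun n => hcoef n * (k * sin t ^ 2) ^ n) N) 0 b (I - psum c N)).
    { apply (is_RInt_minus (V := R_NormedModule)); [|apply Hpart].
      apply (RInt_correct (V := R_CompleteNormedModule)). now apply ex_RInt_hyp. }
    rewrite <- (is_RInt_unique _ _ _ _ HD).
    replace b with (b - 0) at 2 by ring. apply abs_RInt_le_const.
    - unfold b. lra.
    - eexists. exact HD.
    - intros t _.
      assert (Hs : 0 <= k * sin t ^ 2 <= k).
      { pose proof (SIN_bound t). assert (0 <= sin t ^ 2 <= 1) by (split; [apply pow2_ge_0|nra]). nra. }
      set (s := k * sin t ^ 2) in *.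
      assert (Hb : forall n, Rabs (hcoef n * s ^ n) <= k ^ n).
      { intros n. pose proof (hcoef_bounds n). pose proof (pow_le s n ltac:(lra)).
        rewrite Rabs_pos_eq by (apply Rmult_le_pos; lra).
        apply Rle_trans with (1 * s ^ n); [apply Rmult_le_compat_r; lra|].
        rewrite Rmult_1_l. apply pow_incr. lra. }
      assert (Hgeo : ex_series (fun n => k ^ n)) by (apply ex_series_geom; rewrite Rabs_pos_eq; lra).
      unfold PSeries. rewrite Series_tail by (apply ex_series_abs_le with (2 := Hgeo); exact Hb).
      rewrite <- Series_geom, <- Series_scal_l by (rewrite Rabs_pos_eq; lra).
      apply Series_abs_le; [|now apply ex_series_scal_R].
      intros n. rewrite <- pow_add. apply Hb. }
  assert (Hlim : is_lim_seq (psum c) I).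
  { apply is_lim_seq_ext with (fun N => I - (I - psum c N)); [intros; ring|].
    replace (Finite I) with (Finite (I - 0)) by (f_equal; ring).
    apply is_lim_seq_minus'; [apply is_lim_seq_const|].
    apply is_lim_seq_abs_0.
    apply is_lim_seq_le_le with (u := fun _ => 0) (w := fun N => b * / (1 - k) * k ^ N).
    - intros N. split; [apply Rabs_pos|]. eapply Rle_trans; [apply Herr|]. right. ring.
    - apply is_lim_seq_const.
    - replace (Finite 0) with (Rbar_mult (b * / (1 - k)) 0) by (simpl; f_equal; ring).
      apply is_lim_seq_scal_l, is_lim_seq_geom. rewrite Rabs_pos_eq; lra. }
  apply psum_lim, is_series_unique in Hlim. rewrite <- Hlim. unfold c, hyp2F1.
  now rewrite Series_scal_l.
Qed.

(** * The real period of the cubic *)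

Lemma is_derive_div_sqrt3 (p n : R -> R) (x dp dn : R) :
  is_derive p x dp -> is_derive n x dn -> 0 < n x ->
  is_derive (fun x => p x / sqrt (n x) ^ 3) x ((dp * n x - 3 / 2 * p x * dn) / sqrt (n x) ^ 5).
Proof.
  intros Hp Hn Hpos. pose proof (sqrt_lt_R0 _ Hpos) as Hs.
  assert (H3 : sqrt (n x) ^ 3 <> 0) by (apply pow_nonzero; lra).
  auto_derive.
  - derivable_hyps; auto.
  - rewrite_derive Hp. rewrite_derive Hn.
    transitivity ((dp * (sqrt (n x) * sqrt (n x)) - 3 / 2 * p x * dn) / sqrt (n x) ^ 5).
    + set (s := sqrt (n x)) in *. field. lra.
    + rewrite sqrt_sqrt by lra. reflexivity.
Qed.

Lemma sin_PI_minus_2atan (z : R) : sin (PI - 2 * atan z) = 2 * z / (1 + z ^ 2).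
Proof.
  rewrite sin_PI_x, sin_2a, sin_atan, cos_atan.
  assert (H : 0 < 1 + Rsqr z) by (unfold Rsqr; nra).
  pose proof (sqrt_lt_R0 _ H) as Hs. pose proof (sqrt_sqrt _ (Rlt_le _ _ H)) as E.
  replace (1 + z ^ 2) with (1 + Rsqr z) by (unfold Rsqr; ring). rewrite <- E at 3.
  field. lra.
Qed.

Lemma atan_le_id (y : R) : 0 <= y -> atan y <= y.
Proof.
  intros Hy. enough (0 <= y - atan y) by lra. revert y Hy.
  apply nonneg_of_derive with (fun y => 1 - / (1 + y ^ 2)).
  - rewrite atan_0. ring.
  - intros x. auto_derive; [auto|]. unfold Rsqr. field. nra.
  - intros x Hx. assert (/ (1 + x ^ 2) <= / 1) by (apply Rinv_le_contravar; nra). lra.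
Qed.

(* The lattice with real period [2 Om] has a rational 3-isogeny, with kernel at [W = 0], onto the curve
   parametrised by [t |-> 3 u - 4 u^3 = kappa sin t], where [u = sqrt 6 kappa W / sqrt N];
   along it [t] runs from [0] to [3 PI / 2]. *)
Section Period.

Variables (kappa Om : R) (W Y : R -> R).
Hypothesis kappa_pos : 0 < kappa.
Hypothesis kappa_lt_1 : kappa < 1.
Hypothesis Om_pos : 0 < Om.

Let k := kappa ^ 2.
Let m := 1 - k.

Hypothesis dW : forall x, 0 < x <= Om -> is_derive W x (2 * Y x).
Hypothesis dY : forall x, 0 < x <= Om -> is_derive Y x (3 * W x ^ 2 + 12 * (3 * W x + 8 * m)).
Hypothesis cubic : forall x, 0 < x <= Om -> Y x ^ 2 = W x ^ 3 + 2 * (3 * W x + 8 * m) ^ 2.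
Hypothesis Y_neg : forall x, 0 < x < Om -> Y x < 0.
Hypothesis Y_Om : Y Om = 0.
Hypothesis W_pole : forall B, exists d, 0 < d /\ forall x, 0 < x < d -> B < W x.

Let k_bounds : 0 < k < 1.
Proof. unfold k. split; nra. Qed.

Let m_bounds : 0 < m < 1.
Proof. unfold m. pose proof k_bounds. lra. Qed.

(** The isogeny with kernel W = 0 sends W to N / W^2, whose derivative in W is Q / W^3. In these
    terms u^2 = 6 k W^2 / N, hence 1 - 4 u^2 = M / N and 3 - 4 u^2 = 3 (N - 8 k W^2) / N. Thus [sn]
    is (3 u - 4 u^3) / kappa, [cn] is the matching cosine, and [tau] is to be the derivative of
    [t]. *)
Let N (x : R) := W x ^ 3 + 8 / 3 * (9 * W x ^ 2 + 72 * m * W x + 192 * m ^ 2).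
Let dNW (x : R) := 3 * W x ^ 2 + 48 * W x + 192 * m.
Let M (x : R) := N x - 24 * k * W x ^ 2.
Let Q (x : R) := W x ^ 3 - 192 * m * W x - 1024 * m ^ 2.
Let sn (x : R) := 3 * sqrt 6 * (W x * (N x - 8 * k * W x ^ 2)) / sqrt (N x) ^ 3.
Let cn (x : R) := - (Y x * Q x) / sqrt (N x) ^ 3.
Let tau (x : R) := 3 * sqrt 6 * (M x / N x).
(** The half-angle formula cot (t / 2) = sn / (1 - cn) gives the angle in (0, 2 PI) as a single
    differentiable branch, long enough to reach 3 PI / 2, provided that cn < 1. *)
Let t (x : R) := PI - 2 * atan (sn x / (1 - cn x)).

Let sq6 : sqrt 6 * sqrt 6 = 6.
Proof. apply sqrt_sqrt. lra. Qed.

Let sq6_pos : 0 < sqrt 6.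
Proof. apply sqrt_lt_R0. lra. Qed.

(** At a zero of 3 W + 8 m the cubic would give Y^2 = W^3 < 0. The expression is positive near the
    pole, so it never changes sign. *)
Lemma line_pos (x : R) : 0 < x <= Om -> 0 < 3 * W x + 8 * m.
Proof.
  intros Hx. pose proof m_bounds as Hm. apply Rnot_le_lt. intros Hneg.
  assert (Hne : forall z, 0 < z <= Om -> 3 * W z + 8 * m <> 0).
  { intros z Hz E. pose proof (cubic z Hz) as H. rewrite E in H.
    replace (W z) with (- (8 * m / 3)) in H by lra.
    pose proof (pow2_ge_0 (Y z)). assert (0 < (8 * m / 3) ^ 3) by (apply pow_lt; lra). nra. }
  destruct (W_pole 0) as [d [Hd HW]].
  set (y := Rmin (d / 2) (x / 2)).
  assert (Hy : 0 < y) by (apply Rmin_pos; lra).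
  assert (Hyd : y <= d / 2) by apply Rmin_l. assert (Hyx : y <= x / 2) by apply Rmin_r.
  specialize (HW y ltac:(lra)).
  destruct (Ranalysis5.IVT_interv (fun z => - (3 * W z + 8 * m)) y x) as [z [Hz Ez]].
  - intros a Ha. apply derivable_continuous_pt. exists (- (3 * (2 * Y a))).
    apply is_derive_Reals. pose proof (dW a ltac:(lra)) as HdW.
    auto_derive; [derivable_hyps|]. rewrite_derive HdW. ring.
  - lra.
  - lra.
  - specialize (Hne x Hx). lra.
  - apply (Hne z); lra.
Qed.

Lemma N_pos (x : R) : 0 < x <= Om -> 0 < N x.
Proof.
  intros Hx. pose proof (line_pos x Hx). pose proof (cubic x Hx) as HY. pose proof m_bounds.
  replace (N x) with (Y x ^ 2 + 6 * (W x + 8 * m) ^ 2) by (rewrite HY; unfold N; field).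
  pose proof (pow2_ge_0 (Y x)). assert (0 < (W x + 8 * m) ^ 2) by (apply pow_lt; lra). lra.
Qed.

(** M / N is 1 - 4 u^2, so this supplies the condition 4 u^2 < 1 of [hyp_algebraic]. The proof
    writes M through the positive quantity 3 W + 8 m. *)
Lemma M_pos (x : R) : 0 < x <= Om -> 0 < M x.
Proof.
  intros Hx. pose proof (line_pos x Hx) as H. pose proof m_bounds as Hm.
  replace (M x) with (64 * m * (3 * W x + 8 * m) + W x ^ 2 * (W x + 24 * m))
    by (unfold M, N; replace k with (1 - m) by (unfold m; ring); field).
  apply Rplus_lt_le_0_compat; [nra|]. apply Rmult_le_pos; [apply pow2_ge_0|lra].
Qed.

Lemma is_derive_N (x : R) : 0 < x <= Om -> is_derive N x (2 * Y x * dNW x).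
Proof.
  intros Hx. pose proof (dW x Hx) as H. unfold N.
  auto_derive; [derivable_hyps|]. rewrite_derive H. unfold dNW. field.
Qed.

Lemma is_derive_sn (x : R) : 0 < x <= Om -> is_derive sn x (cn x * tau x).
Proof.
  intros Hx. pose proof (N_pos x Hx) as HN. pose proof (dW x Hx) as HW.
  pose proof (is_derive_N x Hx) as HdN. pose proof (sqrt_lt_R0 _ HN) as Hs.
  pose proof (sqrt_sqrt _ (Rlt_le _ _ HN)) as ES.
  unfold sn. evar_last.
  - apply (is_derive_div_sqrt3 (fun x => 3 * sqrt 6 * (W x * (N x - 8 * k * W x ^ 2))) N x
      (3 * sqrt 6 * (2 * Y x * (N x - 8 * k * W x ^ 2)
                     + W x * (2 * Y x * dNW x - 16 * k * W x * (2 * Y x)))) (2 * Y x * dNW x)); auto.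
    auto_derive; [derivable_hyps|]. rewrite_derive HW. rewrite_derive HdN. ring.
  - unfold cn, tau.
    replace (M x / N x) with (M x / sqrt (N x) ^ 2) by (do 2 f_equal; simpl; lra).
    transitivity (3 * sqrt 6 * (- (Y x * Q x) * M x) / sqrt (N x) ^ 5); [|field; lra].
    f_equal. unfold Q, M, dNW, N. replace k with (1 - m) by (unfold m; ring). field.
Qed.

(** Once the roots are cleared and Y^2 is replaced through the cubic, a polynomial identity in W and
    m remains; the same holds for [sn_cn_sq]. *)
Lemma is_derive_cn (x : R) : 0 < x <= Om -> is_derive cn x (- sn x * tau x).
Proof.
  intros Hx. pose proof (N_pos x Hx) as HN. pose proof (dW x Hx) as HW. pose proof (dY x Hx) as HY.
  pose proof (is_derive_N x Hx) as HdN. pose proof (sqrt_lt_R0 _ HN) as Hs.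
  pose proof (sqrt_sqrt _ (Rlt_le _ _ HN)) as ES. pose proof (cubic x Hx) as EY.
  unfold cn. evar_last.
  - apply (is_derive_div_sqrt3 (fun x => - (Y x * Q x)) N x
      (- ((3 * W x ^ 2 + 12 * (3 * W x + 8 * m)) * Q x
          + 2 * Y x ^ 2 * (3 * W x ^ 2 - 192 * m))) (2 * Y x * dNW x)); auto.
    unfold Q. auto_derive; [derivable_hyps|]. rewrite_derive HW. rewrite_derive HY. ring.
  - unfold sn, tau.
    replace (M x / N x) with (M x / sqrt (N x) ^ 2) by (do 2 f_equal; simpl; lra).
    transitivity (- (9 * (sqrt 6 * sqrt 6) * (W x * (N x - 8 * k * W x ^ 2) * M x))
                    / sqrt (N x) ^ 5); [|field; lra].
    rewrite sq6. f_equal.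
    replace (3 / 2 * - (Y x * Q x) * (2 * Y x * dNW x)) with (- 3 * Y x ^ 2 * Q x * dNW x) by field.
    rewrite EY. unfold Q, M, dNW, N. replace k with (1 - m) by (unfold m; ring). field.
Qed.

Lemma sn_cn_sq (x : R) : 0 < x <= Om -> sn x ^ 2 + cn x ^ 2 = 1.
Proof.
  intros Hx. pose proof (N_pos x Hx) as HN. pose proof (sqrt_lt_R0 _ HN) as Hs.
  pose proof (sqrt_sqrt _ (Rlt_le _ _ HN)) as ES. pose proof (cubic x Hx) as EY.
  transitivity ((9 * (sqrt 6 * sqrt 6) * (W x * (N x - 8 * k * W x ^ 2)) ^ 2
    + Y x ^ 2 * Q x ^ 2) / (sqrt (N x) * sqrt (N x)) ^ 3).
  - unfold sn, cn. field. lra.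
  - rewrite sq6, ES, EY. apply Rmult_eq_reg_r with (N x ^ 3); [|apply pow_nonzero; lra].
    unfold Rdiv. rewrite Rmult_assoc, Rinv_l, Rmult_1_r, Rmult_1_l by (apply pow_nonzero; lra).
    unfold Q, N. replace k with (1 - m) by (unfold m; ring). field.
Qed.

(** cn = 1 would force sn = 0, hence W = 0; there Q is negative and Y <= 0, so that cn <= 0. *)
Lemma cn_lt_1 (x : R) : 0 < x <= Om -> cn x < 1.
Proof.
  intros Hx. pose proof (sn_cn_sq x Hx) as E. pose proof (pow2_ge_0 (sn x)) as H2.
  pose proof (N_pos x Hx) as HN. pose proof (sqrt_lt_R0 _ HN) as Hs.
  pose proof (M_pos x Hx) as HM. pose proof m_bounds as Hm. pose proof k_bounds as Hk.
  assert (Hle : cn x <= 1) by nra.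
  destruct (Rle_lt_or_eq_dec _ _ Hle) as [|Ec]; auto. exfalso.
  assert (Hsn : sn x = 0) by (rewrite Ec in E; nra).
  assert (H3 : 0 < sqrt (N x) ^ 3) by now apply pow_lt.
  assert (HW : W x = 0).
  { unfold sn in Hsn. apply Rmult_integral in Hsn. destruct Hsn as [Hsn|Hsn].
    - assert (0 < N x - 8 * k * W x ^ 2).
      { unfold M in HM. pose proof (pow2_ge_0 (W x)). nra. }
      apply Rmult_integral in Hsn. destruct Hsn as [|Hsn]; [lra|].
      apply Rmult_integral in Hsn. destruct Hsn; lra.
    - pose proof (Rinv_0_lt_compat _ H3). lra. }
  assert (HY : Y x <= 0).
  { destruct (Req_dec x Om) as [->|]; [lra|]. apply Rlt_le, Y_neg. lra. }
  assert (cn x <= 0); [|lra].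
  unfold cn, Q. rewrite HW.
  replace (- (Y x * (0 ^ 3 - 192 * m * 0 - 1024 * m ^ 2)) / sqrt (N x) ^ 3)
    with (- ((- Y x * (1024 * m ^ 2)) * / sqrt (N x) ^ 3)) by (field; lra).
  pose proof (Rinv_0_lt_compat _ H3). pose proof (pow2_ge_0 m).
  assert (0 <= - Y x * (1024 * m ^ 2)) by nra. nra.
Qed.

Lemma is_derive_t (x : R) : 0 < x <= Om -> is_derive t x (tau x).
Proof.
  intros Hx. pose proof (is_derive_sn x Hx) as Hs. pose proof (is_derive_cn x Hx) as Hc.
  pose proof (cn_lt_1 x Hx) as Hc1. pose proof (sn_cn_sq x Hx) as E.
  unfold t. auto_derive; [derivable_hyps; lra|].
  rewrite_derive Hs. rewrite_derive Hc.
  assert (E' : sn x * sn x = 1 - cn x * cn x) by (simpl in E; lra).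
  assert (HD : 1 + sn x * / (1 + - cn x) * (sn x * / (1 + - cn x) * 1) = 2 / (1 - cn x)).
  { replace (sn x * / (1 + - cn x) * (sn x * / (1 + - cn x) * 1))
      with (sn x * sn x * / (1 - cn x) ^ 2) by (field; lra).
    rewrite E'. field. lra. }
  rewrite HD.
  transitivity (- ((cn x * tau x * (1 - cn x) - sn x * sn x * tau x) / (1 - cn x))); [field; lra|].
  rewrite E'. field. lra.
Qed.

Let X (s : R) := / (3 * sqrt 6) * RInt (fun r => PSeries hcoef (k * sin r ^ 2)) 0 s.

Lemma is_derive_X (s : R) : is_derive X s (/ (3 * sqrt 6) * PSeries hcoef (k * sin s ^ 2)).
Proof.
  pose proof k_bounds. unfold X. apply is_derive_scal.
  apply (is_derive_RInt (V := R_NormedModule) (fun r => PSeries hcoef (k * sin r ^ 2))) with 0.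
  - apply filter_forall. intros b. apply (RInt_correct (V := R_CompleteNormedModule)).
    apply ex_RInt_hyp. lra.
  - apply (ex_derive_continuous (K := R_AbsRing) (V := R_NormedModule)), ex_derive_hyp_sin. lra.
Qed.

Lemma sin_t (x : R) : 0 < x <= Om -> sin (t x) = sn x.
Proof.
  intros Hx. pose proof (cn_lt_1 x Hx) as Hc1. pose proof (sn_cn_sq x Hx) as E.
  unfold t. rewrite sin_PI_minus_2atan.
  replace (1 + (sn x / (1 - cn x)) ^ 2) with (2 / (1 - cn x)); [field; lra|].
  replace ((sn x / (1 - cn x)) ^ 2) with (sn x ^ 2 / (1 - cn x) ^ 2) by (field; lra).
  replace (sn x ^ 2) with (1 - cn x ^ 2) by lra. field. lra.
Qed.

(** The chain rule gives the hypergeometric value at k sn^2 times M / N. The former is 1 / (1 - 4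
    u^2) by [hyp_algebraic], the latter is 1 - 4 u^2. *)
Lemma is_derive_X_t (x : R) : 0 < x <= Om -> is_derive (fun x => X (t x)) x 1.
Proof.
  intros Hx. evar_last.
  - apply (is_derive_comp X t); [apply is_derive_X|now apply is_derive_t].
  - unfold scal; simpl; unfold mult; simpl. rewrite sin_t by auto.
    pose proof (N_pos x Hx) as HN. pose proof (sqrt_lt_R0 _ HN) as Hs.
    pose proof (M_pos x Hx) as HM. pose proof (sqrt_sqrt _ (Rlt_le _ _ HN)) as ES.
    set (u := sqrt 6 * kappa * W x / sqrt (N x)).
    assert (Eu2 : u ^ 2 = 6 * k * W x ^ 2 / N x).
    { unfold u. transitivity ((sqrt 6 * sqrt 6) * kappa ^ 2 * W x ^ 2 / (sqrt (N x) * sqrt (N x)));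
        [field; lra|]. rewrite sq6, ES. reflexivity. }
    assert (Eu : 1 - 4 * u ^ 2 = M x / N x) by (rewrite Eu2; unfold M; field; lra).
    assert (Hu : 4 * u ^ 2 < 1).
    { assert (0 < M x / N x) by now apply Rdiv_lt_0_compat. lra. }
    pose proof (hyp_algebraic u Hu) as H.
    replace ((3 * u - 4 * u ^ 3) ^ 2) with (k * sn x ^ 2) in H.
    + rewrite Eu in H. unfold tau.
      transitivity (PSeries hcoef (k * sn x ^ 2) * (M x / N x)); [|exact H].
      simpl. field. repeat split; lra.
    + replace (3 * u - 4 * u ^ 3) with (u * (3 - 4 * u ^ 2)) by ring.
      rewrite Eu2. unfold sn, u, k.
      transitivity ((kappa * (sqrt 6 * W x / sqrt (N x)) *
        (3 * (N x - 8 * kappa ^ 2 * W x ^ 2) / (sqrt (N x) * sqrt (N x)))) ^ 2); [field; lra|].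
      rewrite ES. field. lra.
Qed.

(** sn is at most 3 sqrt 6 / sqrt W, and t is at most 2 sn as soon as cn >= 0. The threshold 20
    makes Q positive, hence cn nonnegative. *)
Lemma t_small (x : R) : 0 < x < Om -> 20 <= W x -> 0 <= t x <= 6 * sqrt 6 / sqrt (W x).
Proof.
  intros Hx HW. assert (Hx' : 0 < x <= Om) by lra.
  pose proof (cn_lt_1 x Hx') as Hc1. pose proof (sn_cn_sq x Hx') as E.
  pose proof (N_pos x Hx') as HN. pose proof (sqrt_lt_R0 _ HN) as Hs.
  pose proof (M_pos x Hx') as HM. pose proof (sqrt_sqrt _ (Rlt_le _ _ HN)) as ES.
  pose proof m_bounds as Hm. pose proof k_bounds as Hk. pose proof (Y_neg x Hx) as HY.
  assert (H3 : 0 < / sqrt (N x) ^ 3) by now apply Rinv_0_lt_compat, pow_lt.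
  assert (HQ : 0 < Q x).
  { unfold Q. assert (400 * W x <= W x ^ 3) by nra. assert (192 * m * W x <= 192 * W x) by nra.
    assert (1024 * m ^ 2 <= 1024) by nra. nra. }
  assert (Hcn : 0 <= cn x).
  { unfold cn. replace (- (Y x * Q x) / sqrt (N x) ^ 3) with ((- Y x * Q x) * / sqrt (N x) ^ 3)
      by (field; lra). apply Rmult_le_pos; [|lra]. apply Rmult_le_pos; lra. }
  assert (HNk : 0 < N x - 8 * k * W x ^ 2 <= N x).
  { unfold M in HM. pose proof (pow2_ge_0 (W x)). split; nra. }
  assert (Hsn : 0 < sn x).
  { unfold sn, Rdiv. apply Rmult_lt_0_compat; [|lra].
    apply Rmult_lt_0_compat; [lra|]. apply Rmult_lt_0_compat; lra. }
  assert (HsW : 0 < sqrt (W x)) by (apply sqrt_lt_R0; lra).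
  pose proof (sqrt_sqrt (W x) ltac:(lra)) as EW.
  assert (Hsle : sn x <= 3 * sqrt 6 / sqrt (W x)).
  { apply Rle_trans with (3 * sqrt 6 * (W x / sqrt (N x))).
    - unfold sn. replace (3 * sqrt 6 * (W x * (N x - 8 * k * W x ^ 2)) / sqrt (N x) ^ 3)
        with (3 * sqrt 6 * W x * / sqrt (N x) ^ 3 * (N x - 8 * k * W x ^ 2)) by (field; lra).
      apply Rle_trans with (3 * sqrt 6 * W x * / sqrt (N x) ^ 3 * N x).
      + apply Rmult_le_compat_l; [|lra]. apply Rmult_le_pos; [|lra]. apply Rmult_le_pos; lra.
      + rewrite <- ES at 2. right. field. lra.
    - unfold Rdiv at 2. apply Rmult_le_compat_l; [lra|].
      apply Rmult_le_reg_r with (sqrt (N x) * sqrt (W x)); [nra|].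
      replace (W x / sqrt (N x) * (sqrt (N x) * sqrt (W x))) with (W x * sqrt (W x)) by (field; lra).
      replace (/ sqrt (W x) * (sqrt (N x) * sqrt (W x))) with (sqrt (N x)) by (field; lra).
      rewrite <- (sqrt_square (W x)) at 1 by lra. rewrite <- sqrt_mult by nra.
      apply sqrt_le_1; [nra|lra|]. unfold N. pose proof (pow2_ge_0 (W x)).
      assert (0 <= m * W x) by nra. pose proof (pow2_ge_0 m). simpl. nra. }
  set (z := sn x / (1 - cn x)).
  assert (Hz : 0 < z) by (apply Rdiv_lt_0_compat; lra).
  assert (Ht : t x = 2 * atan (/ z)) by (rewrite atan_inv by auto; unfold t; fold z; field).
  assert (Hiz : 0 < / z) by now apply Rinv_0_lt_compat.
  assert (Hz2 : / z <= sn x).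
  { replace (/ z) with ((1 - cn x) / sn x) by (unfold z; field; lra).
    apply Rmult_le_reg_r with (sn x); auto.
    unfold Rdiv. rewrite Rmult_assoc, Rinv_l, Rmult_1_r by lra. nra. }
  pose proof (atan_le_id (/ z) ltac:(lra)).
  assert (0 < atan (/ z)) by (rewrite <- atan_0; now apply atan_increasing).
  rewrite Ht. split; [lra|]. replace (6 * sqrt 6 / sqrt (W x)) with (2 * (3 * sqrt 6 / sqrt (W x)))
    by (field; lra). lra.
Qed.

(** Y = 0 gives cn = 0, and the cubic then forces W < 0, hence sn = -1: the angle is 3 PI / 2 rather
    than PI / 2. *)
Lemma t_Om : t Om = 3 * (PI / 2).
Proof.
  assert (Hx : 0 < Om <= Om) by lra.
  pose proof (sn_cn_sq Om Hx) as E. pose proof (N_pos Om Hx) as HN.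
  pose proof (sqrt_lt_R0 _ HN) as Hs. pose proof (M_pos Om Hx) as HM. pose proof k_bounds as Hk.
  assert (Hcn : cn Om = 0) by (unfold cn; rewrite Y_Om; field; lra).
  assert (HW : W Om < 0).
  { pose proof (cubic Om Hx) as H. rewrite Y_Om in H. pose proof (line_pos Om Hx) as Hl.
    apply Rnot_le_lt. intros Hge. assert (0 < (3 * W Om + 8 * m) ^ 2) by now apply pow_lt.
    assert (0 <= W Om ^ 3) by now apply pow_le. nra. }
  assert (Hsn : sn Om < 0).
  { assert (H3 : 0 < / sqrt (N Om) ^ 3) by now apply Rinv_0_lt_compat, pow_lt.
    assert (HNk : 0 < N Om - 8 * k * W Om ^ 2).
    { unfold M in HM. pose proof (pow2_ge_0 (W Om)). nra. }
    unfold sn. replace (3 * sqrt 6 * (W Om * (N Om - 8 * k * W Om ^ 2)) / sqrt (N Om) ^ 3)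
      with (W Om * (3 * sqrt 6 * (N Om - 8 * k * W Om ^ 2) * / sqrt (N Om) ^ 3)) by (field; lra).
    assert (0 < 3 * sqrt 6 * (N Om - 8 * k * W Om ^ 2) * / sqrt (N Om) ^ 3).
    { apply Rmult_lt_0_compat; [|lra]. apply Rmult_lt_0_compat; lra. }
    nra. }
  assert (Esn : sn Om = -1) by (rewrite Hcn in E; nra).
  unfold t. rewrite Esn, Hcn. replace (-1 / (1 - 0)) with (- (1)) by field.
  rewrite atan_opp, atan_1. field.
Qed.

Lemma abs_X_le (s : R) : 0 <= s -> Rabs (X s) <= / (3 * sqrt 6) * (s * / (1 - k)).
Proof.
  intros Hs. pose proof k_bounds as Hk. unfold X.
  assert (0 < / (3 * sqrt 6)) by (apply Rinv_0_lt_compat; lra).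
  rewrite Rabs_mult, Rabs_pos_eq by lra. apply Rmult_le_compat_l; [lra|].
  replace s with (s - 0) at 2 by ring. apply abs_RInt_le_const; auto.
  - apply ex_RInt_hyp. lra.
  - intros r _. assert (Hr : 0 <= k * sin r ^ 2 <= k).
    { pose proof (SIN_bound r). assert (0 <= sin r ^ 2 <= 1) by (split; [apply pow2_ge_0|nra]). nra. }
    unfold PSeries. rewrite <- Series_geom by (rewrite Rabs_pos_eq; lra).
    apply Series_abs_le; [|apply ex_series_geom; rewrite Rabs_pos_eq; lra].
    intros n. pose proof (hcoef_bounds n). pose proof (pow_le (k * sin r ^ 2) n ltac:(lra)).
    rewrite Rabs_pos_eq by (apply Rmult_le_pos; lra).
    apply Rle_trans with (1 * (k * sin r ^ 2) ^ n); [apply Rmult_le_compat_r; lra|].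
    rewrite Rmult_1_l. apply pow_incr. lra.
Qed.

Lemma X_t (x : R) : 0 < x <= Om -> X (t x) - x = X (t Om) - Om.
Proof.
  intros Hx.
  assert (H : Rabs ((X (t Om) - Om) - (X (t x) - x)) <= 0 * Rabs (Om - x)).
  { apply mvt_bound with (g := fun x => X (t x) - x) (dg := fun _ => 0).
    - intros z Hz. rewrite Rmin_left, Rmax_right in Hz by lra. evar_last.
      + apply (is_derive_minus (V := R_NormedModule) (fun x => X (t x))); [apply is_derive_X_t; lra|].
        apply @is_derive_id.
      + unfold minus, plus, opp, one; simpl. ring.
    - intros z _. rewrite Rabs_R0. lra. }
  rewrite Rmult_0_l in H. pose proof (Rabs_pos ((X (t Om) - Om) - (X (t x) - x))).
  assert (E : Rabs ((X (t Om) - Om) - (X (t x) - x)) = 0) by lra.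
  apply Rabs_eq_0 in E. lra.
Qed.

(** X (t x) - x is constant. As x tends to 0 the pole of W drives t to 0, and X (t x) with it, so
    the constant is 0; at [Om] the integral is given by [hyp_period]. *)
Lemma period_formula : Om = / (2 * sqrt 6) * PI * hyp2F1 (1/3) (2/3) 1 (kappa ^ 2).
Proof.
  pose proof k_bounds as Hk.
  assert (E : X (t Om) - Om = 0).
  { set (c := X (t Om) - Om). set (K := / (3 * sqrt 6) * / (1 - k) * (6 * sqrt 6)).
    assert (HK : 0 < K).
    { unfold K. repeat apply Rmult_lt_0_compat; try apply Rinv_0_lt_compat; lra. }
    assert (Hb : forall e, 0 < e -> Rabs c <= 2 * e).
    (* W > B makes K / sqrt W at most e, and 20 is the threshold of [t_small]. *)
    { intros e He. set (B := Rmax 20 ((K / e) ^ 2)).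
      destruct (W_pole B) as [d [Hd HW]].
      set (x := Rmin (d / 2) (Rmin (Om / 2) e)).
      assert (Hx : 0 < x) by (repeat apply Rmin_pos; lra).
      assert (Hxd : x <= d / 2) by apply Rmin_l.
      assert (Hx2 : x <= Rmin (Om / 2) e) by apply Rmin_r.
      pose proof (Rmin_l (Om / 2) e). pose proof (Rmin_r (Om / 2) e).
      specialize (HW x ltac:(lra)).
      assert (H20 : 20 <= B) by apply Rmax_l. assert (HKe : (K / e) ^ 2 <= B) by apply Rmax_r.
      pose proof (t_small x ltac:(lra) ltac:(lra)) as Ht.
      pose proof (X_t x ltac:(lra)) as HX. fold c in HX. rewrite <- HX.
      pose proof (abs_X_le (t x) (proj1 Ht)) as HXt.
      assert (HsW : K / e <= sqrt (W x)).
      { assert (0 < K / e) by now apply Rdiv_lt_0_compat.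
        rewrite <- (sqrt_pow2 (K / e)) by lra. apply sqrt_le_1; [apply pow2_ge_0|lra|lra]. }
      assert (HsW0 : 0 < sqrt (W x)) by (apply sqrt_lt_R0; lra).
      assert (H1 : Rabs (X (t x)) <= K * / sqrt (W x)).
      { eapply Rle_trans; [exact HXt|].
        replace (K * / sqrt (W x)) with (/ (3 * sqrt 6) * (6 * sqrt 6 / sqrt (W x) * / (1 - k)))
          by (unfold K; field; repeat split; lra).
        apply Rmult_le_compat_l; [apply Rlt_le, Rinv_0_lt_compat; lra|].
        apply Rmult_le_compat_r; [apply Rlt_le, Rinv_0_lt_compat; lra|lra]. }
      assert (H2 : K * / sqrt (W x) <= e).
      { apply Rmult_le_reg_r with (sqrt (W x)); auto.
        rewrite Rmult_assoc, Rinv_l, Rmult_1_r by lra.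
        apply Rmult_le_reg_l with (/ e); [now apply Rinv_0_lt_compat|].
        rewrite <- Rmult_assoc, Rinv_l, Rmult_1_l by lra. unfold Rdiv in HsW. lra. }
      unfold Rminus. eapply Rle_trans; [apply Rabs_triang|].
      rewrite Rabs_Ropp, (Rabs_pos_eq x) by lra. lra. }
    destruct (Req_dec c 0) as [|Hc]; auto. exfalso.
    pose proof (Rabs_pos_lt c Hc). specialize (Hb (Rabs c / 4) ltac:(lra)). lra. }
  rewrite t_Om in E. unfold X in E. rewrite hyp_period in E by lra.
  unfold k in E. rewrite <- (Rminus_diag_uniq _ _ E). field. lra.
Qed.

End Period.

(** * The Weierstrass function on a half period and the period formula for its lattice *)

Lemma half_sum_0_le_2 (L x : R) : 0 < L -> 0 < x -> half_sum L 0 x <= half_sum L 2 x.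
Proof.
  intros HL Hx. apply Series_le; [|now apply ex_half_sum].
  intros n. pose proof (pos_INR n) as Hn. assert (Hy : 0 < x + INR n * L) by nra.
  split; [now apply Rlt_le, psi_pos|].
  unfold psi. apply Rmult_le_compat_r; [now apply Rlt_le, csch2_pos|].
  apply Rle_pow; [now apply coth_ge_1|lia].
Qed.

(** [half_sum L 1] is decreasing, because its derivative is [half_sum L 0] minus three times
    [half_sum L 2]; and x lies to the left of L - x. *)
Lemma wp'_neg (L x : R) : 0 < x < L / 2 -> wp' L x < 0.
Proof.
  intros Hx.
  destruct (MVT_gen (half_sum L 1) x (L - x) (dhalf L 1)) as [c [Hc E]];
    rewrite ?Rmin_left, ?Rmax_right in * by lra.
  - intros z Hz. apply is_derive_half_sum; lra.
  - intros z Hz. apply derivable_continuous_pt. exists (dhalf L 1 z).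
    apply is_derive_Reals, is_derive_half_sum; lra.
  - pose proof (half_sum_0_le_2 L c ltac:(lra) ltac:(lra)).
    pose proof (half_sum_pos L c 0 ltac:(lra) ltac:(lra)).
    assert (dhalf L 1 c < 0) by (unfold dhalf; simpl; lra).
    unfold wp'. nra.
Qed.

Lemma wp_pole (L B : R) : 0 < L -> exists d, 0 < d /\ forall x, 0 < x < d -> B < wp L x.
Proof.
  intros HL. set (Z := Series (fun n => 2 * / (INR n + 1) ^ 2)).
  set (q := 1 + Rabs (B + Z - coefC L)).
  assert (Hq : 1 <= q) by (unfold q; pose proof (Rabs_pos (B + Z - coefC L)); lra).
  assert (Hiq : 0 < / q <= 1)
    by (split; [apply Rinv_0_lt_compat; lra|rewrite <- Rinv_1; apply Rinv_le_contravar; lra]).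
  exists (Rmin L (/ q)). split; [apply Rmin_pos; lra|].
  intros x Hx. pose proof (Rmin_l L (/ q)). pose proof (Rmin_r L (/ q)).
  unfold wp, full_sum. rewrite half_sum_shift, csch2_row by lra.
  pose proof (half_sum_pos L (L + x) 0 ltac:(lra) ltac:(lra)).
  pose proof (half_sum_pos L (L - x) 0 ltac:(lra) ltac:(lra)).
  assert (Hr : Rabs (row 2 x) <= Z).
  { apply Series_abs_le; [|apply ex_series_inv_square_scal]. intros n. now apply row_term_le. }
  apply Rabs_le_between in Hr.
  assert (q < / x ^ 2).
  { rewrite <- (Rinv_inv q). apply Rinv_lt_contravar; [apply Rmult_lt_0_compat; [nra|lra]|nra]. }
  pose proof (Rle_abs (B + Z - coefC L)). unfold q in *. lra.
Qed.

(** The Weierstrass function of s (L Z + i PI Z) is s^-2 wp (x / s). [W] subtracts from it the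
    abscissa 6 of the 3-torsion point, and [Y] is half the derivative. *)
Lemma period_of_invariants (kappa L s : R) : 0 < kappa < 1 -> 0 < L -> 0 < s ->
  g2 L = s ^ 4 * (48 * (1 + 8 * kappa ^ 2)) ->
  g3 L = s ^ 6 * (64 * (1 - 20 * kappa ^ 2 - 8 * kappa ^ 4)) ->
  s * L / 2 = / (2 * sqrt 6) * PI * hyp2F1 (1/3) (2/3) 1 (kappa ^ 2).
Proof.
  intros Hk HL Hs H2 H3.
  set (W := fun x => (/ s) ^ 2 * wp L (/ s * x) - 6).
  set (Y := fun x => (/ s) ^ 3 * wp' L (/ s * x) / 2).
  assert (His : 0 < / s) by now apply Rinv_0_lt_compat.
  assert (Hdom : forall x, 0 < x <= s * L / 2 -> 0 < / s * x <= L / 2).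
  { intros x Hx. split; [nra|]. apply Rmult_le_reg_l with s; auto.
    rewrite <- Rmult_assoc, Rinv_r by lra. lra. }
  apply period_formula with (W := W) (Y := Y); try lra.
  - nra.
  - intros x Hx. specialize (Hdom x Hx). unfold W, Y. evar_last.
    + apply (is_derive_minus (V := R_NormedModule)); [|apply @is_derive_const].
      apply is_derive_scal. apply (is_derive_comp (wp L) (fun x => / s * x)).
      * apply is_derive_wp. lra.
      * auto_derive; [auto|reflexivity].
    + unfold minus, plus, opp, zero, scal; simpl. unfold mult; simpl. field. lra.
  - intros x Hx. specialize (Hdom x Hx). unfold W, Y. evar_last.
    + apply is_derive_ext with (fun x => ((/ s) ^ 3 / 2) * wp' L (/ s * x)).
      * intros z. match goal with |- ?a = ?b => change (@eq R a b) end. field. lra.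
      * apply is_derive_scal. apply (is_derive_comp (wp' L) (fun x => / s * x)).
        -- apply is_derive_wp'. lra.
        -- auto_derive; [auto|reflexivity].
    + unfold scal; simpl. unfold mult; simpl. rewrite H2. field. lra.
  - intros x Hx. specialize (Hdom x Hx). unfold W, Y.
    replace (((/ s) ^ 3 * wp' L (/ s * x) / 2) ^ 2)
      with ((/ s) ^ 6 * wp' L (/ s * x) ^ 2 / 4) by (field; lra).
    rewrite wp_equation by lra. rewrite H2, H3. field. lra.
  - intros x Hx. assert (Hd : 0 < / s * x < L / 2).
    { split; [nra|]. apply Rmult_lt_reg_l with s; auto.
      rewrite <- Rmult_assoc, Rinv_r by lra. lra. }
    pose proof (wp'_neg L _ Hd). unfold Y.
    assert (0 < (/ s) ^ 3) by now apply pow_lt. nra.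
  - unfold Y. replace (/ s * (s * L / 2)) with (L / 2) by (field; lra).
    unfold wp'. replace (L - L / 2) with (L / 2) by field. field. lra.
  - intros B. destruct (wp_pole L (s ^ 2 * (B + 6)) HL) as [d [Hd HB]].
    exists (s * d). split; [nra|]. intros x Hx.
    assert (Hx' : 0 < / s * x < d).
    { split; [nra|]. apply Rmult_lt_reg_l with s; auto.
      rewrite <- Rmult_assoc, Rinv_r by lra. lra. }
    specialize (HB _ Hx'). unfold W.
    assert (0 < (/ s) ^ 2) by now apply pow_lt.
    assert (E : B + 6 = (/ s) ^ 2 * (s ^ 2 * (B + 6))) by (field; lra).
    nra.
Qed.

(** * Existence of a rectangular lattice with given invariants *)

(** The common shape of the three sums through which the invariants depend on L, so that continuity
    and the limit at infinity are proved once. *)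
Definition theta_sum (a : nat) (w v : nat -> R) (L : R) : R :=
  Series (fun n => w n * psi a (v n * L)).

(** Nodes comparable with n + 1 and weights at most n + 1: the decay of fourth order of [psi] then
    leaves terms of order n^-2, even after differentiation in L has produced a factor [v n]. *)
Definition admissible (w v : nat -> R) : Prop :=
  forall n, 0 <= w n <= INR n + 1 /\ (INR n + 1) / 2 <= v n <= INR n + 1.

Lemma psi_scaled_le (a b n : nat) (v L : R) : (a <= b)%nat -> 1 <= L -> (INR n + 1) / 2 <= v ->
  0 < psi a (v * L) <= 5 ^ b * 64 * / (INR n + 1) ^ 4 * / L ^ 4.
Proof.
  intros Hab HL Hv. pose proof (pos_INR n) as Hn.
  assert (Hy : 1 / 2 <= v * L) by nra.
  split; [apply psi_pos; lra|].
  eapply Rle_trans; [apply (psi_le4 (1/2) _ a b); auto; lra|].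
  replace (1 + / (1 / 2) ^ 2) with 5 by field.
  rewrite !Rmult_assoc. apply Rmult_le_compat_l; [apply pow_le; lra|].
  replace (64 * (/ (INR n + 1) ^ 4 * / L ^ 4)) with (4 * / (((INR n + 1) / 2) * L) ^ 4)
    by (field; lra).
  apply Rmult_le_compat_l; [lra|].
  apply Rinv_le_contravar; [apply pow_lt; nra|apply pow_incr; nra].
Qed.

Lemma inv_pow4_weight_le (n : nat) (w : R) : 0 <= w <= (INR n + 1) ^ 2 ->
  w * / (INR n + 1) ^ 4 <= / (INR n + 1) ^ 2.
Proof.
  intros Hw. pose proof (pos_INR n).
  replace (/ (INR n + 1) ^ 2) with ((INR n + 1) ^ 2 * / (INR n + 1) ^ 4) by (field; lra).
  apply Rmult_le_compat_r; [apply Rlt_le, Rinv_0_lt_compat, pow_lt; lra|lra].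
Qed.

Lemma theta_term_le (a n : nat) (w v : nat -> R) (L : R) : admissible w v -> 1 <= L ->
  Rabs (w n * psi a (v n * L)) <= 5 ^ a * 64 * / L ^ 4 * / (INR n + 1) ^ 2.
Proof.
  intros Hadm HL. destruct (Hadm n) as [Hw Hv]. pose proof (pos_INR n) as Hn.
  pose proof (psi_scaled_le a a n (v n) L ltac:(lia) HL ltac:(lra)) as Hp.
  assert (0 < 5 ^ a) by (apply pow_lt; lra).
  assert (0 < / L ^ 4) by (apply Rinv_0_lt_compat, pow_lt; lra).
  rewrite Rabs_pos_eq by (apply Rmult_le_pos; lra).
  apply Rle_trans with (w n * (5 ^ a * 64 * / (INR n + 1) ^ 4 * / L ^ 4)).
  - apply Rmult_le_compat_l; lra.
  - replace (w n * (5 ^ a * 64 * / (INR n + 1) ^ 4 * / L ^ 4))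
      with (5 ^ a * 64 * / L ^ 4 * (w n * / (INR n + 1) ^ 4)) by ring.
    apply Rmult_le_compat_l; [nra|]. apply inv_pow4_weight_le. nra.
Qed.

Lemma ex_theta_sum (a : nat) (w v : nat -> R) (L : R) : admissible w v -> 1 <= L ->
  ex_series (fun n => w n * psi a (v n * L)).
Proof.
  intros Hadm HL. eapply ex_series_abs_le; [intros n; now apply theta_term_le|].
  apply ex_series_inv_square_scal.
Qed.

Lemma theta_sum_lim (a : nat) (w v : nat -> R) : admissible w v ->
  is_lim_seq (fun N => theta_sum a w v (INR N + 1)) 0.
Proof.
  intros Hadm. apply is_lim_seq_abs_0.
  set (K := 5 ^ a * 64 * Series (fun n => / (INR n + 1) ^ 2)).
  apply is_lim_seq_le_le with (u := fun _ => 0) (w := fun N => K * / (INR N + 1)).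
  - intros N. split; [apply Rabs_pos|]. pose proof (pos_INR N) as HN.
    unfold theta_sum.
    eapply Rle_trans; [apply Series_abs_le;
      [intros n; apply theta_term_le; [auto|lra]|apply ex_series_inv_square_scal]|].
    rewrite Series_scal_l. unfold K.
    replace (5 ^ a * 64 * Series (fun n => / (INR n + 1) ^ 2) * / (INR N + 1))
      with (5 ^ a * 64 * / (INR N + 1) * Series (fun n => / (INR n + 1) ^ 2)) by ring.
    apply Rmult_le_compat_r.
    + apply Series_nonneg; [|apply ex_series_inv_square].
      intros n. apply Rlt_le, Rinv_0_lt_compat, pow_lt. pose proof (pos_INR n). lra.
    + apply Rmult_le_compat_l; [pose proof (pow_lt 5 a ltac:(lra)); lra|].
      apply Rinv_le_contravar; [lra|]. rewrite <- (pow_1 (INR N + 1)) at 1.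
      apply Rle_pow; [lra|lia].
  - apply is_lim_seq_const.
  - replace (Finite 0) with (Rbar_mult K 0) by (simpl; f_equal; ring).
    apply is_lim_seq_scal_l.
    apply is_lim_seq_ext with (fun n => / INR (S n)); [intros n; now rewrite S_INR|].
    apply (proj1 (is_lim_seq_incr_1 (fun n => / INR n) 0)).
    replace (Finite 0) with (Rbar_inv p_infty) by reflexivity.
    apply is_lim_seq_inv; [apply is_lim_seq_INR|discriminate].
Qed.

(** The mean value theorem in each term. The range L >= 1 suffices, since the modulus is sought from
    L = PI onwards. *)
Lemma theta_sum_lipschitz (a : nat) (w v : nat -> R) (L L' : R) : admissible w v ->
  1 <= L -> 1 <= L' ->
  Rabs (theta_sum a w v L' - theta_sum a w v L)
    <= (2 * INR a + 2) * (5 ^ S a * 64) * Series (fun n => / (INR n + 1) ^ 2) * Rabs (L' - L).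
Proof.
  intros Hadm HL HL'. unfold theta_sum. rewrite <- Series_minus by now apply ex_theta_sum.
  set (K := (2 * INR a + 2) * (5 ^ S a * 64)).
  replace (K * Series (fun n => / (INR n + 1) ^ 2) * Rabs (L' - L))
    with (K * Rabs (L' - L) * Series (fun n => / (INR n + 1) ^ 2)) by ring.
  rewrite <- Series_scal_l. apply Series_abs_le; [|apply ex_series_inv_square_scal].
  intros n. destruct (Hadm n) as [Hw Hv]. pose proof (pos_INR n) as Hn. pose proof (pos_INR a) as Ha.
  assert (Hi4 : 0 < / (INR n + 1) ^ 4) by (apply Rinv_0_lt_compat, pow_lt; lra).
  assert (HK : 0 < K).
  { unfold K. pose proof (pow_lt 5 (S a) ltac:(lra)). apply Rmult_lt_0_compat; lra. }
  rewrite <- Rmult_minus_distr_l, Rabs_mult, (Rabs_pos_eq (w n)) by lra.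
  apply Rle_trans with (w n * (v n * (K * / (INR n + 1) ^ 4) * Rabs (L' - L))).
  - apply Rmult_le_compat_l; [lra|].
    apply mvt_bound with (g := fun z => psi a (v n * z)) (dg := fun z => v n * dpsi a (v n * z)).
    + intros z Hz. apply (is_derive_comp (psi a) (fun z => v n * z)).
      * apply is_derive_psi. assert (1 <= z); [|nra].
        eapply Rle_trans; [|apply (proj1 Hz)]. apply Rmin_glb; lra.
      * auto_derive; [auto|ring].
    + intros z Hz. assert (Hz1 : 1 <= z)
        by (eapply Rle_trans; [|apply (proj1 Hz)]; apply Rmin_glb; lra).
      rewrite Rabs_mult, (Rabs_pos_eq (v n)) by lra. apply Rmult_le_compat_l; [lra|].
      assert (Hb : forall b, (b <= S a)%nat -> psi b (v n * z) <= 5 ^ S a * 64 * / (INR n + 1) ^ 4).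
      { intros b Hb. pose proof (psi_scaled_le b (S a) n (v n) z Hb Hz1 ltac:(lra)) as H.
        eapply Rle_trans; [apply H|]. rewrite <- (Rmult_1_r (5 ^ S a * 64 * / (INR n + 1) ^ 4)) at 2.
        apply Rmult_le_compat_l.
        - pose proof (pow_lt 5 (S a) ltac:(lra)). apply Rmult_le_pos; lra.
        - rewrite <- Rinv_1. apply Rinv_le_contravar; [lra|]. rewrite <- (pow1 4). apply pow_incr. lra. }
      unfold K. rewrite (Rmult_assoc (2 * INR a + 2)).
      apply abs_dpsi_le; [nra|apply Hb; lia|apply Hb; lia].
  - replace (w n * (v n * (K * / (INR n + 1) ^ 4) * Rabs (L' - L)))
      with (K * Rabs (L' - L) * (w n * v n * / (INR n + 1) ^ 4)) by ring.
    apply Rmult_le_compat_l; [apply Rmult_le_pos; [lra|apply Rabs_pos]|].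
    apply inv_pow4_weight_le. split; [nra|].
    replace ((INR n + 1) ^ 2) with ((INR n + 1) * (INR n + 1)) by ring.
    apply Rmult_le_compat; lra.
Qed.

Lemma theta_sum_continuous (a : nat) (w v : nat -> R) (L : R) : admissible w v -> 1 < L ->
  continuity_pt (theta_sum a w v) L.
Proof.
  intros Hadm HL eps Heps.
  set (K := (2 * INR a + 2) * (5 ^ S a * 64) * Series (fun n => / (INR n + 1) ^ 2)).
  assert (HK : 0 <= K).
  { unfold K. pose proof (pow_lt 5 (S a) ltac:(lra)). pose proof (pos_INR a).
    apply Rmult_le_pos; [apply Rmult_le_pos; lra|].
    apply Series_nonneg; [|apply ex_series_inv_square].
    intros n. apply Rlt_le, Rinv_0_lt_compat, pow_lt. pose proof (pos_INR n). lra. }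
  set (d := Rmin (L - 1) (eps / (K + 1))).
  assert (Hq : 0 < eps / (K + 1)) by (apply Rdiv_lt_0_compat; lra).
  exists d. split; [apply Rmin_pos; lra|].
  intros x [_ Hx]. simpl in Hx. unfold R_dist in *. simpl.
  assert (Hd1 : d <= L - 1) by apply Rmin_l. assert (Hd2 : d <= eps / (K + 1)) by apply Rmin_r.
  assert (HxL : 1 <= x) by (apply Rabs_def2 in Hx; lra).
  eapply Rle_lt_trans; [apply theta_sum_lipschitz; auto; lra|]. fold K.
  pose proof (Rabs_pos (x - L)).
  apply Rle_lt_trans with ((K + 1) * Rabs (x - L)); [nra|].
  apply Rlt_le_trans with ((K + 1) * (eps / (K + 1))); [apply Rmult_lt_compat_l; lra|].
  right. field. lra.
Qed.

Lemma admissible_A : admissible (fun _ => 1) (fun n => INR n + 1).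
Proof. intros n. pose proof (pos_INR n). lra. Qed.

Lemma admissible_B : admissible (fun n => INR n + 1) (fun n => INR n + 1).
Proof. intros n. pose proof (pos_INR n). lra. Qed.

Lemma admissible_E : admissible (fun _ => 1) (fun n => INR n + 1 / 2).
Proof. intros n. pose proof (pos_INR n). lra. Qed.

Definition thA : R -> R := theta_sum 0 (fun _ => 1) (fun n => INR n + 1).

Definition thB : R -> R := theta_sum 1 (fun n => INR n + 1) (fun n => INR n + 1).

(** This is [half_sum L 0 (L / 2)], which carries the value of [wp] at the half period and thereby
    [g3]. *)
Definition thE : R -> R := theta_sum 0 (fun _ => 1) (fun n => INR n + 1 / 2).


Lemma g2_theta (L : R) : g2 L = 12 * ((1 / 3 - 2 * thA L) ^ 2 + 8 * thB L).
Proof.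
  unfold g2, coefC, coefA, coefB. rewrite half_sum_L.
  replace (Series (fun n => psi 0 ((INR n + 1) * L))) with (thA L); [reflexivity|].
  apply Series_ext. intros n. ring.
Qed.

Lemma g3_theta (L : R) :
  g3 L = 4 * (2 * thE L + (1 / 3 - 2 * thA L)) ^ 3 - g2 L * (2 * thE L + (1 / 3 - 2 * thA L)).
Proof.
  assert (E : wp L (L / 2) = 2 * thE L + (1 / 3 - 2 * thA L)).
  { unfold wp, full_sum, coefC, coefA. rewrite half_sum_L.
    replace (L - L / 2) with (L / 2) by field.
    replace (Series (fun n => psi 0 ((INR n + 1) * L))) with (thA L)
      by (apply Series_ext; intros n; ring).
    replace (half_sum L 0 (L / 2)) with (thE L); [ring|].
    apply Series_ext. intros n. rewrite Rmult_1_l. f_equal. field. }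
  unfold g3. now rewrite E.
Qed.

Lemma g2_pos (L : R) : 0 < L -> 0 < g2 L.
Proof.
  intros HL. unfold g2, coefB.
  assert (0 < Series (fun n => (INR n + 1) * psi 1 ((INR n + 1) * L))).
  { apply Series_pos; [intros n; now apply weight_psi1_le|now apply ex_weight_psi1]. }
  pose proof (pow2_ge_0 (coefC L)). lra.
Qed.

Ltac continuity_theta :=
  lazymatch goal with
  | |- continuity_pt (fun x => @?f x + @?g x) _ => apply (continuity_pt_plus f g); continuity_theta
  | |- continuity_pt (fun x => @?f x - @?g x) _ => apply (continuity_pt_minus f g); continuity_theta
  | |- continuity_pt (fun x => @?f x * @?g x) _ => apply (continuity_pt_mult f g); continuity_theta
  | |- continuity_pt (fun x => thA x) _ =>
      apply theta_sum_continuous; [apply admissible_A|assumption]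
  | |- continuity_pt (fun x => thB x) _ =>
      apply theta_sum_continuous; [apply admissible_B|assumption]
  | |- continuity_pt (fun x => thE x) _ =>
      apply theta_sum_continuous; [apply admissible_E|assumption]
  | |- continuity_pt (fun x => ?c) _ => apply continuity_pt_const; intros ? ?; reflexivity
  end.

Lemma g2_continuous (L : R) : 1 < L -> continuity_pt g2 L.
Proof.
  intros HL. apply continuity_pt_ext with
    (fun L => 12 * ((1 / 3 - 2 * thA L) * (1 / 3 - 2 * thA L) + 8 * thB L)).
  - intros x. rewrite g2_theta. ring.
  - continuity_theta.
Qed.

Lemma g3_continuous (L : R) : 1 < L -> continuity_pt g3 L.
Proof.
  intros HL.
  assert (He : continuity_pt (fun L => 2 * thE L + (1 / 3 - 2 * thA L)) L) by continuity_theta.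
  set (e := fun L => 2 * thE L + (1 / 3 - 2 * thA L)) in He.
  apply continuity_pt_ext with (fun L => 4 * (e L * (e L * e L)) - g2 L * e L).
  - intros x. rewrite g3_theta. unfold e. ring.
  - pose proof (g2_continuous L HL) as H2.
    apply (continuity_pt_minus (fun L => 4 * (e L * (e L * e L))) (fun L => g2 L * e L)).
    + apply (continuity_pt_mult (fun _ => 4) (fun L => e L * (e L * e L)));
        [apply continuity_pt_const; intros ? ?; reflexivity|].
      apply (continuity_pt_mult e (fun L => e L * e L)); auto.
      now apply (continuity_pt_mult e e).
    + now apply (continuity_pt_mult g2 e).
Qed.

(** All three theta sums vanish in the limit and [wp L (L / 2)] tends to 1 / 3. What remains is the
    degenerate cubic of csch^2 x + 1 / 3, for which g2^3 = 27 g3^2. *)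
Lemma invariants_lim :
  is_lim_seq (fun N => g2 (INR N + 1)) (4 / 3) /\ is_lim_seq (fun N => g3 (INR N + 1)) (- (8 / 27)).
Proof.
  pose proof (theta_sum_lim 0 _ _ admissible_A) as HA. fold thA in HA.
  pose proof (theta_sum_lim 1 _ _ admissible_B) as HB. fold thB in HB.
  pose proof (theta_sum_lim 0 _ _ admissible_E) as HE. fold thE in HE.
  assert (HC : is_lim_seq (fun N => 1 / 3 - 2 * thA (INR N + 1)) (1 / 3 - 2 * 0)).
  { apply is_lim_seq_minus'; [apply is_lim_seq_const|]. now apply (is_lim_seq_scal_l _ 2 (Finite 0)). }
  assert (He : is_lim_seq (fun N => 2 * thE (INR N + 1) + (1 / 3 - 2 * thA (INR N + 1)))
    (2 * 0 + (1 / 3 - 2 * 0))).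
  { apply is_lim_seq_plus'; [now apply (is_lim_seq_scal_l _ 2 (Finite 0))|exact HC]. }
  assert (H2 : is_lim_seq (fun N => g2 (INR N + 1)) (4 / 3)).
  { replace (Finite (4 / 3)) with (Finite (12 * ((1 / 3 - 2 * 0) * (1 / 3 - 2 * 0) + 8 * 0)))
      by (f_equal; field).
    apply is_lim_seq_ext with (fun N => 12 * ((1 / 3 - 2 * thA (INR N + 1))
      * (1 / 3 - 2 * thA (INR N + 1)) + 8 * thB (INR N + 1))).
    - intros N. rewrite g2_theta. ring.
    - apply (is_lim_seq_scal_l _ 12 (Finite _)).
      apply is_lim_seq_plus'; [now apply is_lim_seq_mult'|].
      now apply (is_lim_seq_scal_l _ 8 (Finite 0)). }
  split; [exact H2|].
  set (e := 2 * 0 + (1 / 3 - 2 * 0)) in He.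
  replace (Finite (- (8 / 27))) with (Finite (4 * (e * (e * e)) - 4 / 3 * e))
    by (f_equal; unfold e; field).
  eapply is_lim_seq_ext; [intros N; symmetry; apply g3_theta|].
  apply is_lim_seq_minus'; [|now apply is_lim_seq_mult'].
  apply (is_lim_seq_scal_l _ 4 (Finite _)).
  apply is_lim_seq_ext with (fun N => (2 * thE (INR N + 1) + (1 / 3 - 2 * thA (INR N + 1)))
    * ((2 * thE (INR N + 1) + (1 / 3 - 2 * thA (INR N + 1)))
       * (2 * thE (INR N + 1) + (1 / 3 - 2 * thA (INR N + 1))))); [intros; ring|].
  repeat apply is_lim_seq_mult'; exact He.
Qed.

(** The equation says that the two pairs of invariants agree up to scaling and up to the sign of g3.
    For G3 nonzero, [Phi] is negative at the square lattice and tends to 64 / 729 times the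
    discriminant G2^3 - 27 G3^2 at infinity. *)
Lemma exists_modulus (G2 G3 : R) : 0 < G2 -> 0 < G2 ^ 3 - 27 * G3 ^ 2 ->
  exists L, 0 < L /\ g3 L ^ 2 * G2 ^ 3 = G3 ^ 2 * g2 L ^ 3.
Proof.
  intros HG2 Hdisc. pose proof PI2_1 as HPI.
  destruct (Req_dec G3 0) as [->|HG3].
  { exists PI. split; [lra|]. rewrite g3_square. ring. }
  set (Phi := fun L => g3 L * g3 L * G2 ^ 3 - G3 ^ 2 * (g2 L * (g2 L * g2 L))).
  assert (H0 : Phi PI < 0).
  { unfold Phi. rewrite g3_square. pose proof (g2_pos PI ltac:(lra)) as Hg.
    assert (0 < G3 ^ 2) by now apply pow2_gt_0.
    revert Hg. generalize (g2 PI). intros g Hg.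
    assert (0 < g * (g * g)) by (repeat apply Rmult_lt_0_compat; auto).
    assert (0 < G3 ^ 2 * (g * (g * g))) by now apply Rmult_lt_0_compat.
    lra. }
  assert (Hinf : exists b, PI < b /\ 0 < Phi b).
  { destruct invariants_lim as [H2 H3].
    assert (HP : is_lim_seq (fun N => Phi (INR N + 1))
      (- (8 / 27) * - (8 / 27) * G2 ^ 3 - G3 ^ 2 * (4 / 3 * (4 / 3 * (4 / 3))))).
    { unfold Phi. apply is_lim_seq_minus'.
      - apply is_lim_seq_mult'; [now apply is_lim_seq_mult'|apply is_lim_seq_const].
      - apply is_lim_seq_mult'; [apply is_lim_seq_const|]. apply is_lim_seq_mult'; [exact H2|].
        apply is_lim_seq_mult'; exact H2. }
    set (l := - (8 / 27) * - (8 / 27) * G2 ^ 3 - G3 ^ 2 * (4 / 3 * (4 / 3 * (4 / 3)))) in HP.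
    assert (Hl : 0 < l)
      by (replace l with (64 / 729 * (G2 ^ 3 - 27 * G3 ^ 2)) by (unfold l; field); lra).
    apply is_lim_seq_spec in HP. destruct (HP (mkposreal l Hl)) as [N0 HN].
    (* The 4 guarantees [INR N + 1] >= 5, which lies beyond PI. *)
    set (N := max N0 4). exists (INR N + 1). split.
    - assert (INR 4 <= INR N) by (apply le_INR; unfold N; lia). simpl in *. pose proof PI_4. lra.
    - specialize (HN N ltac:(unfold N; lia)). simpl in HN. apply Rabs_def2 in HN. lra. }
  destruct Hinf as [b [Hb Hpos]].
  destruct (Ranalysis5.IVT_interv Phi PI b) as [L [HL E]]; auto.
  - intros a Ha. pose proof (g2_continuous a ltac:(lra)) as C2.
    pose proof (g3_continuous a ltac:(lra)) as C3.
    apply (continuity_pt_minus (fun L => g3 L * g3 L * G2 ^ 3)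
      (fun L => G3 ^ 2 * (g2 L * (g2 L * g2 L)))).
    + apply (continuity_pt_mult (fun L => g3 L * g3 L) (fun _ => G2 ^ 3)).
      * now apply (continuity_pt_mult g3 g3).
      * apply continuity_pt_const; intros ? ?; reflexivity.
    + apply (continuity_pt_mult (fun _ => G3 ^ 2) (fun L => g2 L * (g2 L * g2 L))).
      * apply continuity_pt_const; intros ? ?; reflexivity.
      * apply (continuity_pt_mult g2 (fun L => g2 L * g2 L)); auto.
        now apply (continuity_pt_mult g2 g2).
  - exists L. split; [lra|]. unfold Phi in E. simpl. simpl in E. lra.
Qed.

(** The scale is the fourth root that matches g2. Then g3 is matched up to sign, and a wrong sign is
    repaired by exchanging the two periods. *)
Lemma rectangular_lattice_exists (G2 G3 : R) : 0 < G2 -> 0 < G2 ^ 3 - 27 * G3 ^ 2 ->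
  exists Om T, 0 < Om /\ 0 < T /\ has_invariants (RtoC Om) (0, T) G2 G3.
Proof.
  intros HG2 Hdisc. destruct (exists_modulus G2 G3 HG2 Hdisc) as [L [HL E]].
  pose proof (g2_pos L HL) as Hg2. pose proof PI_RGT_0 as HPI.
  assert (Hq : 0 < g2 L / G2) by now apply Rdiv_lt_0_compat.
  set (s := sqrt (sqrt (g2 L / G2))).
  assert (Hs : 0 < s) by (unfold s; now repeat apply sqrt_lt_R0).
  assert (Hs4 : s ^ 4 = g2 L / G2).
  { replace (s ^ 4) with ((s * s) * (s * s)) by ring. unfold s.
    rewrite sqrt_sqrt by apply sqrt_pos. apply sqrt_sqrt. lra. }
  pose proof (eisen_sum_4 L s HL Hs) as H4. pose proof (eisen_sum_6 L s HL Hs) as H6.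
  assert (E4 : 60 * ((/ s) ^ 4 * eis4 L) = G2).
  { replace (60 * ((/ s) ^ 4 * eis4 L)) with (60 * eis4 L / s ^ 4) by (field; lra).
    rewrite <- g2_eis4, Hs4 by auto. field. lra. }
  assert (E6 : (140 * ((/ s) ^ 6 * eis6 L)) ^ 2 = G3 ^ 2).
  { replace ((140 * ((/ s) ^ 6 * eis6 L)) ^ 2) with ((140 * eis6 L) ^ 2 / (s ^ 4) ^ 3) by (field; lra).
    rewrite <- g3_eis6, Hs4 by auto.
    replace (g3 L ^ 2 / (g2 L / G2) ^ 3) with (g3 L ^ 2 * G2 ^ 3 / g2 L ^ 3) by (field; lra).
    rewrite E. field. lra. }
  assert (HOm : 0 < s * L / 2) by nra. assert (HT : 0 < s * PI / 2) by nra.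
  destruct (Req_dec (140 * ((/ s) ^ 6 * eis6 L)) G3) as [Eq|Neq].
  - exists (s * L / 2), (s * PI / 2). repeat split; auto.
    exists (RtoC ((/ s) ^ 4 * eis4 L)), (RtoC ((/ s) ^ 6 * eis6 L)).
    split; [exact H4|]. split; [exact H6|].
    split; rewrite <- RtoC_mult; f_equal; auto.
  - exists (s * PI / 2), (s * L / 2). repeat split; auto.
    exists (RtoC ((/ s) ^ 4 * eis4 L)), (RtoC (- ((/ s) ^ 6 * eis6 L))).
    split; [now apply eisen_sum_4_swap|]. split; [now apply eisen_sum_6_swap|].
    split; rewrite <- RtoC_mult; f_equal; auto.
    set (p := 140 * ((/ s) ^ 6 * eis6 L)) in *.
    replace (140 * - ((/ s) ^ 6 * eis6 L)) with (- p) by (unfold p; ring).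
    assert (Hz : (p - G3) * (p + G3) = 0).
    { replace ((p - G3) * (p + G3)) with (p ^ 2 - G3 ^ 2) by ring. rewrite E6. ring. }
    apply Rmult_integral in Hz. destruct Hz; lra.
Qed.

Theorem theorem8 (kappa : R) (hk0 : 0 < kappa) (hk1 : kappa < 1) :
  let G2 := 48 * (1 + 8 * kappa ^ 2) in
  let G3 := 64 * (1 - 20 * kappa ^ 2 - 8 * kappa ^ 4) in
  (exists (Om : R) (Om' : C),
      0 < Om /\ Re Om' = 0 /\ 0 < Im Om' /\
      has_invariants (RtoC Om) Om' G2 G3) /\
  (forall (Om : R) (Om' : C),
      0 < Om -> Re Om' = 0 -> 0 < Im Om' ->
      has_invariants (RtoC Om) Om' G2 G3 ->
      Om = / (2 * sqrt 6) * PI * hyp2F1 (1/3) (2/3) 1 (kappa ^ 2)).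
Proof.
  intros G2 G3. split.
  - assert (Hk : 0 < kappa ^ 2 < 1) by (split; nra).
    destruct (rectangular_lattice_exists G2 G3) as (Om & T & HOm & HT & H).
    + unfold G2. lra.
    (* 48^3 and 27 times 64^2 both equal 110592, and with k = kappa^2 one has (1 + 8 k)^3 - (1 - 20
       k - 8 k^2)^2 = 64 k (1 - k)^3. *)
    + replace (G2 ^ 3 - 27 * G3 ^ 2)
        with (110592 * 64 * (kappa ^ 2 * (1 - kappa ^ 2) ^ 3)) by (unfold G2, G3; ring).
      assert (0 < (1 - kappa ^ 2) ^ 3) by (apply pow_lt; lra). nra.
    + exists Om, (0, T). auto.
  - intros Om [a T] HOm Ha HT (s4 & s6 & H4 & H6 & E4 & E6). simpl in Ha, HT. subst a.
    pose proof PI_RGT_0 as HPI.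
    (* Scale and modulus solving s L / 2 = Om and s PI / 2 = T; uniqueness of limits then identifies
       the given sums with those of the normal form. *)
    set (s := 2 * T / PI). set (L := PI * Om / T).
    assert (Hs : 0 < s) by (unfold s; apply Rdiv_lt_0_compat; lra).
    assert (HL : 0 < L) by (unfold L; apply Rdiv_lt_0_compat; nra).
    assert (EOm : Om = s * L / 2) by (unfold s, L; field; lra).
    assert (ET : T = s * PI / 2) by (unfold s; field; lra).
    rewrite EOm, ET in H4, H6.
    rewrite (eisen_sum_unique _ _ _ _ _ H4 (eisen_sum_4 L s HL Hs)) in E4.
    rewrite (eisen_sum_unique _ _ _ _ _ H6 (eisen_sum_6 L s HL Hs)) in E6.
    rewrite <- RtoC_mult in E4, E6. apply (f_equal Re) in E4, E6.
    change (60 * ((/ s) ^ 4 * eis4 L) = G2) in E4. change (140 * ((/ s) ^ 6 * eis6 L) = G3) in E6.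
    rewrite EOm. apply period_of_invariants; auto.
    + rewrite g2_eis4 by auto. fold G2. rewrite <- E4. field. lra.
    + rewrite g3_eis6 by auto. fold G3. rewrite <- E6. field. lra.
Qed.
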